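(* Let $\mathcal B$ be a complex Banach space and let $\mathcal E\ni f\mapsto \mathrm{Op}(f)\in\mathcal L(\mathcal B)$ be a continuous linear map such that (i) $\mathrm{Op}(f_1)\mathrm{Op}(f_2)=\mathrm{Op}(f_1f_2)$ for all $f_1,f_2\in\mathcal E$; (ii) $\sum_{g\in C_0^\infty(\mathbb R)}\mathcal R(\mathrm{Op}(g))$ is dense in $\mathcal B$; (iii) $\bigcap_{g\in C_0^\infty(\mathbb R)}\mathcal N(\mathrm{Op}(g))=0$. Let $P$ be the closed densely defined operator on $\mathcal B$ generated by $\mathrm{Op}$ (defined in the context). Then $\mathrm{Op}(f)=f(P)$ for all $f\in\mathcal E$.
   Context: $\mathcal R$ denotes range, $\mathcal N$ null space; the sum in (ii) is the linear span. $\mathcal E=\mathcal E(\widehat{\mathbb R})$ is the space of $f\in C^\infty(\mathbb R)$ (complex-valued) having an asymptotic expansion $f(x)\sim\sum_0^\infty a_kx^{-k}$ as $x\to\infty$ (the same for $x\to\pm\infty$), $a_k\in\mathbb C$, in the sense that for every $N\in\mathbb N$, $f(x)=\sum_0^Na_kx^{-k}+x^{-N-1}r_{N+1}(x)$ for $|x|>1$, with $r_{N+1}$ bounded together with all its derivatives. Equivalently, $f$ is smooth and $y\mapsto f(-1/y)$ extends to a smooth function on $]-1,1[$. $\mathcal E$ is a Fréchet space with the $C^\infty$-topology of the restriction of $f$ to bounded intervals and the $C^\infty(]-1,1[)$-topology for $f(-1/y)$. Definition of $P$: for $z\in\mathbb C\setminus\mathbb R$ let $\omega_z(x)=1/(z-x)$,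 so $\omega_z\in\mathcal E$. The space $\mathcal D=\mathcal R(\mathrm{Op}(\omega_z))$ is independent of $z\in\mathbb C\setminus\mathbb R$ and dense. For $u=\mathrm{Op}(\omega_z)v\in\mathcal D$, $v\in\mathcal B$, put $Pu=\mathrm{Op}(x\,\omega_z(x))v$, where $x\,\omega_z(x)$ denotes the function $x\mapsto x/(z-x)$; this does not depend on the choice of $z,v$ representing $u$. Then $P$ with domain $\mathcal D$ is closed, $\sigma(P)\subset\mathbb R$, and $\|(z-P)^{-1}\|\le C_0|\Im z|^{-N_0^0}\langle z\rangle^{N_1^0}$ for $z\in\mathbb C\setminus\mathbb R$, for some constants $C_0,N_0^0,N_1^0$, where $\langle z\rangle=(1+|z|^2)^{1/2}$. Definition of $f(P)$ for $f\in\mathcal E$ and such $P$: $$f(P)=a_0\,1-\frac1\pi\int_{\mathbb C}\frac{\partial\tilde f}{\partial\bar z}(z)(z-P)^{-1}L(dz),$$ where $a_0=\lim_{|x|\to\infty}f(x)$, $L$ is Lebesgue measure, and $\tilde f$ is any bounded continuous extension of $f$ to $\mathbb C$ such that $\partial\tilde f/\partial\bar z$ is bounded and $\partial\tilde f/\partial\bar z=\mathcal O_{N_0,N_1}(\langle z\rangle^{-N_1}|\Im z|^{N_0})$ for all $N_0,N_1\in\mathbb N$; such an extension exists and the result does not depend on its choice. *)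

(* Defs.v *)
From HB Require Import structures.
From mathcomp Require Import all_boot all_order all_algebra.
From mathcomp Require Import all_classical all_reals all_analysis.
From mathcomp Require Import complex.

Set Implicit Arguments.
Unset Strict Implicit.
Unset Printing Implicit Defensive.

Import Order.TTheory GRing.Theory Num.Theory numFieldNormedType.Exports.

Local Open Scope classical_set_scope.
Local Open Scope complex_scope.
Local Open Scope ring_scope.

(* The normed-module structure of R[i] over itself, as numFieldNormedType
   provides it for a generic numFieldType. *)
#[warnings="-redundant-canonical-projection"]
HB.instance Definition _ (R : realType) := NormedModule.copy R[i] R[i]^o.

Section ComplexValuedFunctions.
Context {R : realType}.

(* R[i] carries no normed R-module structure, so derivatives of complex-valued
   functions of real variables are taken on real and imaginary parts. *)
Definition cderivable (V : normedModType R) (f : V -> R[i]) (p v : V) : Prop :=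
  derivable (fun q => complex.Re (f q)) p v /\
  derivable (fun q => complex.Im (f q)) p v.

Definition cderive (V : normedModType R) (v : V) (f : V -> R[i]) : V -> R[i] :=
  fun p => 'D_v (fun q => complex.Re (f q)) p
           +i* 'D_v (fun q => complex.Im (f q)) p.

Definition cderiven (n : nat) (f : R -> R[i]) : R -> R[i] :=
  iter n (cderive (1 : R)) f.

(* For open U: f is C^oo on U. *)
Definition smooth_on (U : set R) (f : R -> R[i]) : Prop :=
  forall (n : nat) (x : R), U x -> cderivable (cderiven n f) x 1.

Definition Cc_infty (f : R -> R[i]) : Prop :=
  smooth_on setT f /\ compact (closure [set x | f x != 0]).

Definition axis (b : bool) : R * R := if b then (0, 1) else (1, 0).

Definition pderive (s : seq bool) (phi : R * R -> R[i]) : R * R -> R[i] :=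
  foldr (fun b => cderive (axis b)) phi s.

Definition smooth2 (phi : R * R -> R[i]) : Prop :=
  forall s : seq bool, continuous (pderive s phi) /\
    forall (b : bool) (p : R * R), cderivable (pderive s phi) p (axis b).

Definition Cc_infty2 (phi : R * R -> R[i]) : Prop :=
  smooth2 phi /\ compact (closure [set p | phi p != 0]).

Definition dbar (phi : R * R -> R[i]) (p : R * R) : R[i] :=
  2^-1 * (cderive (axis false) phi p + (0 +i* 1) * cderive (axis true) phi p).

End ComplexValuedFunctions.

Section SpaceE.
Context {R : realType}.

(* f(x) ~ sum_k a_k x^{-k}, the same expansion at both ends of the line. *)
Definition asymptotic_expansion (f : R -> R[i]) (a : nat -> R[i]) : Prop :=
  forall N : nat, exists r : R -> R[i],
    [/\ forall x : R, 1 < `|x| ->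
          f x = \sum_(k < N.+1) a k * x%:C ^- k + x%:C ^- N.+1 * r x,
        smooth_on [set x | 1 < `|x|] r
      & forall j : nat, exists M : R,
          forall x : R, 1 < `|x| -> `|cderiven j r x| <= M%:C].

Definition spaceE : set (R -> R[i]) :=
  [set f | smooth_on setT f /\ exists a, asymptotic_expansion f a].

(* For f in spaceE the limits at +oo and -oo coincide, and equal a_0. *)
Definition lim_infty (f : R -> R[i]) : R[i] := lim (f @ +oo).

(* y |-> f (-1/y), extended to y = 0. *)
Definition at_infty (f : R -> R[i]) (y : R) : R[i] :=
  if y == 0 then lim_infty f else f (- y^-1).

(* The sets of g with E_close k delta f g (k : nat, delta > 0) are a
   neighbourhood basis of f for the topology of spaceE: C^oo-convergence of g
   on bounded intervals, and of y |-> g (-1/y) in C^oo(]-1, 1[), i.e. on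
   compact subintervals of ]-1, 1[. *)
Definition E_close (k : nat) (delta : R) (f g : R -> R[i]) : Prop :=
  let h x := g x - f x in
  forall j : nat, (j <= k)%N ->
    (forall x : R, `|x| <= k%:R -> `|cderiven j h x| < delta%:C) /\
    (forall y : R, `|y| <= 1 - k.+1%:R^-1 ->
       `|cderiven j (at_infty h) y| < delta%:C).

Definition omega (z : R[i]) (x : R) : R[i] := (z - x%:C)^-1.

Definition xomega (z : R[i]) (x : R) : R[i] := x%:C / (z - x%:C).

End SpaceE.

Section Operators.
Context {R : realType} {B : completeNormedModType R[i]}.
Implicit Types S T : B -> B.

(* L(B), as a subset of the R[i]-module of all maps B -> B. *)
Definition bounded_ops : set (B -> B) := [set T | linear T /\ continuous T].

(* `|T u| : R[i] is real; +oo when T is unbounded on the unit ball. *)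
Definition opnorm T : \bar R :=
  ereal_sup [set (complex.Re `|T u|)%:E | u in [set u : B | `|u| <= 1]].

(* An unbounded operator is represented by its graph P; S is the bounded
   two-sided inverse of z - P, defined on the domain of P. *)
Definition is_resolvent (P : set (B * B)) (z : R[i]) S : Prop :=
  [/\ bounded_ops S,
      forall u w : B, P (u, w) -> S (z *: u - w) = u
    & forall v : B, exists w : B, P (S v, w) /\ z *: S v - w = v].

Definition resolvent (P : set (B * B)) (z : R[i]) : B -> B :=
  get (is_resolvent P z).

(* The graph of the operator Op(omega_z) v |-> Op(x omega_z) v. *)
Definition generated_op (Op : (R -> R[i]) -> B -> B) : set (B * B) :=
  [set uw | exists (z : R[i]) (v : B),
     [/\ complex.Im z != 0, uw.1 = Op (omega z) v & uw.2 = Op (xomega z) v]].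

Definition span_ranges (Op : (R -> R[i]) -> B -> B) : set B :=
  [set u | exists (n : nat) (g : 'I_n -> R -> R[i]) (v : 'I_n -> B),
     (forall i, Cc_infty (g i)) /\ u = \sum_(i < n) Op (g i) (v i)].

Definition continuous_on_E (Op : (R -> R[i]) -> B -> B) : Prop :=
  forall f, spaceE f -> forall eps : R, 0 < eps ->
    exists (k : nat) (delta : R), 0 < delta /\
      forall g, spaceE g -> E_close k delta f g ->
        (opnorm (Op g - Op f)%R < eps%:E)%E.

End Operators.

Section BochnerIntegral.
Context {d : measure_display} {T : measurableType d} {R : realType}
  {B : completeNormedModType R[i]} (mu : {measure set T -> \bar R}).

(* Integrable simple functions with values in L(B). *)
Record simple_op := SimpleOp {
  so_size : nat;
  so_set : 'I_so_size -> set T;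
  so_val : 'I_so_size -> B -> B;
  so_measurable : forall i, measurable (so_set i);
  so_finite : forall i, (mu (so_set i) < +oo)%E;
  so_bounded : forall i, bounded_ops (so_val i) }.

Definition so_fun (s : simple_op) (t : T) : B -> B :=
  \sum_(i < so_size s) (\1_(so_set (s := s) i) t : R)%:C *: so_val i.

Definition so_integral (s : simple_op) : B -> B :=
  \sum_(i < so_size s) (fine (mu (so_set (s := s) i)))%:C *: so_val i.

(* F is Bochner integrable with values in (L(B), opnorm), with integral I. *)
Definition is_bochner_integral (F : T -> B -> B) (I : B -> B) : Prop :=
  bounded_ops I /\ exists s : nat -> simple_op,
    [/\ {ae mu, forall t, bounded_ops (F t) /\
           opnorm (F t - so_fun (s k) t) @[k --> \oo] --> 0%E},
        (\int[mu]_t opnorm (F t - so_fun (s k) t)%R)%E @[k --> \oo] --> 0%E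
      & opnorm (I - so_integral (s k)) @[k --> \oo] --> 0%E].

End BochnerIntegral.

Section FunctionalCalculus.
Context {R : realType}.

(* Lebesgue measure on R * R, identified with R[i] by toC. *)
Definition plane_measure :
    {measure set (measurableTypeR R * measurableTypeR R) -> \bar R} :=
  (@lebesgue_measure R \x @lebesgue_measure R)%E.

Definition toC (p : R * R) : R[i] := p.1 +i* p.2.

Definition plane_integral (h : R * R -> R[i]) : R[i] :=
  (\int[plane_measure]_p complex.Re (h p))
  +i* (\int[plane_measure]_p complex.Im (h p)).

(* df/d(zbar) = g in the sense of distributions on the plane. *)
Definition weak_dbar (f g : R[i] -> R[i]) : Prop :=
  forall phi : R * R -> R[i], Cc_infty2 phi ->
    plane_integral (fun p => f (toC p) * dbar phi p) =
    - plane_integral (fun p => g (toC p) * phi p).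

Definition bracket (z : R[i]) : R :=
  Num.sqrt (1 + (complex.Re z ^+ 2 + complex.Im z ^+ 2)).

(* ft is an admissible extension of f, with d ft/d(zbar) represented by the
   bounded measurable function g.  As ft is only assumed continuous, the
   derivative is a weak one. *)
Record extension (f : R -> R[i]) (ft g : R[i] -> R[i]) : Prop := Extension {
  ext_continuous : continuous ft;
  ext_bounded : exists M : R, forall z, `|ft z| <= M%:C;
  ext_restriction : forall x : R, ft x%:C = f x;
  ext_measurable_Re : measurable_fun setT
    (fun p : measurableTypeR R * measurableTypeR R => complex.Re (g (toC p)));
  ext_measurable_Im : measurable_fun setT
    (fun p : measurableTypeR R * measurableTypeR R => complex.Im (g (toC p)));
  ext_dbar_bounded : exists M : R, forall z, `|g z| <= M%:C;
  ext_dbar : weak_dbar ft g;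
  ext_decay : forall N0 N1 : nat, exists C : R, forall z : R[i],
    `|g z| <= (C * bracket z ^- N1 * `|complex.Im z| ^+ N0)%:C }.

(* T = a_0 1 - 1/pi int (d ft/d(zbar)) (z - P)^{-1} L(dz), the integral being
   (absolutely) convergent in L(B).  The real axis, where the resolvent need not
   exist, is a null set. *)
Definition is_functional_calculus {B : completeNormedModType R[i]}
    (P : set (B * B)) (f : R -> R[i]) (g : R[i] -> R[i]) (T : B -> B) : Prop :=
  exists I : B -> B,
    is_bochner_integral plane_measure
      (fun p => g (toC p) *: resolvent P (toC p)) I /\
    T = (fun u => lim_infty f *: u - (pi^-1)%:C *: I u).

End FunctionalCalculus.

(* Main.v *)
(** For [z] off the real axis, [Op (omega z)] is the resolvent of the generated
    operator, so the claim is the Cauchy-Pompeiu formula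
    [f = a_0 - 1/pi \int dbar(ft)(z) omega z L(dz)], with convergence in the
    topology of [spaceE], pushed through the continuous map [Op].

    Pointwise, the formula comes from testing the weak derivative on a plateau
    function of radius [r] times [K (z-x) - K (z-y)], where
    [K u = conj u / (|u|^2 + r^-2)] has the approximate identity [rho] as its
    d/d(zbar).  Taking a difference of two kernels makes the contribution of the
    cutoff vanish as [r] grows although [ft] is merely bounded; then [y] is sent
    to infinity, where [f y] tends to [a_0].

    For the convergence in [spaceE], all derivatives of [omega z], in the chart
    at infinity as well, are bounded by powers of [tau z = <z>^2/|Im z|], which
    the decay of dbar(ft) absorbs.  Simple functions built on a fine partition of
    [tau z <= n] therefore approximate [dbar(ft)(z) omega z] in every seminorm of
    [spaceE] up to [C/n <z>^-4], and [<z>^-4] is integrable over the plane.  The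
    same estimate gives Bochner integrability and identifies the integral. *)
Require Import Defs.
From mathcomp Require Import all_boot all_order all_algebra.
From mathcomp Require Import all_classical all_reals all_analysis.
From mathcomp Require Import measurable_realfun complex ring lra.
Import Order.TTheory GRing.Theory Num.Theory numFieldNormedType.Exports.
Local Open Scope classical_set_scope.
Local Open Scope ring_scope.
Local Open Scope complex_scope.
Set Implicit Arguments.
Unset Strict Implicit.
Unset Printing Implicit Defensive.

(** * Complex modulus and complex-valued derivatives *)

(** The plateau has a derivative of size 1/r on a frame of area of order r^2. A single kernel has
    size 1/r there, so its contribution is merely bounded; the difference of two kernels has size
    r^-2, which leaves 1/r. Tying the regularization parameter to the radius (it is 1/r) leaves one
    limit instead of two.

    [Op] is never interchanged with an integral. Linearity and continuity at 0 give one estimate of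
    [opnorm (Op h)] by finitely many derivatives of [h] in the two charts. The error of a simple
    function at a point is [Op] of an explicit element of [spaceE]. The error of its integral is
    [Op] of the plane integral of these elements, which Cauchy-Pompeiu gives in closed form. One
    bound on the pointwise error functions therefore yields pointwise convergence, convergence in
    mean and the value of the integral. The weight <z>^-4 suits this because it is integrable and at
    least n^-4 where [tau z <= n]. *)

(** The modulus as an element of [R]: the norm takes its values in [R[i]], whose order is only
    partial. *)
Definition cmod {R : realType} (z : R[i]) : R := complex.Re `|z|.

Section Modulus.
Context {R : realType}.
Implicit Types z w : R[i].

Lemma norm_cmod z : `|z| = (cmod z)%:C.
Proof. by rewrite /cmod normc_def. Qed.

Lemma cmodE z : cmod z = Num.sqrt (complex.Re z ^+ 2 + complex.Im z ^+ 2).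
Proof. by rewrite /cmod normc_def. Qed.

Lemma cmod_ge0 z : 0 <= cmod z.
Proof. by rewrite cmodE sqrtr_ge0. Qed.

Lemma cmod_sqr z : cmod z ^+ 2 = complex.Re z ^+ 2 + complex.Im z ^+ 2.
Proof. by rewrite cmodE sqr_sqrtr // addr_ge0 // sqr_ge0. Qed.

Lemma norm_leC z (M : R) : (`|z| <= M%:C) = (cmod z <= M).
Proof. by rewrite norm_cmod lecR. Qed.

Lemma norm_ltC z (M : R) : (`|z| < M%:C) = (cmod z < M).
Proof. by rewrite norm_cmod ltcR. Qed.

Lemma cmodM z w : cmod (z * w) = cmod z * cmod w.
Proof. by apply: (@complexI R); rewrite rmorphM -!norm_cmod normrM. Qed.

Lemma cmodX z n : cmod (z ^+ n) = cmod z ^+ n.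
Proof. by apply: (@complexI R); rewrite rmorphXn -!norm_cmod normrX. Qed.

Lemma cmodV z : cmod z^-1 = (cmod z)^-1.
Proof. by apply: (@complexI R); rewrite fmorphV -!norm_cmod normfV. Qed.

Lemma cmodN z : cmod (- z) = cmod z.
Proof. by rewrite /cmod normrN. Qed.

Lemma cmod0 : cmod (0 : R[i]) = 0.
Proof. by rewrite /cmod normr0. Qed.

Lemma cmod1 : cmod (1 : R[i]) = 1.
Proof. by rewrite /cmod normr1. Qed.

Lemma cmodR (x : R) : cmod x%:C = `|x|.
Proof. by rewrite cmodE /= expr0n /= addr0 sqrtr_sqr. Qed.

Lemma cmod_nat n : cmod (n%:R : R[i]) = n%:R.
Proof. by rewrite /cmod normr_nat -(rmorph_nat (real_complex R)). Qed.

Lemma cmodD z w : cmod (z + w) <= cmod z + cmod w.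
Proof. by rewrite -lecR rmorphD -!norm_cmod ler_normD. Qed.

Lemma cmodB z w : cmod (z - w) <= cmod z + cmod w.
Proof. by rewrite (le_trans (cmodD _ _)) // cmodN. Qed.

Lemma cmodBC z w : cmod (z - w) = cmod (w - z).
Proof. by rewrite -cmodN opprB. Qed.

Lemma cmod_eq0 z : (cmod z == 0) = (z == 0).
Proof. by rewrite -(inj_eq (@complexI R)) -norm_cmod normr_eq0. Qed.

Lemma cmod_gt0 z : (0 < cmod z) = (z != 0).
Proof. by rewrite lt0r cmod_ge0 andbT cmod_eq0. Qed.

Lemma Re_cmod z : `|complex.Re z| <= cmod z.
Proof. by rewrite cmodE -sqrtr_sqr ler_wsqrtr // lerDl sqr_ge0. Qed.

Lemma Im_cmod z : `|complex.Im z| <= cmod z.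
Proof. by rewrite cmodE -sqrtr_sqr ler_wsqrtr // lerDr sqr_ge0. Qed.

Lemma cmod_ReIm z : cmod z <= `|complex.Re z| + `|complex.Im z|.
Proof.
rewrite -(@ler_pXn2r _ 2) ?nnegrE ?cmod_ge0 ?addr_ge0 // cmod_sqr.
rewrite sqrrD !real_normK ?num_real // lerD2r lerDl.
by rewrite mulrn_wge0 // mulr_ge0.
Qed.

Lemma ReD z w : complex.Re (z + w) = complex.Re z + complex.Re w.
Proof. by case: z w => [? ?] [? ?]. Qed.
Lemma ImD z w : complex.Im (z + w) = complex.Im z + complex.Im w.
Proof. by case: z w => [? ?] [? ?]. Qed.
Lemma ReN z : complex.Re (- z) = - complex.Re z.
Proof. by case: z => [? ?]. Qed.
Lemma ImN z : complex.Im (- z) = - complex.Im z.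
Proof. by case: z => [? ?]. Qed.
Lemma ReM z w : complex.Re (z * w) =
  complex.Re z * complex.Re w - complex.Im z * complex.Im w.
Proof. by case: z w => [? ?] [? ?]. Qed.
Lemma ImM z w : complex.Im (z * w) =
  complex.Re z * complex.Im w + complex.Im z * complex.Re w.
Proof. by case: z w => [? ?] [? ?]. Qed.
Lemma ReV z : complex.Re z^-1 =
  complex.Re z / (complex.Re z ^+ 2 + complex.Im z ^+ 2).
Proof. by case: z => [? ?]. Qed.
Lemma ImV z : complex.Im z^-1 =
  - complex.Im z / (complex.Re z ^+ 2 + complex.Im z ^+ 2).
Proof. by case: z => a b; rewrite /= mulNr. Qed.

Lemma complex_ext z w : complex.Re z = complex.Re w ->
  complex.Im z = complex.Im w -> z = w.
Proof. by case: z w => [? ?] [? ?] /= -> ->. Qed.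

End Modulus.

(** * Directional derivatives of complex-valued functions *)

Section ComplexDerivative.
Context {R : realType} {V : normedModType R}.
Implicit Types (f g : V -> R[i]) (p v : V) (c d : R[i]).

(** Existence and value of the derivative in one statement, so that the rules below compose without
    separate derivability conditions. *)
Definition is_cderive p v f d :=
  is_derive p v (fun q => complex.Re (f q)) (complex.Re d) /\
  is_derive p v (fun q => complex.Im (f q)) (complex.Im d).

Lemma is_cderiveE p v f d : is_cderive p v f d -> cderive v f p = d.
Proof. by move=> [h1 h2]; rewrite /cderive !derive_val; case: d {h1 h2}. Qed.

Lemma is_cderive_cderivable p v f d : is_cderive p v f d -> cderivable f p v.
Proof. by move=> [h1 h2]; split; apply: ex_derive. Qed.

Lemma cderivableP p v f : cderivable f p v -> is_cderive p v f (cderive v f p).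
Proof. by move=> [h1 h2]; split; apply/derivableP. Qed.

Lemma is_cderive_eq p v f d d' : is_cderive p v f d -> d = d' ->
  is_cderive p v f d'.
Proof. by move=> ? <-. Qed.

Lemma is_cderive_cst p v c : is_cderive p v (fun=> c) 0.
Proof. by split; apply: is_derive_cst. Qed.

Lemma is_cderiveD p v f g c d : is_cderive p v f c -> is_cderive p v g d ->
  is_cderive p v (fun q => f q + g q) (c + d).
Proof.
move=> [f1 f2] [g1 g2]; split.
  by under eq_fun do rewrite ReD; rewrite ReD; apply: is_deriveD.
by under eq_fun do rewrite ImD; rewrite ImD; apply: is_deriveD.
Qed.

Lemma is_cderiveM p v f g c d : is_cderive p v f c -> is_cderive p v g d ->
  is_cderive p v (fun q => f q * g q) (f p * d + c * g p).
Proof.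
move=> [f1 f2] [g1 g2]; split.
  under eq_fun do rewrite ReM.
  apply: is_derive_eq; rewrite /GRing.scale /= ReD !ReM; ring.
under eq_fun do rewrite ImM.
apply: is_derive_eq; rewrite /GRing.scale /= ImD !ImM; ring.
Qed.

Lemma is_derive_inv (h : V -> R) p v (dh : R) : h p != 0 ->
  is_derive p v h dh -> is_derive p v (fun q => (h q)^-1) (- dh / h p ^+ 2).
Proof.
move=> h0 hd; apply: DeriveDef; first exact: derivableV.
by rewrite deriveV // derive_val /GRing.scale /= mulNr mulrC mulNr.
Qed.

Lemma is_cderiveV p v f d : f p != 0 -> is_cderive p v f d ->
  is_cderive p v (fun q => (f q)^-1) (- d / f p ^+ 2).
Proof.
move=> fp0 [f1 f2].
have n0 : complex.Re (f p) ^+ 2 + complex.Im (f p) ^+ 2 != 0.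
  by rewrite -cmod_sqr expf_eq0 /= cmod_eq0.
have nd : is_derive p v (fun q => complex.Re (f q) ^+ 2 + complex.Im (f q) ^+ 2)
    (2 * (complex.Re (f p) * complex.Re d + complex.Im (f p) * complex.Im d)).
  apply: is_derive_eq; rewrite /GRing.scale /=; ring.
have nd' := is_derive_inv n0 nd.
split.
  under eq_fun do rewrite ReV.
  apply: is_derive_eq.
  rewrite /GRing.scale /= ReM ReN ImN ReV ImV !expr2 !ReM !ImM.
  move: n0; case: (f p) => a b /=; case: d {f1 f2 nd nd'} => c e /= n0; field.
  rewrite n0 /=.
  have -> : (a * a - b * b) ^+ 2 + (a * b + b * a) ^+ 2 = (a ^+ 2 + b ^+ 2) ^+ 2 by ring.
  by rewrite expf_neq0.
under eq_fun do rewrite ImV.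
apply: is_derive_eq.
rewrite /GRing.scale /= ImM ReN ImN ReV ImV !expr2 !ReM !ImM.
move: n0; case: (f p) => a b /=; case: d {f1 f2 nd nd'} => c e /= n0; field.
rewrite n0 /=.
have -> : (a * a - b * b) ^+ 2 + (a * b + b * a) ^+ 2 = (a ^+ 2 + b ^+ 2) ^+ 2 by ring.
by rewrite expf_neq0.
Qed.

Lemma is_cderiveX p v f d n : is_cderive p v f d ->
  is_cderive p v (fun q => f q ^+ n) (n%:R * f p ^+ n.-1 * d).
Proof.
move=> fd; elim: n => [|n ih].
  by rewrite !mul0r; apply: is_cderive_cst.
under [fun q => _]eq_fun do rewrite exprS.
apply: is_cderive_eq; first exact: is_cderiveM fd ih.
case: n {ih} => [|n] /=; first by rewrite expr0; ring.
rewrite exprS -natr1; ring.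
Qed.

End ComplexDerivative.

Lemma near_is_cderive {R : realType} {V : normedModType R} (p v : V)
  (f g : V -> R[i]) d :
  (\forall q \near p, f q = g q) -> is_cderive p v f d -> is_cderive p v g d.
Proof.
move=> fg [f1 f2]; split.
  by apply: (near_eq_is_derive _ f1); apply: filterS fg => q ->.
by apply: (near_eq_is_derive _ f2); apply: filterS fg => q ->.
Qed.

(** * Iterated derivatives on the line *)

Section Smooth.
Context {R : realType}.
Implicit Types (x y : R) (z : R[i]) (f g : R -> R[i]) (D : nat -> R -> R[i]) (U : set R).

Lemma cderivenS n f : cderiven n.+1 f = cderive (1 : R) (cderiven n f).
Proof. by []. Qed.

Lemma smooth_is_cderive U f n x : smooth_on U f -> U x ->
  is_cderive x (1 : R) (cderiven n f) (cderiven n.+1 f x).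
Proof. by move=> sf Ux; apply: cderivableP; apply: sf. Qed.

(** A family in which each member has the next one as derivative must consist of the iterated
    derivatives. Openness of [U] matters in the induction: the derivative at [x] depends on the
    values near [x]. *)
Lemma cderiven_family U f D : open U ->
  (forall x, U x -> f x = D 0%N x) ->
  (forall n x, U x -> is_cderive x (1 : R) (D n) (D n.+1 x)) ->
  forall n x, U x -> cderiven n f x = D n x.
Proof.
move=> oU f0 DS; elim=> [|n ih] x Ux; first exact: f0.
rewrite cderivenS; apply: is_cderiveE.
apply: (near_is_cderive _ (DS n x Ux)).
by have := oU x Ux; apply: filterS => y Uy; rewrite ih.
Qed.

Lemma smooth_family U f D : open U ->
  (forall x, U x -> f x = D 0%N x) ->
  (forall n x, U x -> is_cderive x (1 : R) (D n) (D n.+1 x)) ->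
  smooth_on U f.
Proof.
move=> oU f0 DS n x Ux; apply: is_cderive_cderivable.
apply: (near_is_cderive _ (DS n x Ux)).
have := oU x Ux; apply: filterS => y Uy.
by rewrite (@cderiven_family U f D).
Qed.

Lemma open_gt1 : open [set x : R | 1 < `|x|].
Proof.
rewrite (_ : [set _ | _] = (fun x : R => `|x|) @^-1` `]1, +oo[).
  by apply: open_comp => [x _|]; [exact: norm_continuous | exact: interval_open].
by apply/seteqP; split => x /=; rewrite in_itv /= andbT.
Qed.

Lemma is_cderive_lin (U : set R) (a : R[i]) f g n x :
  smooth_on U f -> smooth_on U g -> U x ->
  is_cderive x (1 : R) (fun y => a * cderiven n f y + cderiven n g y)
    (a * cderiven n.+1 f x + cderiven n.+1 g x).
Proof.
move=> sf sg Ux.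
have h := is_cderiveM (is_cderive_cst x (1 : R) a)
  (smooth_is_cderive n sf Ux).
apply: is_cderive_eq.
  exact: is_cderiveD h (smooth_is_cderive n sg Ux).
by rewrite mul0r addr0.
Qed.

Lemma cderiven_lin U (a : R[i]) f g n x : open U ->
  smooth_on U f -> smooth_on U g -> U x ->
  cderiven n (fun y => a * f y + g y) x = a * cderiven n f x + cderiven n g x.
Proof.
move=> oU sf sg Ux.
apply: (@cderiven_family U _ (fun n y => a * cderiven n f y + cderiven n g y)) => //.
by move=> m y Uy; apply: (@is_cderive_lin U).
Qed.

Lemma smooth_lin U (a : R[i]) f g : open U ->
  smooth_on U f -> smooth_on U g -> smooth_on U (fun y => a * f y + g y).
Proof.
move=> oU sf sg.
apply: (@smooth_family U _ (fun n y => a * cderiven n f y + cderiven n g y)) => //.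
by move=> m y Uy; apply: (@is_cderive_lin U).
Qed.

Definition cst_family (c : R[i]) (n : nat) (x : R) : R[i] := if n == 0%N then c else 0.

Lemma is_cderive_cst_family c n x : is_cderive x (1 : R) (cst_family c n) (cst_family c n.+1 x).
Proof. by rewrite /cst_family; case: n => [|n] /=; apply: is_cderive_cst. Qed.

Lemma smooth_cst c : smooth_on (@setT R) (fun _ : R => c).
Proof.
apply: (@smooth_family setT _ (cst_family c)) => //; first exact: openT.
by move=> n x _; apply: is_cderive_cst_family.
Qed.

Lemma cderiven_cst c n : cderiven n (fun _ : R => c) = cst_family c n.
Proof.
apply/funext => x; apply: (@cderiven_family setT) => //; first exact: openT.
by move=> m y _; apply: is_cderive_cst_family.
Qed.

Lemma is_cderive_real (x : R) : is_cderive x (1 : R) (fun y : R => y%:C) 1.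
Proof. by split => /=; [exact: is_derive_id | exact: is_derive_cst]. Qed.

Lemma is_cderive_affine_powV (a b : R[i]) m (x : R) : a + b * x%:C != 0 ->
  is_cderive x (1 : R) (fun y => (a + b * y%:C) ^- m)
    (- m%:R * b * (a + b * x%:C) ^- m.+1).
Proof.
move=> n0.
have h := is_cderiveD (is_cderive_cst x (1 : R) a)
   (is_cderiveM (is_cderive_cst x (1 : R) b) (is_cderive_real x)).
have h2 := is_cderiveX m h.
apply: is_cderive_eq; first by apply: is_cderiveV h2; rewrite expf_neq0.
case: m {h2} => [|m] /=; first by rewrite !mul0r !oppr0 !mul0r.
rewrite mulr1 mul0r addr0 add0r !exprS.
have := expf_neq0 m n0; set w := a + _; set t := w ^+ m => t0.
by field; rewrite t0 n0.
Qed.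

Definition omega_family (z : R[i]) (n : nat) (x : R) : R[i] :=
  n`!%:R * (z - x%:C) ^- n.+1.

Lemma nonreal_neq (z : R[i]) (x : R) : complex.Im z != 0 -> z - x%:C != 0.
Proof.
by apply: contraNneq => /(congr1 (@complex.Im R)); rewrite ImD ImN /= subr0 => ->.
Qed.

Lemma is_cderive_omega_family z n x : complex.Im z != 0 ->
  is_cderive x (1 : R) (omega_family z n) (omega_family z n.+1 x).
Proof.
move=> z0; have zx := nonreal_neq x z0.
have E y : z + (-1) * y%:C = z - y%:C by rewrite mulN1r.
have := @is_cderive_affine_powV z (-1) n.+1 x; rewrite E => /(_ zx).
under [fun y => _]eq_fun do rewrite E.
move=> h; apply: is_cderive_eq.
  exact: is_cderiveM (is_cderive_cst x (1 : R) n`!%:R) h.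
rewrite /omega_family factS natrM; ring.
Qed.

Lemma cderiven_omega z n : complex.Im z != 0 ->
  cderiven n (omega z) = omega_family z n.
Proof.
move=> z0; apply/funext => x; apply: (@cderiven_family setT) => //; first exact: openT.
  by move=> y _; rewrite /omega_family mul1r expr1.
by move=> m y _; apply: is_cderive_omega_family.
Qed.

Lemma smooth_omega z : complex.Im z != 0 -> smooth_on (@setT R) (omega z).
Proof.
move=> z0; apply: (@smooth_family setT _ (omega_family z)) => //; first exact: openT.
  by move=> y _; rewrite /omega_family mul1r expr1.
by move=> m y _; apply: is_cderive_omega_family.
Qed.

Lemma cmod_omega z x : complex.Im z != 0 ->
  cmod (omega z x) <= `|complex.Im z|^-1.
Proof.
move=> z0; rewrite /omega cmodV lef_pV2 ?posrE ?normr_gt0 //; last first.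
  by rewrite cmod_gt0 nonreal_neq.
by rewrite (le_trans _ (Im_cmod _)) // ImD ImN /= subr0.
Qed.

Lemma smooth_subset U U' f : U `<=` U' -> smooth_on U' f -> smooth_on U f.
Proof. by move=> UU' sf n x Ux; apply: sf; apply: UU'. Qed.

End Smooth.

(** * The space E *)

Section SpaceEMembers.
Context {R : realType}.
Implicit Types (x y : R) (z a : R[i]) (f g : R -> R[i]).

Lemma spaceE_lin a f1 f2 : spaceE f1 -> spaceE f2 ->
  spaceE (fun x => a * f1 x + f2 x).
Proof.
move=> [s1 [a1 e1]] [s2 [a2 e2]]; split; first exact: smooth_lin (openT) s1 s2.
exists (fun k => a * a1 k + a2 k) => N.
have [r1 [E1 S1 B1]] := e1 N; have [r2 [E2 S2 B2]] := e2 N.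
exists (fun x => a * r1 x + r2 x); split.
- move=> x x1; rewrite E1 // E2 //.
  under [in RHS]eq_bigr do rewrite mulrDl -mulrA.
  rewrite big_split /= -mulr_sumr; ring.
- exact: smooth_lin open_gt1 S1 S2.
- move=> j; have [M1 H1] := B1 j; have [M2 H2] := B2 j.
  exists (cmod a * M1 + M2) => x x1; rewrite (cderiven_lin _ _ open_gt1 S1 S2) //.
  rewrite norm_leC (le_trans (cmodD _ _)) // cmodM.
  have := H1 x x1; have := H2 x x1; rewrite !norm_leC => h2 h1.
  by rewrite lerD // ler_wpM2l // cmod_ge0.
Qed.

Lemma spaceE_cst a : spaceE (fun _ : R => a).
Proof.
split; first exact: smooth_cst.
exists (fun k => if k == 0%N then a else 0) => N; exists (fun=> 0); split.
- move=> x _; rewrite big_ord_recl /= expr0 invr1 mulr1 mulr0 addr0.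
  by rewrite big1 ?addr0 // => i _; rewrite mul0r.
- exact: smooth_subset (smooth_cst 0).
- move=> j; exists 0 => x _; rewrite cderiven_cst /cst_family.
  by case: ifP; rewrite normr0.
Qed.

Lemma spaceEZ a f : spaceE f -> spaceE (fun x => a * f x).
Proof.
move=> Ef; have := spaceE_lin a Ef (spaceE_cst 0).
by congr (spaceE _); apply/funext => x; rewrite addr0.
Qed.

Lemma spaceE_sum (I : Type) (s : seq I) (c : I -> R[i]) (F : I -> R -> R[i]) :
  (forall i, spaceE (F i)) -> spaceE (fun x => \sum_(i <- s) c i * F i x).
Proof.
move=> EF; elim: s => [|i s ih].
  by under [fun x => _]eq_fun do rewrite big_nil; apply: spaceE_cst.
by under [fun x => _]eq_fun do rewrite big_cons; apply: spaceE_lin.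
Qed.

(* The remainder in [1/(z-x) = - \sum_(k < N) z^k / x^k.+1 + x^-N.+1 * r x] is
   [r x = z^N x/(z-x) = z^N (-1 + z/(z-x))]. *)
Lemma spaceE_omega z : complex.Im z != 0 -> spaceE (omega z).
Proof.
move=> z0; split; first exact: smooth_omega.
exists (fun k => if k is k'.+1 then - z ^+ k' else 0) => N.
pose r x := z ^+ N * z * omega z x + - z ^+ N.
have sr : smooth_on (@setT R) r.
  apply: smooth_lin; [exact: openT | exact: smooth_omega | exact: smooth_cst].
exists r; split.
- move=> x x1; have zx := nonreal_neq x z0.
  have x0 : x%:C != 0 :> R[i].
    rewrite -cmod_eq0 cmodR normr_eq0; apply: contraTneq x1 => ->.
    by rewrite normr0 ltr10.
  rewrite /r {sr r}; elim: N => [|N ih].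
    by rewrite big_ord_recl big_ord0 /omega; field; rewrite zx x0.
  rewrite big_ord_recr /= [LHS]ih {ih}.
  have xN := expf_neq0 N x0; rewrite !exprS /omega.
  have -> : \sum_(k < N.+1) (match (k : nat) with 0%N => 0 | k'.+1 => - z ^+ k' end)
     / x%:C ^+ k
    = \sum_(k < N.+1) (match (k : nat) with 0%N => 0 | k'.+1 => - z ^+ k' end)
     / x%:C ^+ k by [].
  set S := \sum_(k < _) _; set t := x%:C ^+ N in xN *; set w := z ^+ N.
  by field; rewrite zx x0 xN.
- exact: smooth_subset sr.
- move=> j; exists (cmod (z ^+ N * z) * (j`!%:R * `|complex.Im z|^-1 ^+ j.+1)
     + cmod (z ^+ N)) => x _.
  rewrite (cderiven_lin _ _ openT (smooth_omega z0) (smooth_cst _)) //.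
  rewrite norm_leC (le_trans (cmodD _ _)) // cmodM lerD //.
    rewrite ler_wpM2l ?cmod_ge0 // cderiven_omega // /omega_family.
    rewrite cmodM cmod_nat ler_wpM2l // -exprVn cmodX lerXn2r ?nnegrE ?cmod_ge0 //.
    exact: cmod_omega.
  rewrite cderiven_cst /cst_family; case: ifP => _; rewrite ?cmodN //.
  by rewrite cmod0 cmod_ge0.
Qed.

Lemma cvgC (T : Type) (F : set_system T) (FF : Filter F) (f : T -> R[i]) l :
  (forall e : R, 0 < e -> \forall x \near F, cmod (l - f x) < e) -> f @ F --> l.
Proof.
move=> h; apply/cvgrPdist_lt => e e0.
have eE : e = (complex.Re e)%:C by rewrite RRe_real // gtr0_real.
rewrite eE; move: e0; rewrite eE ltcR => e0.
by apply: filterS (h _ e0) => x; rewrite norm_ltC.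
Qed.

Lemma spaceE_lim f : spaceE f -> exists a0 C : R[i],
  lim_infty f = a0 /\
  forall x, 1 < `|x| -> cmod (a0 - f x) <= cmod C / `|x|.
Proof.
move=> [_ [a /(_ 0%N) [r [fE _ /(_ 0%N) [M rM]]]]].
have H x : 1 < `|x| -> cmod (a 0%N - f x) <= M / `|x|.
  move=> x1; rewrite fE // big_ord_recl big_ord0 /= expr0 invr1 mulr1 addr0.
  rewrite opprD addNKr cmodN cmodM expr1 cmodV cmodR mulrC.
  by rewrite ler_wpM2r ?invr_ge0 // -norm_leC rM.
(* The bound at the point 2 forces [M] to be nonnegative, so that [cmod M%:C] is [M]. *)
have M0 : 0 <= M.
  have h : (1 : R) < `|2| by rewrite ger0_norm // ltr1n.
  have := H 2 h; rewrite ger0_norm // => /(le_trans (cmod_ge0 _)).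
  by rewrite pmulr_lge0 // invr_gt0.
exists (a 0%N), M%:C; split; last by move=> x x1; rewrite cmodR ger0_norm // H.
apply: cvg_lim; first exact: norm_hausdorff.
apply: cvgC => e e0; near=> x.
have x1 : 1 < x by near: x; apply: nbhs_pinfty_gt; rewrite num_real.
have nx : `|x| = x by rewrite ger0_norm // (le_trans ler01) // ltW.
have := H x; rewrite nx => /(_ x1) /le_lt_trans; apply.
rewrite ltr_pdivrMr ?(lt_trans ltr01) // mulrC -ltr_pdivrMr //.
by near: x; apply: nbhs_pinfty_gt; rewrite num_real.
Unshelve. all: by end_near. Qed.

Lemma lim_inftyE f l : (forall e : R, 0 < e -> exists A : R, forall x, A < x ->
   cmod (l - f x) < e) -> lim_infty f = l.
Proof.
move=> H; apply: cvg_lim; first exact: norm_hausdorff.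
apply: cvgC => e /H[A hA]; near=> x; apply: hA.
by near: x; apply: nbhs_pinfty_gt; rewrite num_real.
Unshelve. all: by end_near. Qed.

Definition vanishes_out f := exists A : R, forall x, A < `|x| -> f x = 0.

Lemma is_cderive_continuous f x d : is_cderive x (1 : R) f d ->
  {for x, continuous (fun y => complex.Re (f y))} /\
  {for x, continuous (fun y => complex.Im (f y))}.
Proof.
move=> [[h1 _] [h2 _]].
by split; apply: differentiable_continuous; apply/derivable1_diffP.
Qed.

Lemma continuous_bounded (h : R -> R) (A : R) : continuous h ->
  exists M : R, forall x, `|x| <= A -> `|h x| <= M.
Proof.
move=> ch; have [A0|A0] := ltP A 0.
  by exists 0 => x xA; have := le_lt_trans xA A0; rewrite normr_lt0.
have AA : - A <= A by rewrite (le_trans _ A0) // oppr_le0.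
have [|c _ hc] := @EVT_max R (fun x => `|h x|) (- A) A AA.
  apply: continuous_subspaceT => x.
  by apply: continuous_comp; [exact: ch | exact: norm_continuous].
by exists (`|h c|) => x; rewrite ler_norml => xA; apply: hc; rewrite in_itv.
Qed.

(** By Leibniz, the n-th derivative of [x f] is x f^(n) + n f^(n-1). *)
Lemma smooth_mulX f : smooth_on (@setT R) f ->
  smooth_on (@setT R) (fun x => x%:C * f x).
Proof.
move=> sf; apply: (@smooth_family _ setT _ (fun n x => x%:C * cderiven n f x +
   if n is n'.+1 then n%:R * cderiven n' f x else 0)); first exact: openT.
  by move=> x _; rewrite addr0.
move=> n x _.
have h := is_cderiveM (is_cderive_real x) (smooth_is_cderive n sf (I : setT x)).
case: n h => [|n] h.
  by apply: is_cderive_eq; [exact: is_cderiveD h (is_cderive_cst x (1 : R) 0) | ring].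
apply: is_cderive_eq.
  apply: is_cderiveD h _; apply: is_cderiveM (is_cderive_cst x (1 : R) n.+1%:R) _.
  exact: smooth_is_cderive sf (I : setT x).
by rewrite mul0r addr0 -(natr1 n.+1); ring.
Qed.

Lemma smooth_mulXn f n : smooth_on (@setT R) f ->
  smooth_on (@setT R) (fun x => x%:C ^+ n * f x).
Proof.
move=> sf; elim: n => [|n ih].
  by under eq_fun do rewrite expr0 mul1r.
by under eq_fun do rewrite exprS -mulrA; apply: smooth_mulX.
Qed.

(** Outside a compact interval all derivatives vanish, since [f] is zero on an open set; inside,
    continuity bounds them. *)
Lemma smooth_vanishes_bounded f j : smooth_on (@setT R) f -> vanishes_out f ->
  exists M : R, forall x, `|cderiven j f x| <= M%:C.
Proof.
move=> sf [A fA].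
have oA : open [set x : R | A < `|x|].
  rewrite (_ : [set _ | _] = (fun x : R => `|x|) @^-1` `]A, +oo[).
    by apply: open_comp => [x _|]; [exact: norm_continuous | exact: interval_open].
  by apply/seteqP; split => x /=; rewrite in_itv /= andbT.
have f0 x : A < `|x| -> cderiven j f x = 0.
  move=> xA.
  rewrite (@cderiven_family _ [set x | A < `|x|] f (cst_family 0)) //.
    by rewrite /cst_family; case: ifP.
  by move=> n y _; apply: is_cderive_cst_family.
have h x := is_cderive_continuous (smooth_is_cderive j sf (I : setT x)).
have [M1 H1] := @continuous_bounded (fun x => complex.Re (cderiven j f x)) A (fun x => (h x).1).
have [M2 H2] := @continuous_bounded (fun x => complex.Im (cderiven j f x)) A (fun x => (h x).2).
exists (`|M1| + `|M2|) => x; rewrite norm_leC.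
have [xA|xA] := ltP A `|x|; first by rewrite f0 // cmod0 addr_ge0.
rewrite (le_trans (cmod_ReIm _)) // lerD // ?(le_trans (H1 _ _)) ?(le_trans (H2 _ _)) //;
 exact: ler_norm.
Qed.

Lemma Cc_vanishes f : Cc_infty f -> vanishes_out f.
Proof.
move=> [_ /compact_bounded [M [Mr hM]]].
exists (M + 1) => x xM; apply/eqP/negPn/negP => fx.
have := hM (M + 1); rewrite ltrDl ltr01 => /(_ isT) /(_ x).
by rewrite /= leNgt xM => /(_ (@subset_closure _ [set y : R | f y != 0] x fx)).
Qed.

(** All coefficients of the expansion are 0. The remainder of order N is x^(N+1) f, which is smooth
    on the whole line and again vanishes far out. *)
Lemma spaceE_Cc f : Cc_infty f -> spaceE f.
Proof.
move=> Cf; have [A fA] := Cc_vanishes Cf; have [sf _] := Cf; split => //.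
exists (fun=> 0) => N; exists (fun x => x%:C ^+ N.+1 * f x); split.
- move=> x x1.
  have x0 : x%:C != 0 :> R[i].
    rewrite -cmod_eq0 cmodR normr_eq0; apply: contraTneq x1 => ->.
    by rewrite normr0 ltr10.
  rewrite big1 ?add0r; last by move=> i _; rewrite mul0r.
  by rewrite mulrA mulVf ?mul1r // expf_neq0.
- exact: smooth_subset (smooth_mulXn N.+1 sf).
- move=> j; have [|M hM] := smooth_vanishes_bounded j (smooth_mulXn N.+1 sf).
    by exists A => x /fA ->; rewrite mulr0.
  by exists M => x _.
Qed.

End SpaceEMembers.

(** * The algebra of the operators Op f *)

Section Bound.
Context {R : realType}.
Implicit Types (h : R -> R[i]) (t : R) (k : nat).

(** The derivatives are supplied as a family [D], so that their existence and their size come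
    together. For a function given by an integral, [D j] will be the integral of the differentiated
    integrand. *)
Definition Ck_bound k t h := exists D : nat -> R -> R[i],
  [/\ D 0%N = h,
      forall j x, (j < k)%N -> is_cderive x (1 : R) (D j) (D j.+1 x)
    & forall j x, (j <= k)%N -> cmod (D j x) <= t].

(* [E_close] only looks at bounded intervals; the functions to be estimated are
   bounded over the whole line in both charts. *)
Definition E_bound k t h := Ck_bound k t h /\ Ck_bound k t (at_infty h).

Lemma Ck_boundP k t h j x : Ck_bound k t h -> (j <= k)%N ->
  cmod (cderiven j h x) <= t.
Proof.
move=> [D [D0 DS Dt]] jk; suff -> : cderiven j h = D j by exact: Dt.
elim: j jk => [//|j ih] jk; apply/funext => y.
by rewrite cderivenS ih ?(ltnW jk) //; apply: is_cderiveE; apply: DS.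
Qed.

Lemma Ck_boundZ k t h (c : R[i]) : Ck_bound k t h ->
  Ck_bound k (cmod c * t) (fun x => c * h x).
Proof.
move=> [D [D0 DS Dt]]; exists (fun j x => c * D j x); split.
- by rewrite D0.
- move=> j x jk; apply: is_cderive_eq.
    exact: is_cderiveM (is_cderive_cst x (1 : R) c) (DS _ x jk).
  by rewrite mul0r addr0.
- by move=> j x jk; rewrite cmodM ler_wpM2l ?cmod_ge0 ?Dt.
Qed.

Lemma lim_inftyZ c h : spaceE h -> lim_infty (fun x => c * h x) = c * lim_infty h.
Proof.
move=> /spaceE_lim[a0 [M [-> hM]]]; apply: lim_inftyE => e e0.
exists (1 + (cmod c * cmod M) / e) => x xA.
have x1 : 1 < x.
  by apply: le_lt_trans xA; rewrite lerDl divr_ge0 ?mulr_ge0 ?cmod_ge0 // ltW.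
have x0 : 0 < x by rewrite (lt_trans ltr01).
have := hM x; rewrite (ger0_norm (ltW x0)) => /(_ x1) hx.
rewrite -mulrBr cmodM (le_lt_trans (ler_wpM2l (cmod_ge0 c) hx)) //.
rewrite mulrA ltr_pdivrMr // [ltRHS]mulrC -ltr_pdivrMr //.
by apply: le_lt_trans xA; rewrite lerDr.
Qed.

Lemma at_inftyZ c h : spaceE h ->
  at_infty (fun x => c * h x) = (fun y => c * at_infty h y).
Proof.
by move=> Eh; apply/funext => y; rewrite /at_infty lim_inftyZ //; case: ifP.
Qed.

Lemma E_boundZ k t h c : spaceE h -> E_bound k t h ->
  E_bound k (cmod c * t) (fun x => c * h x).
Proof.
move=> Eh [h1 h2]; split; first exact: Ck_boundZ.
by rewrite at_inftyZ //; apply: Ck_boundZ.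
Qed.

Lemma E_bound_close k t d h : E_bound k t h -> t < d ->
  E_close k d (fun=> 0) h.
Proof.
move=> [h1 h2] td; rewrite /E_close.
have -> : (fun x => h x - 0) = h by apply/funext => x; rewrite subr0.
move=> j jk; split=> x _; rewrite norm_ltC; apply: le_lt_trans td;
  [exact: Ck_boundP h1 jk | exact: Ck_boundP h2 jk].
Qed.

End Bound.

Section RealNorm.
Context {R : realType} {B : completeNormedModType R[i]}.
Implicit Types (u v : B).

Definition rnorm u : R := complex.Re `|u|.

Lemma rnormE u : `|u| = (rnorm u)%:C.
Proof. by rewrite /rnorm RRe_real // ger0_real. Qed.

Lemma rnorm_ge0 u : 0 <= rnorm u.
Proof. by rewrite -ler0c -rnormE. Qed.

Lemma rnormZ (c : R[i]) u : rnorm (c *: u) = cmod c * rnorm u.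
Proof.
by rewrite /rnorm normrZ norm_cmod rnormE -rmorphM.
Qed.

Lemma opnorm_le (T : B -> B) (c : R) :
  (forall u, `|u| <= 1 -> rnorm (T u) <= c) -> (opnorm T <= c%:E)%E.
Proof.
by move=> h; apply: ge_ereal_sup => _ [u u1 <-]; rewrite lee_fin; apply: h.
Qed.

Lemma le_opnorm (T : B -> B) u : `|u| <= 1 -> ((rnorm (T u))%:E <= opnorm T)%E.
Proof. by move=> u1; apply: ereal_sup_ubound; exists u. Qed.

Lemma opnorm_ge0 (T : B -> B) : (0 <= opnorm T)%E.
Proof.
have := @le_opnorm T 0; rewrite normr0 => /(_ ler01); apply: le_trans.
by rewrite lee_fin rnorm_ge0.
Qed.

End RealNorm.

(** * Op as a homomorphism, the resolvent, and the norm estimate *)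

Section OperatorAlgebra.
Context {R : realType} {B : completeNormedModType R[i]}.
Variable (Op : (R -> R[i]) -> B -> B).
Hypothesis (Op_bounded : forall f, spaceE f -> bounded_ops (Op f)).
Hypothesis (Op_linear : forall (a : R[i]) f1 f2, spaceE f1 -> spaceE f2 ->
     Op (fun x => a * f1 x + f2 x) = (fun u => a *: Op f1 u + Op f2 u)).
Hypothesis (Op_continuous : continuous_on_E Op).
Hypothesis (Op_mul : forall f1 f2, spaceE f1 -> spaceE f2 ->
     (fun u => Op f1 (Op f2 u)) = Op (fun x => f1 x * f2 x)).
Hypothesis (Op_ker : forall u : B, (forall g, Cc_infty g -> Op g u = 0) -> u = 0).
Implicit Types (f g h : R -> R[i]) (u v : B) (z : R[i]).

Lemma Op_zero u : Op (fun=> 0) u = 0.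
Proof.
have := Op_linear (-1) (spaceE_cst 0) (spaceE_cst 0).
under eq_fun do rewrite mulr0 addr0.
by move=> ->; rewrite scaleN1r addNr.
Qed.

Lemma Op_lin a f1 f2 u : spaceE f1 -> spaceE f2 ->
  Op (fun x => a * f1 x + f2 x) u = a *: Op f1 u + Op f2 u.
Proof. by move=> E1 E2; rewrite Op_linear. Qed.

Lemma Op_scale a f u : spaceE f -> Op (fun x => a * f x) u = a *: Op f u.
Proof.
move=> Ef; rewrite -[RHS]addr0 -(Op_zero u) -Op_lin //; last exact: spaceE_cst.
by congr (Op _ u); apply/funext => x; rewrite addr0.
Qed.

Lemma Op_sum (I : Type) (s : seq I) (c : I -> R[i]) (F : I -> R -> R[i]) u :
  (forall i, spaceE (F i)) ->
  Op (fun x => \sum_(i <- s) c i * F i x) u = \sum_(i <- s) c i *: Op (F i) u.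
Proof.
move=> EF; elim: s => [|i s ih].
  by under [fun x => _]eq_fun do rewrite big_nil; rewrite big_nil Op_zero.
under [fun x => _]eq_fun do rewrite big_cons.
by rewrite big_cons Op_lin ?ih //; apply: spaceE_sum.
Qed.

Lemma OpM f1 f2 u : spaceE f1 -> spaceE f2 ->
  Op f1 (Op f2 u) = Op (fun x => f1 x * f2 x) u.
Proof. by move=> E1 E2; rewrite -Op_mul. Qed.

Lemma OpB f u v : spaceE f -> Op f (u - v) = Op f u - Op f v.
Proof.
by move=> /Op_bounded[l _]; rewrite [u - v]addrC -scaleN1r l scaleN1r addrC.
Qed.

(** For every [g] in [Cc_infty], [Op g] maps [Op 1 u - u] to [Op (g * 1) u - Op g u = 0]; the
    triviality of the common null space then gives equality. *)
Lemma Op_one u : Op (fun=> 1) u = u.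
Proof.
apply/eqP; rewrite -subr_eq0; apply/eqP; apply: Op_ker => g Cg.
have Eg := spaceE_Cc Cg.
rewrite OpB // OpM //; last exact: spaceE_cst.
rewrite (_ : (fun x => g x * 1) = g) ?subrr //.
by apply/funext => x; rewrite mulr1.
Qed.

Lemma Op_cst a u : Op (fun=> a) u = a *: u.
Proof.
rewrite -[in RHS](Op_one u) -Op_scale; last exact: spaceE_cst.
by congr (Op _ u); apply/funext => x; rewrite mulr1.
Qed.

Lemma xomegaE z : complex.Im z != 0 -> xomega z = (fun x => z * omega z x + (-1)).
Proof.
move=> z0; apply/funext => x; have zx := nonreal_neq x z0.
by rewrite /xomega /omega; field.
Qed.

(** The resolvent identity: the product of [omega z] and [omega w] splits into partial fractions,
    and multiplicativity transports this to [Op]. *)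
Lemma Op_resolvent z w u : complex.Im z != 0 -> complex.Im w != 0 ->
  (z - w) *: Op (omega z) (Op (omega w) u) = Op (omega w) u - Op (omega z) u.
Proof.
move=> z0 w0; have Ez := spaceE_omega z0; have Ew := spaceE_omega w0.
have [->|zw] := eqVneq z w; first by rewrite !subrr scale0r.
have zw0 : z - w != 0 by rewrite subr_eq0.
rewrite OpM // (_ : (fun x => _) = (fun x => (z - w)^-1 * (1 * omega w x + (-1) * omega z x))).
  rewrite Op_scale; last by apply: spaceE_lin => //; apply: spaceEZ.
  rewrite scalerA mulfV // scale1r Op_lin //; last exact: spaceEZ.
  by rewrite scale1r Op_scale // scaleN1r.
apply/funext => x; rewrite /omega.
have zx := nonreal_neq x z0; have wx := nonreal_neq x w0.
by field; rewrite zx wx zw0.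
Qed.

(** A pair in the graph comes with its own parameter [z']; the resolvent identity passes from [z']
    to [z]. Since [resolvent] is a choice, uniqueness is needed too: every [v] has the form
    [z u - w] with [(u, w)] in the graph, and there any resolvent must return [u]. *)
Lemma resolvent_generated z : complex.Im z != 0 ->
  resolvent (generated_op Op) z = Op (omega z).
Proof.
move=> z0.
have xo w u : complex.Im w != 0 -> Op (xomega w) u = w *: Op (omega w) u - u.
  move=> w0; rewrite xomegaE // Op_lin ?Op_cst ?scaleN1r //.
    exact: spaceE_omega.
  exact: spaceE_cst.
have res : is_resolvent (generated_op Op) z (Op (omega z)).
  split; first exact/Op_bounded/spaceE_omega.
    move=> u w [z' [v [z'0 /= -> ->]]].
    rewrite xo // opprB addrCA -scalerBl.
    have [l _] := Op_bounded (spaceE_omega z0).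
    by rewrite addrC l Op_resolvent // subrK.
  move=> v; exists (Op (xomega z) v); split; first by exists z, v.
  by rewrite xo // opprB addrCA subrr addr0.
have [_ S1 _] : is_resolvent (generated_op Op) z (resolvent (generated_op Op) z).
  by apply: getPex; exists (Op (omega z)).
apply/funext => v; have [_ _ S3] := res; have [w [Pw wv]] := S3 v.
by rewrite -[in LHS]wv (S1 _ _ Pw).
Qed.

(** Continuity at 0 with tolerance 1 gives [k] and [d]. The multiple [d / (2 t)] of [h] has
    derivatives at most [d / 2], hence is [E_close] to 0, so [Op] of it has norm at most 1; undoing
    the scaling gives the constant [2 / d]. *)
Lemma Op_norm_bound : exists (k : nat) (C : R), 0 < C /\
  forall t h, 0 < t -> spaceE h -> E_bound k t h -> (opnorm (Op h) <= (C * t)%:E)%E.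
Proof.
have [k [d [d0 Hd]]] := Op_continuous (spaceE_cst 0) ltr01.
exists k, (2 / d); split; first by rewrite divr_gt0.
move=> t h t0 Eh bh; apply: opnorm_le => u u1.
pose c : R := d / (2 * t).
have c0 : 0 < c by rewrite divr_gt0 // mulr_gt0.
have Ec : spaceE (fun x => c%:C * h x) by exact: spaceEZ.
have ct : c * t < d.
  rewrite /c mulrAC ltr_pdivrMr ?mulr_gt0 // ltr_pM2l //.
  by rewrite ltr_pMl // ltr1n.
have := E_boundZ c%:C Eh bh; rewrite cmodR gtr0_norm // => /E_bound_close H.
have H1 := le_lt_trans (le_opnorm _ u1) (Hd _ Ec (H _ ct)).
move: H1; rewrite lte_fin.
have -> : (Op (fun x => c%:C * h x) - Op (fun=> 0))%R u = c%:C *: Op h u.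
  by rewrite -Op_scale // -[RHS]subr0 -(Op_zero u).
rewrite rnormZ cmodR gtr0_norm // => /ltW.
by rewrite mulrC -ler_pdivlMr // mul1r /c invf_div mulrAC.
Qed.

End OperatorAlgebra.

(** * Kernels in the two charts *)

Section AtInfinity.
Context {R : realType}.
Implicit Types (x y : R) (z a : R[i]) (f g : R -> R[i]).

Lemma lim_infty_lin a f g : spaceE f -> spaceE g ->
  lim_infty (fun x => a * f x + g x) = a * lim_infty f + lim_infty g.
Proof.
move=> /spaceE_lim[a1 [M1 [-> h1]]] /spaceE_lim[a2 [M2 [-> h2]]].
apply: lim_inftyE => e e0.
have M0 : 0 <= cmod a * cmod M1 + cmod M2 by rewrite addr_ge0 ?mulr_ge0 ?cmod_ge0.
exists (1 + (cmod a * cmod M1 + cmod M2) / e) => x xA.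
have x1 : 1 < x.
  by apply: le_lt_trans xA; rewrite lerDl divr_ge0 // ltW.
have x0 : 0 < x by rewrite (lt_trans ltr01).
have := h1 x; have := h2 x; rewrite (ger0_norm (ltW x0)) => /(_ x1) g2 /(_ x1) g1.
rewrite (_ : _ - _ = a * (a1 - f x) + (a2 - g x)); last by ring.
apply: (@le_lt_trans _ _ ((cmod a * cmod M1 + cmod M2) / x)).
  rewrite (le_trans (cmodD _ _)) // mulrDl cmodM lerD // -mulrA.
  by rewrite ler_wpM2l ?cmod_ge0.
rewrite ltr_pdivrMr // [ltRHS]mulrC -ltr_pdivrMr //.
by apply: le_lt_trans xA; rewrite lerDr.
Qed.

Lemma lim_infty_cst a : lim_infty (fun _ : R => a) = a.
Proof. by apply: lim_inftyE => e e0; exists 0 => x _; rewrite subrr cmod0. Qed.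

Lemma lim_infty_omega z : complex.Im z != 0 -> lim_infty (omega z) = 0.
Proof.
move=> z0; apply: lim_inftyE => e e0; exists (complex.Re z + e^-1) => x.
rewrite -ltrBrDl => xA; have i0 : 0 < e^-1 by rewrite invr_gt0.
rewrite sub0r cmodN /omega cmodV invf_plt ?posrE // ?cmod_gt0 ?nonreal_neq //.
apply: (lt_le_trans xA); rewrite cmodBC.
by rewrite (le_trans _ (Re_cmod _)) // ReD ReN /= ler_norm.
Qed.

Lemma at_infty_lin a f g : spaceE f -> spaceE g ->
  at_infty (fun x => a * f x + g x) = (fun y => a * at_infty f y + at_infty g y).
Proof.
move=> Ef Eg; apply/funext => y; rewrite /at_infty lim_infty_lin //.
by case: ifP.
Qed.

Lemma at_infty_cst a : at_infty (fun _ : R => a) = (fun=> a).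
Proof. by apply/funext => y; rewrite /at_infty lim_infty_cst; case: ifP. Qed.

Lemma at_infty_sum (I : Type) (s : seq I) (c : I -> R[i]) (F : I -> R -> R[i]) :
  (forall i, spaceE (F i)) ->
  at_infty (fun x => \sum_(i <- s) c i * F i x) =
  (fun y => \sum_(i <- s) c i * at_infty (F i) y).
Proof.
move=> EF; elim: s => [|i s ih].
  under [fun x => _]eq_fun do rewrite big_nil.
  by rewrite at_infty_cst; apply/funext => y; rewrite big_nil.
under [fun x => _]eq_fun do rewrite big_cons.
rewrite at_infty_lin ?ih //; last exact: spaceE_sum.
by apply/funext => y; rewrite big_cons.
Qed.

End AtInfinity.

(** * Bounds by powers of tau, and Lipschitz dependence on z *)

Section Kernels.
Context {R : realType}.
Implicit Types (x y : R) (z w : R[i]) (j k n : nat).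

(** The square <z>^2 of [bracket], kept without the root so that it is polynomial in the two
    coordinates. *)
Definition br2 z : R := 1 + (complex.Re z ^+ 2 + complex.Im z ^+ 2).

Definition tau z : R := br2 z / `|complex.Im z|.

Definition weight z : R := br2 z ^- 2.

Lemma br2E z : br2 z = 1 + cmod z ^+ 2.
Proof. by rewrite /br2 cmod_sqr. Qed.

Lemma br2_ge1 z : 1 <= br2 z.
Proof. by rewrite br2E lerDl sqr_ge0. Qed.

Lemma br2_gt0 z : 0 < br2 z.
Proof. exact: lt_le_trans ltr01 (br2_ge1 z). Qed.

Lemma bracket_sqr z : bracket z ^+ 2 = br2 z.
Proof. by rewrite sqr_sqrtr // ltW // br2_gt0. Qed.

Lemma weight_gt0 z : 0 < weight z.
Proof. by rewrite invr_gt0 exprn_gt0 // br2_gt0. Qed.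

Lemma cmod_br2 z : cmod z <= br2 z.
Proof.
rewrite br2E; have [z1|z1] := leP (cmod z) 1.
  by rewrite (le_trans z1) // lerDl sqr_ge0.
by rewrite (@le_trans _ _ (cmod z ^+ 2)) ?lerDr // expr2 ler_peMl ?cmod_ge0 // ltW.
Qed.

Section NonReal.
Variable z : R[i].
Hypothesis z0 : complex.Im z != 0.

Let i0 : 0 < `|complex.Im z|. Proof. by rewrite normr_gt0. Qed.

Lemma tau_ge1 : 1 <= tau z.
Proof.
by rewrite ler_pdivlMr // mul1r (le_trans (Im_cmod _)) // cmod_br2.
Qed.

Lemma tau_gt0 : 0 < tau z. Proof. exact: lt_le_trans ltr01 tau_ge1. Qed.

Lemma tau_ge_invIm : `|complex.Im z|^-1 <= tau z.
Proof. by rewrite /tau ler_peMl ?invr_ge0 // br2_ge1. Qed.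

Lemma tau_ge_cmod : cmod z <= tau z.
Proof.
rewrite ler_pdivlMr // br2E (@le_trans _ _ (cmod z * cmod z)) //.
  by rewrite ler_wpM2l ?cmod_ge0 // Im_cmod.
by rewrite -expr2 lerDr.
Qed.

Lemma tau_ge_br2 : cmod z / `|complex.Im z| <= tau z.
Proof. by rewrite ler_wpM2r ?invr_ge0 // cmod_br2. Qed.

Lemma affine_neq0 y : 1 + z * y%:C != 0.
Proof.
apply: contraNneq z0 => e.
have := congr1 (@complex.Im R) e; rewrite ImD ImM /= mulr0 !add0r => /eqP.
rewrite mulf_eq0 => /orP[//|/eqP y0]; move: e.
by rewrite y0 mulr0 addr0 => /eqP; rewrite oner_eq0.
Qed.

(** Multiplication by the conjugate of [z] turns [1 + z y] into conj z + |z|^2 y, whose imaginary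
    part is [- Im z]. Hence |z| |1 + z y| is at least |Im z|. *)
Lemma cmod_affineV y : cmod (1 + z * y%:C)^-1 <= tau z.
Proof.
have n0 := affine_neq0 y.
apply: (le_trans _ tau_ge_br2); rewrite cmodV ler_pdivlMr // mulrC ler_pdivrMr ?cmod_gt0 //.
have -> : cmod z = cmod (z^*) by rewrite !cmodE; case: (z) => a b /=; rewrite sqrrN.
rewrite -cmodM (le_trans _ (Im_cmod _)) //.
have -> // : complex.Im (z^* * (1 + z * y%:C)) = - complex.Im z.
  by case: (z) => a b; rewrite /=; ring.
by rewrite normrN.
Qed.

(** The imaginary part of [1 + z y] is [y Im z], so the quotient is bounded by 1/|Im z|, uniformly
    in [y]. *)
Lemma cmod_affine_ratio y : cmod (y%:C / (1 + z * y%:C)) <= tau z.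
Proof.
have n0 := affine_neq0 y.
apply: (le_trans _ tau_ge_invIm); rewrite cmodM cmodV cmodR.
rewrite ler_pdivrMr ?cmod_gt0 // mulrC ler_pdivlMr //.
rewrite (le_trans _ (Im_cmod _)) // ImD ImM /= mulr0 !add0r normrM mulrC.
by [].
Qed.

End NonReal.

(* The derivatives of [x |-> 1/(z-x)] are [omega_family z]; those of
   [y |-> 1/(z+1/y) = y/(1+zy)], the same function near infinity, are: *)
Definition omega_infty z j y : R[i] :=
  if j is j'.+1 then (-1) ^+ j' * j`!%:R * z ^+ j' * (1 + z * y%:C) ^- j.+1
  else y%:C / (1 + z * y%:C).

Lemma is_cderive_omega_infty z j y : complex.Im z != 0 ->
  is_cderive y (1 : R) (omega_infty z j) (omega_infty z j.+1 y).
Proof.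
move=> z0; have n0 := affine_neq0 z0 y.
case: j => [|j].
  have h := is_cderiveM (is_cderive_real y) (@is_cderive_affine_powV _ 1 z 1 _ n0).
  apply: is_cderive_eq; first exact: h.
  by rewrite /omega_infty (_ : 1`! = 1)%N // expr1; field.
have h := @is_cderive_affine_powV _ 1 z j.+2 _ n0.
apply: is_cderive_eq.
  exact: is_cderiveM (is_cderive_cst y (1 : R) ((-1) ^+ j * (j.+1)`!%:R * z ^+ j)) h.
by rewrite /omega_infty !factS !natrM !exprS; ring.
Qed.

Lemma at_infty_omega z : complex.Im z != 0 -> at_infty (omega z) = omega_infty z 0.
Proof.
move=> z0; apply/funext => y; rewrite /at_infty /omega_infty lim_infty_omega //.
case: eqP => [->|/eqP y0]; first by rewrite mul0r.
have yC : y%:C != 0 :> R[i] by rewrite -cmod_eq0 cmodR normr_eq0.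
rewrite /omega rmorphN fmorphV opprK.
have -> : z + y%:C^-1 = (1 + z * y%:C) / y%:C by field.
by rewrite invf_div.
Qed.

Lemma omega_family_bound z j x : complex.Im z != 0 ->
  cmod (omega_family z j x) <= j`!%:R * tau z ^+ (j.*2.+1).
Proof.
move=> z0; rewrite /omega_family cmodM cmod_nat ler_wpM2l // -exprVn cmodX.
apply: (@le_trans _ _ (tau z ^+ j.+1)).
  rewrite lerXn2r ?nnegrE ?cmod_ge0 ?(ltW (tau_gt0 z0)) //.
  rewrite (le_trans _ (tau_ge_invIm z)) //; exact: cmod_omega.
by rewrite ler_weXn2l ?tau_ge1 // ltnS -addnn leq_addr.
Qed.

(** The j-th derivative has j-1 factors [z] and j+1 factors 1/(1+zy), each at most [tau z], for j
    positive; for j = 0 one power suffices. The exponent 2j+1 covers both cases, and also the j+1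
    powers needed on the real line. *)
Lemma omega_infty_bound z j x : complex.Im z != 0 ->
  cmod (omega_infty z j x) <= j`!%:R * tau z ^+ (j.*2.+1).
Proof.
move=> z0; case: j => [|j].
  by rewrite fact0 mul1r expr1 cmod_affine_ratio.
rewrite /omega_infty !cmodM !cmodX cmodN cmod1 expr1n mul1r cmod_nat -mulrA ler_wpM2l //.
rewrite -exprVn cmodX (@le_trans _ _ (tau z ^+ j * tau z ^+ j.+2)) //.
  rewrite ler_pM ?exprn_ge0 ?cmod_ge0 // lerXn2r ?nnegrE ?cmod_ge0 ?(ltW (tau_gt0 z0)) //.
    exact: tau_ge_cmod.
  exact: cmod_affineV.
rewrite -exprD ler_weXn2l ?tau_ge1 // doubleS -addnn !addnS leqnSn //.
Qed.

(** These sets exhaust the plane off the real axis. On each of them |z| is at most n and |Im z| at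
    least 1/n, which makes the kernels bounded and Lipschitz in [z]. *)
Definition in_K n z := complex.Im z != 0 /\ tau z <= n%:R.

(** Boundedness is bundled with the Lipschitz condition to make the class stable under products;
    both are uniform in the real variable. *)
Definition K_lipschitz n (phi : R[i] -> R -> R[i]) := exists M : R, 0 <= M /\
  forall z w, in_K n z -> in_K n w -> forall x,
    cmod (phi z x) <= M /\ cmod (phi z x - phi w x) <= M * cmod (z - w).

Lemma K_lipschitzM n phi psi : K_lipschitz n phi -> K_lipschitz n psi ->
  K_lipschitz n (fun z x => phi z x * psi z x).
Proof.
move=> [M [M0 hM]] [N [N0 hN]]; exists (M * N *+ 2); split.
  by rewrite mulrn_wge0 // mulr_ge0.
move=> z w Kz Kw x; have [h1 h2] := hM z w Kz Kw x; have [g1 g2] := hN z w Kz Kw x.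
have [h3 _] := hM w z Kw Kz x.
split.
  by rewrite cmodM (@le_trans _ _ (M * N)) ?ler_pM ?cmod_ge0 // mulr2n lerDl mulr_ge0.
rewrite (_ : _ - _ = (phi z x - phi w x) * psi z x + phi w x * (psi z x - psi w x)); last by ring.
rewrite (le_trans (cmodD _ _)) // !cmodM mulr2n mulrDl lerD //.
  by rewrite mulrAC ler_pM ?cmod_ge0.
by rewrite -mulrA ler_pM ?cmod_ge0.
Qed.

Lemma K_lipschitz_cst n (c : R[i]) : K_lipschitz n (fun _ _ => c).
Proof.
exists (cmod c); split; first exact: cmod_ge0.
by move=> z w _ _ x; rewrite subrr cmod0 mulr_ge0 ?cmod_ge0.
Qed.

Lemma K_lipschitzX n phi m : K_lipschitz n phi ->
  K_lipschitz n (fun z x => phi z x ^+ m).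
Proof.
move=> h; elim: m => [|m ih]; first exact: K_lipschitz_cst.
have := K_lipschitzM h ih; congr K_lipschitz.
by apply/funext => z; apply/funext => x; rewrite exprS.
Qed.

Lemma K_lipschitz_id n : K_lipschitz n (fun z _ => z).
Proof.
exists n.+1%:R; split => // z w [z0 nz] _ x; split.
  by rewrite (le_trans (tau_ge_cmod z0)) // (le_trans nz) // ler_nat.
by rewrite ler_peMl ?cmod_ge0 // ler1n.
Qed.

(** A resolvent identity turns a bound into a Lipschitz bound. It holds for 1/(z-x) and for y/(1+zy)
    alike, so one argument serves both charts. *)
Lemma K_lipschitz_resolvent n (phi : R[i] -> R -> R[i]) :
  (forall z x, complex.Im z != 0 -> cmod (phi z x) <= tau z) ->
  (forall z w x, complex.Im z != 0 -> complex.Im w != 0 ->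
     phi z x - phi w x = (w - z) * (phi z x * phi w x)) ->
  K_lipschitz n phi.
Proof.
move=> h1 h2; exists (n%:R + n%:R * n%:R); split; first by rewrite addr_ge0 ?mulr_ge0.
move=> z w [z0 nz] [w0 nw] x; split.
  by rewrite (le_trans (h1 _ _ z0)) // (le_trans nz) // lerDl mulr_ge0.
rewrite h2 // cmodM mulrC cmodBC ler_wpM2r ?cmod_ge0 // cmodM.
rewrite (@le_trans _ _ (n%:R * n%:R)) ?lerDr //.
rewrite ler_pM ?cmod_ge0 //.
  by rewrite (le_trans (h1 _ _ z0)).
by rewrite (le_trans (h1 _ _ w0)).
Qed.

Lemma K_lipschitz_omega_family n j : K_lipschitz n (fun z x => omega_family z j x).
Proof.
rewrite /omega_family.
under [fun z => _]eq_fun do under eq_fun do rewrite -exprVn.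
apply: K_lipschitzM; first exact: K_lipschitz_cst.
apply: K_lipschitzX; apply: K_lipschitz_resolvent.
  by move=> z x z0; apply: (le_trans _ (tau_ge_invIm z)); apply: cmod_omega.
move=> z w x z0 w0; have zx := nonreal_neq x z0; have wx := nonreal_neq x w0.
by field; rewrite zx wx.
Qed.

Lemma K_lipschitz_ext n phi psi :
  (forall z x, complex.Im z != 0 -> phi z x = psi z x) ->
  K_lipschitz n phi -> K_lipschitz n psi.
Proof.
move=> e [M [M0 h]]; exists M; split => // z w Kz Kw x.
by rewrite -!e //; [apply: h | case: Kw | case: Kz].
Qed.

Lemma K_lipschitzD n phi psi : K_lipschitz n phi -> K_lipschitz n psi ->
  K_lipschitz n (fun z x => phi z x + psi z x).
Proof.
move=> [M [M0 hM]] [N [N0 hN]]; exists (M + N); split; first by rewrite addr_ge0.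
move=> z w Kz Kw x; have [h1 h2] := hM z w Kz Kw x; have [g1 g2] := hN z w Kz Kw x.
split; first by rewrite (le_trans (cmodD _ _)) // lerD.
by rewrite opprD addrACA (le_trans (cmodD _ _)) // mulrDl lerD.
Qed.

Lemma K_lipschitz_omega_infty n j : K_lipschitz n (fun z x => omega_infty z j x).
Proof.
have h0 : K_lipschitz n (fun z y => y%:C / (1 + z * y%:C)).
  apply: K_lipschitz_resolvent; first by move=> z x z0; apply: cmod_affine_ratio.
  move=> z w x z0 w0; have zx := affine_neq0 z0 x; have wx := affine_neq0 w0 x.
  by field; rewrite zx wx.
case: j => [//|j]; rewrite /omega_infty.
under [fun z => _]eq_fun do under eq_fun do rewrite -exprVn.
apply: K_lipschitzM; first apply: K_lipschitzM.
- exact: K_lipschitz_cst.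
- exact/K_lipschitzX/K_lipschitz_id.
apply: K_lipschitzX.
(* 1/(1+zy) satisfies no such identity by itself, but equals 1 - z * y/(1+zy), a combination of
   factors already treated. *)
apply: (@K_lipschitz_ext _ (fun z y => 1 + ((-1) * z) * (y%:C / (1 + z * y%:C)))).
  by move=> z x z0; have zx := affine_neq0 z0 x; field.
apply: K_lipschitzD; first exact: K_lipschitz_cst.
apply: K_lipschitzM => //; apply: K_lipschitzM; first exact: K_lipschitz_cst.
exact: K_lipschitz_id.
Qed.

(** The decay condition with one power of |Im z| gives 0 on the axis. All integrands below thus
    vanish where the kernels have poles and [resolvent] is arbitrary. *)
Lemma extension_real f ft g z : @extension R f ft g -> complex.Im z = 0 -> g z = 0.
Proof.
move=> [_ _ _ _ _ _ _ /(_ 1%N 0%N) [C hC]] z0.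
have := hC z; rewrite z0 normr0 expr1 mulr0 norm_leC.
by move=> h; apply/eqP; rewrite -cmod_eq0 eq_le h cmod_ge0.
Qed.

(** With m powers of |Im z| and 2m+4 of 1/<z>, multiplication by tau^m = <z>^(2m) / |Im z|^m leaves
    exactly <z>^-4. *)
Lemma extension_decay f ft g m : @extension R f ft g -> exists C : R, 0 <= C /\
  forall z, complex.Im z != 0 -> cmod (g z) * tau z ^+ m <= C * weight z.
Proof.
move=> [_ _ _ _ _ _ _ /(_ m (m.*2 + 4)%N) [C hC]]; exists `|C|; split => // z z0.
have i0 : 0 < `|complex.Im z| by rewrite normr_gt0.
have := hC z; rewrite norm_leC (_ : (m.*2 + 4 = 2 * (m + 2))%N); last first.
  by rewrite mulnDr mul2n.
rewrite exprM bracket_sqr exprD invfM => h.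
have h' : cmod (g z) <= `|C| * (br2 z ^- m * br2 z ^- 2) * `|complex.Im z| ^+ m.
  apply: (le_trans h); rewrite ler_wpM2r ?exprn_ge0 // ler_wpM2r ?ler_norm //.
  by rewrite mulr_ge0 // invr_ge0 exprn_ge0 // ltW // br2_gt0.
rewrite (le_trans (ler_wpM2r _ h')) ?exprn_ge0 ?(ltW (tau_gt0 z0)) //.
rewrite /tau /weight expr_div_n.
have b0 := br2_gt0 z.
rewrite le_eqVlt; apply/orP; left; apply/eqP.
have bm : br2 z ^+ m != 0 by rewrite expf_neq0 // gt_eqF.
have im : `|complex.Im z| ^+ m != 0 by rewrite expf_neq0 // gt_eqF.
by field; rewrite bm im gt_eqF.
Qed.

End Kernels.

(** * Smooth test functions *)

Section FlatFunction.
Context {R : realType}.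
Implicit Types (q : {poly R}) (x t : R).

(* These are the derivatives of all orders of [x |-> exp(-1/x)] for [0 < x],
   extended by 0. *)
Definition flat q x : R := if 0 < x then q.[x^-1] * expR (- x^-1) else 0.

Lemma is_derive_chain (f g : R -> R) x df dg :
  is_derive x 1 f df -> is_derive (f x) 1 g dg ->
  is_derive x 1 (fun y => g (f y)) (dg * df).
Proof.
move=> hf hg; exact: (@is_derive1_comp _ g f x dg df hg hf).
Qed.

Lemma monomial_le_expR n t : 0 <= t -> t ^+ n <= n`!%:R * expR t.
Proof.
move=> t0; case: n => [|n].
  by rewrite expr0 fact0 mul1r; rewrite (le_trans _ (expR_ge1Dx t)) // lerDl.
rewrite mulrC -ler_pdivrMr ?ltr0n ?fact_gt0 //.
by rewrite (le_trans _ (expR_ge1Dxn n t0)) // lerDr.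
Qed.

Lemma poly_le_expR q : exists C, 0 <= C /\
  forall t, 0 <= t -> `|q.[t]| <= C * expR t.
Proof.
exists (\sum_(i < size q) `|q`_i| * i`!%:R); split.
  by apply: sumr_ge0 => i _; rewrite mulr_ge0.
move=> t t0; rewrite horner_coef (le_trans (ler_norm_sum _ _ _)) // mulr_suml.
apply: ler_sum => i _; rewrite normrM normrX (ger0_norm t0) -mulrA ler_wpM2l //.
exact: monomial_le_expR.
Qed.

(** The bound of a polynomial by the exponential, applied to X q at 1/x, controls q(1/x) exp(-1/x) /
    x. *)
Lemma flat_small q : exists C, 0 <= C /\ forall x, `|flat q x| <= C * `|x|.
Proof.
have [C [C0 hC]] := poly_le_expR ('X * q); exists C; split => // x.
rewrite /flat; case: ifP => [x0|_]; last by rewrite normr0 mulr_ge0.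
have := hC x^-1; rewrite invr_ge0 (ltW x0) => /(_ isT).
rewrite hornerM hornerX !normrM normfV (gtr0_norm x0) (ger0_norm (expR_ge0 _)).
rewrite expRN ler_pdivrMr ?expR_gt0 // mulrC ler_pdivrMr // mulrAC.
by [].
Qed.

(** For positive [x], differentiating q(1/x) exp(-1/x) gives x^-2 (q - q')(1/x) exp(-1/x). At 0 the
    difference quotient of [flat q] is [flat ('X * q)], which tends to 0 by [flat_small]. *)
Lemma is_derive_flat q x : is_derive x 1 (flat q) (flat ('X^2 * (q - q^`())) x).
Proof.
have [x0|x0|->] := ltgtP x 0.
- apply: (@near_eq_is_derive _ _ _ (fun=> 0)); last first.
    by rewrite /flat ltNge (ltW x0) /=; apply: is_derive_cst.
  near=> y; rewrite /flat ltNge ltW //=; near: y; exact: lt_nbhsl.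
- have i0 : x != 0 by rewrite gt_eqF.
  have hi : is_derive x 1 (fun y : R => y^-1) (- 1 / x ^+ 2).
    exact: (@is_derive_inv _ _ id x 1 1).
  have hq : is_derive x^-1 1 (horner q) (q^`().[x^-1]).
    apply: DeriveDef; first exact: derivable_horner.
    by rewrite -derive1E -derivE.
  have h1 := is_derive_chain hi hq.
  have he : is_derive (- x^-1) 1 expR (expR (- x^-1)) by exact: is_derive_expR.
  have hn : is_derive x 1 (fun y : R => - y^-1) (- (- 1 / x ^+ 2)) by exact: is_deriveN.
  have h2 := is_derive_chain hn he.
  have h3 := is_deriveM h1 h2.
  apply: is_derive_eq.
    apply: (near_eq_is_derive _ h3).
    near=> y; rewrite /flat ifT //; near: y; exact: lt_nbhsr.
  by rewrite /flat x0 !hornerE /GRing.scale /=; field.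
- have [C [C0 hC]] := flat_small ('X * q).
  have L : (fun h => h^-1 *: ((flat q \o shift 0) (h *: (1 : R)) - flat q 0)) @ 0^' --> (0 : R).
    apply/cvgrPdist_lt => e e0; near=> h.
    have h0 : h != 0 by near: h; exact: nbhs_dnbhs_neq.
    rewrite /= /shift /= addr0 /flat ltxx subr0 sub0r normrN /GRing.scale /= mulr1.
    have -> : h^-1 * (if 0 < h then q.[h^-1] * expR (- h^-1) else 0) = flat ('X * q) h.
      by rewrite /flat; case: ifP => _; rewrite ?mulr0 // hornerM hornerX mulrA.
    rewrite (le_lt_trans (hC h)) //.
    have : `|h| < e / (C + 1).
      near: h; apply: dnbhs0_lt; rewrite divr_gt0 //; by rewrite ltr_wpDl.
    rewrite ltr_pdivlMr ?ltr_wpDl // mulrDr mulr1 [_ * C]mulrC; apply: le_lt_trans.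
    by rewrite lerDl.
  have -> : flat ('X^2 * (q - q^`())) 0 = 0 by rewrite /flat ltxx.
  by apply: DeriveDef; [exact: (cvgP _ L) | apply: cvg_lim].
Unshelve. all: by end_near. Qed.

Lemma flat_gt0 x : 0 < x -> 0 < flat 1 x.
Proof. by move=> x0; rewrite /flat x0 hornerC mul1r expR_gt0. Qed.

Lemma flat_ge0 x : 0 <= flat 1 x.
Proof. by rewrite /flat; case: ifP => _ //; rewrite hornerC mul1r expR_ge0. Qed.

Lemma flat_le0 q x : x <= 0 -> flat q x = 0.
Proof. by move=> x0; rewrite /flat ltNge x0. Qed.

End FlatFunction.

(** * A class of smooth functions closed under differentiation *)

Section SmoothClass.
Context {R : realType}.

(* A syntactic class: smoothness to all orders then follows from the single
   statement [smooth_fun_derive] that it is stable under differentiation. *)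
Inductive smooth_fun (V : normedModType R) : (V -> R) -> Prop :=
| smooth_fun_cst c : smooth_fun (fun=> c)
| smooth_fun_lin l : (forall p, differentiable l p) ->
    (forall v, exists c, forall p, is_derive p v l c) -> smooth_fun l
| smooth_funD f g : smooth_fun f -> smooth_fun g ->
    smooth_fun (fun p => f p + g p)
| smooth_funM f g : smooth_fun f -> smooth_fun g ->
    smooth_fun (fun p => f p * g p)
| smooth_funV f : (forall p, f p != 0) -> smooth_fun f ->
    smooth_fun (fun p => (f p)^-1)
| smooth_fun_flat q f : smooth_fun f -> smooth_fun (fun p => flat q (f p)).

Context {V : normedModType R}.
Implicit Types (f g : V -> R).

Lemma differentiable_flat q x : differentiable (flat q : R -> R) x.
Proof.
by apply/derivable1_diffP; have h := is_derive_flat q x; apply: ex_derive.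
Qed.

Lemma smooth_fun_differentiable f : smooth_fun f -> forall p, differentiable f p.
Proof.
elim=> {f} [c|l dl _|f g _ hf _ hg|f g _ hf _ hg|f f0 _ hf|q f _ hf] p.
- exact: differentiable_cst.
- exact: dl.
- exact: differentiableD.
- exact: differentiableM.
- exact: differentiableV.
- exact: (@differentiable_comp _ _ _ _ f (flat q) p (hf p) (differentiable_flat q (f p))).
Qed.

Lemma smooth_fun_continuous f : smooth_fun f -> continuous f.
Proof.
by move=> sf p; apply: differentiable_continuous; apply: smooth_fun_differentiable.
Qed.

Lemma is_derive_comp (h : R -> R) f p v dh df : differentiable f p ->
  is_derive p v f df -> is_derive (f p) (1 : R) h dh ->
  is_derive p v (fun p => h (f p)) (dh * df).
Proof.
move=> sf [_ fd] hd.
have df2 : differentiable h (f p) by apply/derivable1_diffP; apply: ex_derive.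
have dc := @differentiable_comp _ _ _ _ f h p sf df2.
apply: DeriveDef; first exact: diff_derivable.
rewrite (deriveE v dc) (diff_comp sf df2) /= (diff1E df2) /GRing.scale /=.
by rewrite -(deriveE v sf) fd mulrC derive1E derive_val.
Qed.

Lemma smooth_fun_derive f v : smooth_fun f ->
  exists f', smooth_fun f' /\ forall p, is_derive p v f (f' p).
Proof.
elim=> {f} [c|l dl /(_ v)[c hc]|f g sf [f' [sf' hf]] sg [g' [sg' hg]]
  |f g sf [f' [sf' hf]] sg [g' [sg' hg]]|f f0 sf [f' [sf' hf]]|q f sf [f' [sf' hf]]].
- exists (fun=> 0); split; first exact: smooth_fun_cst.
  by move=> p; exact: is_derive_cst.
- by exists (fun=> c); split; first exact: smooth_fun_cst.
- exists (fun p => f' p + g' p); split; first exact: smooth_funD.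
  by move=> p; apply: is_deriveD.
- exists (fun p => f p * g' p + g p * f' p); split.
    by apply: smooth_funD; apply: smooth_funM.
  by move=> p; apply: is_deriveM.
- exists (fun p => (-1) * f' p * ((f p)^-1 * (f p)^-1)); split.
    apply: smooth_funM; last by apply: smooth_funM; apply: smooth_funV.
    by apply: smooth_funM => //; exact: smooth_fun_cst.
  move=> p; apply: is_derive_eq; first exact: (@is_derive_inv _ _ f p v _ (f0 p) (hf p)).
  by rewrite mulN1r -invfM expr2.
- exists (fun p => flat ('X^2 * (q - q^`())) (f p) * f' p); split.
    by apply: smooth_funM => //; exact: smooth_fun_flat.
  move=> p; apply: is_derive_comp => //; last exact: is_derive_flat.
  exact: smooth_fun_differentiable.
Qed.

End SmoothClass.

(** * Smooth functions on the plane, and composition *)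

Section PlaneFunctions.
Context {R : realType}.
Implicit Types (f g : R * R -> R).

Lemma is_derive_fst (p v : R * R) : is_derive p v (fun q : R * R => q.1) v.1.
Proof.
have c : {for p, continuous (@fst R R)} by apply: cvg_fst.
have d : differentiable (@fst R R) p.
  by apply: linear_differentiable => q; apply: cvg_fst.
apply: DeriveDef; first exact: diff_derivable.
rewrite deriveE // diff_lin // => q; exact: cvg_fst.
Qed.

Lemma is_derive_snd (p v : R * R) : is_derive p v (fun q : R * R => q.2) v.2.
Proof.
have d : differentiable (@snd R R) p.
  by apply: linear_differentiable => q; apply: cvg_snd.
apply: DeriveDef; first exact: diff_derivable.
rewrite deriveE // diff_lin // => q; exact: cvg_snd.
Qed.

Lemma smooth_fun_fst : smooth_fun (fun q : R * R => q.1).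
Proof.
apply: smooth_fun_lin => [p|v]; last by exists v.1 => p; exact: is_derive_fst.
by apply: linear_differentiable => q; apply: cvg_fst.
Qed.

Lemma smooth_fun_snd : smooth_fun (fun q : R * R => q.2).
Proof.
apply: smooth_fun_lin => [p|v]; last by exists v.2 => p; exact: is_derive_snd.
by apply: linear_differentiable => q; apply: cvg_snd.
Qed.

Lemma smooth_fun_id : smooth_fun (fun x : R => x).
Proof.
apply: smooth_fun_lin => [p|v]; first exact/derivable1_diffP/derivable_id.
by exists v => p; exact: is_derive_id.
Qed.

Lemma smooth_fun_comp (V : normedModType R) (h : R -> R) (f : V -> R) :
  smooth_fun h -> smooth_fun f -> smooth_fun (fun p => h (f p)).
Proof.
move=> sh sf; elim: sh => {h}
  [c|l dl /(_ 1)[c hc]|h1 h2 _ s1 _ s2|h1 h2 _ s1 _ s2|h h0 _ s|q h _ s].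
- exact: smooth_fun_cst.
(* On the line a constant derivative forces [l] to be affine, and an affine function of [f] is built
   from sums and products. *)
- have -> : l = (fun x => c * x + l 0).
    apply/funext => x.
    have h1 (y : R) : is_derive y (1 : R) (fun x : R => l x - c * x) 0.
      have hcy := hc y.
      by apply: is_derive_eq; rewrite /GRing.scale /= mulr1 subrr.
    have := @is_derive_0_is_cst _ (fun x => l x - c * x) x 0 h1.
    by rewrite mulr0 subr0 => <-; rewrite addrC subrK.
  apply: smooth_funD; last exact: smooth_fun_cst.
  by apply: smooth_funM => //; exact: smooth_fun_cst.
- exact: smooth_funD.
- exact: smooth_funM.
- by apply: smooth_funV => // p; apply: h0.
- exact: smooth_fun_flat.
Qed.

Lemma continuous_complex (T : topologicalType) (u v : T -> R) :
  continuous u -> continuous v -> continuous (fun t => u t +i* v t).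
Proof.
move=> cu cv t; apply: cvgC => e e0.
have e2 : 0 < e / 2 by rewrite divr_gt0.
have /cvgrPdist_lt /(_ _ e2) hu := cu t.
have /cvgrPdist_lt /(_ _ e2) hv := cv t.
near=> s; rewrite (le_lt_trans (cmod_ReIm _)) //= [ltRHS]splitr ltrD //; near: s.
- exact: hu.
- exact: hv.
Unshelve. all: by end_near. Qed.

Lemma smooth2_smooth_fun f g : smooth_fun f -> smooth_fun g ->
  smooth2 (fun p => f p +i* g p).
Proof.
move=> sf sg s.
have [F [G [sF sG ->]]] : exists F G : R * R -> R, [/\ smooth_fun F, smooth_fun G
    & pderive s (fun p => f p +i* g p) = (fun p => F p +i* G p)].
  elim: s => [|b s [F [G [sF sG e]]]]; first by exists f, g.
  have [F' [sF' hF]] := smooth_fun_derive (axis b) sF.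
  have [G' [sG' hG]] := smooth_fun_derive (axis b) sG.
  exists F', G'; split => //.
  rewrite /= {}e; apply/funext => p; apply: is_cderiveE.
  by split; [exact: hF | exact: hG].
split; first by apply: continuous_complex; exact: smooth_fun_continuous.
move=> b p; split => /=; apply: diff_derivable; exact: smooth_fun_differentiable.
Qed.

End PlaneFunctions.

(** * Integrals over the plane *)

Section PlaneMeasurability.
Context {R : realType}.
Local Notation plane := (measurableTypeR R * measurableTypeR R)%type.

(** An open set is the countable union of the squares with rational centre and radius that it
    contains, and squares belong to the product sigma-algebra. *)
Lemma open_plane_measurable (O : set (R * R)) : open O -> measurable (O : set plane).
Proof.
move=> oO.
pose rect (q : rat * rat * rat) : set (R * R) := ball (ratr q.1.1 : R, ratr q.1.2 : R) (ratr q.2).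
pose F q : set plane := if pselect (rect q `<=` O) then rect q else set0.
have mrect q : measurable (rect q : set plane).
  have -> : rect q = ball (ratr q.1.1 : R) (ratr q.2) `*` ball (ratr q.1.2 : R) (ratr q.2).
    by apply/seteqP; split => -[x y].
  by apply: measurableX; rewrite !ball_itv; exact: measurable_itv.
have -> : O = \bigcup_q F q.
  apply/seteqP; split => [[x y] Oxy|p [q _]]; last first.
    by rewrite /F; case: pselect => // h; exact: h.
  have /nbhs_ballP[e /= e0 eO] := oO _ Oxy.
  have e2 : 0 < e / 2 by rewrite divr_gt0.
  have e4 : 0 < e / 4 by rewrite divr_gt0.
  (* A rational centre within e/4 in each coordinate and a rational radius between e/4 and e/2 give
     a square that contains the point and stays within distance e of it. *)
  have : e / 4 < e / 2 by lra.
  move=> /rat_in_itvoo[r]; rewrite in_itv /= => /andP[r1 r2].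
  have : x < x + e / 4 by rewrite ltrDl.
  move=> /rat_in_itvoo[a]; rewrite in_itv /= => /andP[a1 a2].
  have : y < y + e / 4 by rewrite ltrDl.
  move=> /rat_in_itvoo[b]; rewrite in_itv /= => /andP[b1 b2].
  exists (a, b, r) => //; rewrite /F; case: (pselect (rect (a, b, r) `<=` O)) => [hO|nO].
    by split; rewrite /ball /= ltr_norml; apply/andP; split; lra.
  exfalso; apply: nO => -[u v] [/= h1 h2]; apply: eO; split => /=.
    move: h1; rewrite /ball /= !ltr_norml => /andP[h4 h3]; apply/andP; split; lra.
  move: h2; rewrite /ball /= !ltr_norml => /andP[h4 h3]; apply/andP; split; lra.
apply: countable_bigcupT_measurable => // q.
by rewrite /F; case: pselect => h /=; [exact: (mrect q) | exact: measurable0].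
Qed.

Lemma continuous_plane_measurable (f : R * R -> R) : continuous f ->
  measurable_fun setT (f : plane -> R).
Proof.
move=> /continuousP cf; apply: (measurability _ (measurable_realfun.RGenOpens.measurableE R)).
move=> _ [_ [a [b ->] <-]]; rewrite setTI; apply: open_plane_measurable.
exact/cf/interval_open.
Qed.

Lemma measurable_invr : measurable_fun setT (fun x : R => x^-1).
Proof.
rewrite -(setUv [set 0 : R]); apply/measurable_funU => //.
  exact: measurableC.
split; first exact: measurable_fun_set1.
apply: open_continuous_measurable_fun; first
  exact/closed_openC/accessible_closed_set1/hausdorff_accessible/Rhausdorff.
move=> x /[!inE] /eqP x0; exact: inv_continuous.
Qed.
End PlaneMeasurability.

(** * Improper integrals on the line *)

Section LineIntegrals.
Context {R : realType}.
Implicit Types (f F : R -> R) (x y : R).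
Local Notation leb := (@lebesgue_measure R).

(** The fundamental theorem on each half-line; the negative one is reflected, with antiderivative
    [- F (- x)]. *)
Lemma ge0_integral_line f F (a b : R) : (forall x, 0 <= f x) -> continuous f ->
  (forall x, is_derive x 1 F (f x)) ->
  F x @[x --> +oo] --> b -> F (- x) @[x --> +oo] --> a ->
  (\int[leb]_x (f x)%:E = (b - a)%:E)%E.
Proof.
move=> f0 cf dF Fb Fa.
have mf : measurable_fun setT f by exact: continuous_measurable_fun.
have cF : continuous F.
  move=> x; apply: differentiable_continuous; apply/derivable1_diffP.
  by have h := dF x; apply: ex_derive.
have Hp : (\int[leb]_(x in `[0%R, +oo[) (f x)%:E = b%:E - (F 0)%:E)%E.
  apply: ge0_continuous_FTC2y => //.
  - exact: continuous_subspaceT.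
  - by apply: cvg_at_right_filter; exact: cF.
  - by move=> x _; rewrite derive1E; have h := dF x; rewrite derive_val.
have dG x : is_derive x 1 (fun y => - F (- y)) (f (- x)).
  have hN : is_derive x 1 (fun y : R => - y) (-1) by apply: is_deriveN.
  have h := is_derive_chain hN (dF (- x)).
  by apply: is_derive_eq; rewrite mulrN1 opprK.
have cfN : continuous (fun x => f (- x)).
  by move=> x; apply: continuous_comp; [exact: oppr_continuous | exact: cf].
(* The endpoint is written [- 0] to fit the substitution x -> -x. *)
have Hn : (\int[leb]_(x in `]-oo, (- 0)%R]) (f x)%:E = (- a)%:E - (- F 0)%:E)%E.
  rewrite ge0_integration_by_substitutionNy //; last exact: continuous_subspaceT.
  rewrite -[in RHS]oppr0.
  apply: (@ge0_continuous_FTC2y _ (fun x => f (- x)) (fun y => - F (- y))) => //.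
  - exact: continuous_subspaceT.
  - by apply: cvgN.
  - apply: cvg_at_right_filter.
    apply: (@continuous_comp _ _ _ (fun y : R => F (- y)) (fun y => - y));
      last exact: oppr_continuous.
    by apply: continuous_comp; [exact: oppr_continuous | exact: cF].
  - by move=> x _; rewrite derive1E; have h := dG x; rewrite derive_val.
have split0 : [set: R] = `]-oo, (- 0)%R] `|` `]0%R, +oo[.
  rewrite oppr0; apply/seteqP; split => x //= _.
  by rewrite !in_itv /= andbT; case: leP; [left|right].
rewrite split0 ge0_integral_setU //=.
- rewrite Hn integral_itv_obnd_cbnd ?Hp; last first.
    apply/measurable_EFinP; exact: measurable_funTS.
  by rewrite -!EFinB -EFinD; congr (_%:E); ring.
- by rewrite -split0; apply/measurable_EFinP.
- by move=> x _; rewrite lee_fin.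
- rewrite oppr0; apply/disj_setPS => x /= []; rewrite !in_itv /= andbT => h1 h2.
  by have := le_lt_trans h1 h2; rewrite ltxx.
Qed.

Lemma cvg_pinfty_rate F (b C : R) :
  (forall x, 1 < x -> `|b - F x| <= C / x) -> F x @[x --> +oo] --> b.
Proof.
move=> h; apply/cvgrPdist_lt => e e0; near=> x.
have x1 : 1 < x by near: x; apply: nbhs_pinfty_gt; rewrite num_real.
rewrite (le_lt_trans (h x x1)) // ltr_pdivrMr ?(lt_trans ltr01) // mulrC -ltr_pdivrMr //.
by near: x; apply: nbhs_pinfty_gt; rewrite num_real.
Unshelve. all: by end_near. Qed.

Lemma integral_line_odd f F (b c : R) : (forall x, 0 <= f x) -> continuous f ->
  (forall x, is_derive x 1 F (f x)) -> (forall x, F (- x) = - F x) ->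
  F x @[x --> +oo] --> b ->
  (\int[leb]_x (f (x - c))%:E = (2 * b)%:E)%E.
Proof.
move=> f0 cf dF oF Fb.
have shift d : F (x + d) @[x --> +oo] --> b.
  apply: (@cvg_comp _ _ _ (fun x => x + d) F _ +oo) => //.
  by apply: cvg_addrr.
have -> : (2 * b)%:E = (b - - b)%:E :> \bar R by congr (_%:E); ring.
apply: (@ge0_integral_line (fun x => f (x - c)) (fun x => F (x - c))) => //.
- move=> x; apply: (@continuous_comp _ _ _ (fun x => x - c) f); last exact: cf.
  by apply: cvgB; [exact: cvg_id | exact: cvg_cst].
- move=> x; have hN : is_derive x 1 (fun y : R => y - c) 1.
    by apply: is_derive_eq; rewrite subr0.
  by have h := is_derive_chain hN (dF (x - c)); apply: is_derive_eq; rewrite mulr1.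
- have -> : (fun x => F (- x - c)) = (fun x => - F (x + c)).
    by apply/funext => x; rewrite -opprD oF.
  exact: cvgN.
Qed.

(** Of the antiderivative [F] only the arctangent term survives at infinity; it contributes pi / (4
    c^3) at each end. *)
Lemma integral_cauchy2 (c : R) : 0 < c ->
  (\int[leb]_x ((x ^+ 2 + c ^+ 2) ^- 2)%:E = (pi / (2 * c ^+ 3))%:E)%E.
Proof.
move=> c0; have cn : c != 0 by rewrite gt_eqF.
have n0 x : x ^+ 2 + c ^+ 2 != 0 by rewrite gt_eqF // ltr_wpDl ?sqr_ge0 // exprn_gt0.
pose f x := (x ^+ 2 + c ^+ 2) ^- 2.
pose F x := (2 * c ^+ 2)^-1 * (x * (x ^+ 2 + c ^+ 2)^-1) + (2 * c ^+ 3)^-1 * atan (x * c^-1).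
have dF x : is_derive x 1 F (f x).
  have hx : is_derive x 1 (fun y : R => y ^+ 2 + c ^+ 2) (2 * x).
    by apply: is_derive_eq; rewrite /GRing.scale /=; ring.
  have hi := @is_derive_inv _ _ (fun y => y ^+ 2 + c ^+ 2) x 1 _ (n0 x) hx.
  have hc : is_derive x 1 (fun y : R => y * c^-1) c^-1.
    by apply: is_derive_eq; rewrite /GRing.scale /=; ring.
  have ha := is_derive_chain hc (is_derive1_atan (x * c^-1)).
  apply: is_derive_eq; rewrite /f /GRing.scale /=.
  have h1 : 1 + (x / c) ^+ 2 = (x ^+ 2 + c ^+ 2) / c ^+ 2 by field.
  by rewrite h1; field; rewrite n0 cn.
have -> : (pi / (2 * c ^+ 3))%:E = (2 * (pi / (4 * c ^+ 3)))%:E :> \bar R.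
  by congr (_%:E); field.
rewrite -(@integral_line_odd f F _ 0).
- by apply: eq_integral => x _; rewrite subr0.
- by move=> x; rewrite invr_ge0 exprn_ge0 // addr_ge0 ?sqr_ge0.
- move=> x; apply: differentiable_continuous; apply/derivable1_diffP.
  have hx : is_derive x 1 (fun y : R => (y ^+ 2 + c ^+ 2) ^+ 2) (2 * (x ^+ 2 + c ^+ 2) * (2 * x)).
    by apply: is_derive_eq; rewrite /GRing.scale /=; ring.
  have hi : is_derive x 1 f _ := @is_derive_inv _ _
    (fun y => (y ^+ 2 + c ^+ 2) ^+ 2) x 1 _ (expf_neq0 2 (n0 x)) hx.
  by apply: ex_derive.
- by move=> x; rewrite /F sqrrN !mulNr atanN; ring.
- have -> : pi / (4 * c ^+ 3) = (2 * c ^+ 2)^-1 * 0 + (2 * c ^+ 3)^-1 * (pi / 2) by field.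
  apply: cvgD; apply: cvgM; [exact: cvg_cst| |exact: cvg_cst|].
    apply: (@cvg_pinfty_rate _ _ 1) => x x1; have x0 : 0 < x by rewrite (lt_trans ltr01).
    rewrite sub0r normrN ger0_norm ?divr_ge0 ?addr_ge0 ?sqr_ge0 ?(ltW x0) //.
    rewrite ler_pdivlMr // mulrAC -expr2 ler_pdivrMr ?mul1r ?lerDl ?sqr_ge0 //.
    by rewrite ltr_wpDl ?sqr_ge0 // exprn_gt0.
  apply: (@cvg_comp _ _ _ (fun x => x * c^-1) (@atan R) _ +oo); last exact: cvgy_atan.
  by apply: gt0_cvgMly; rewrite ?invr_gt0.
Qed.

(** With s = sqrt(x^2 + e^2), the derivative of x/s is (s^2 - x^2)/s^3 = e^2/s^3, and 1 - x/s =
    e^2/(s (s + x)) shows that x/s tends to 1. *)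
Lemma integral_cauchy32 (e c : R) : 0 < e ->
  (\int[leb]_x (e ^+ 2 / Num.sqrt ((x - c) ^+ 2 + e ^+ 2) ^+ 3)%:E = 2%:E)%E.
Proof.
move=> e0; pose s x := Num.sqrt (x ^+ 2 + e ^+ 2).
have n0 x : 0 < x ^+ 2 + e ^+ 2 by rewrite ltr_wpDl ?sqr_ge0 // exprn_gt0.
have s0 x : 0 < s x by rewrite sqrtr_gt0.
have sn x : s x != 0 by rewrite gt_eqF.
have ss x : s x ^+ 2 = x ^+ 2 + e ^+ 2 by rewrite sqr_sqrtr // ltW.
have ds x : is_derive x 1 s (x / s x).
  have hx : is_derive x 1 (fun y : R => y ^+ 2 + e ^+ 2) (2 * x).
    by apply: is_derive_eq; rewrite /GRing.scale /=; ring.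
  have h := is_derive_chain hx (is_derive1_sqrt (n0 x)).
  by apply: is_derive_eq; rewrite -/(s x); field; rewrite sn.
pose F x := x * (s x)^-1; pose f x := e ^+ 2 / s x ^+ 3.
have dF x : is_derive x 1 F (f x).
  have h := @is_derive_inv _ _ s x 1 _ (sn x) (ds x).
  apply: is_derive_eq; rewrite /f /GRing.scale /=.
  have -> : e ^+ 2 = s x ^+ 2 - x ^+ 2 by rewrite ss addrC addKr.
  by field; rewrite sn.
have cs : continuous s.
  move=> x; apply: differentiable_continuous; apply/derivable1_diffP.
  by have h := ds x; apply: ex_derive.
rewrite -[in RHS](mulr1 2) -(@integral_line_odd f F 1 c) //.
- by move=> x; rewrite divr_ge0 ?sqr_ge0 // exprn_ge0 // ltW.
- move=> x; apply: cvgM; first exact: cvg_cst.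
  apply: cvgV; first by rewrite expf_neq0.
  by rewrite /=; under eq_fun do rewrite !exprS expr0 mulr1; rewrite !exprS expr0 mulr1;
    apply: cvgM; [|apply: cvgM]; exact: cs.
- by move=> x; rewrite /F /s sqrrN mulNr.
- apply: (@cvg_pinfty_rate _ _ (e ^+ 2)) => x x1; have x0 : 0 < x by rewrite (lt_trans ltr01).
  have xs : x <= s x.
    by rewrite /s (le_trans (ler_norm x)) // -sqrtr_sqr ler_wsqrtr // lerDl sqr_ge0.
  have F1 : F x <= 1 by rewrite ler_pdivrMr // mul1r.
  rewrite ger0_norm ?subr_ge0 //.
  rewrite ler_pdivlMr // /F.
  have -> : 1 - x * (s x)^-1 = (s x - x) / s x by field.
  rewrite mulrAC ler_pdivrMr //.
  have -> : e ^+ 2 = (s x - x) * (s x + x) by rewrite -subr_sqr ss addrC addKr.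
  rewrite -mulrA ler_wpM2l ?subr_ge0 // (@le_trans _ _ (s x)) //.
  rewrite ler_peMl ?(ltW (s0 x)) // (le_trans (ltW x1)) // lerDr ltW //.
Qed.

End LineIntegrals.

(** * The approximate identity and complex integrals over the plane *)

Section PlaneIntegrals.
Context {R : realType}.
Local Notation plane := (measurableTypeR R * measurableTypeR R)%type.
Local Notation mu := (@plane_measure R).
Implicit Types (p : R * R) (x e : R).

Definition quad e x p : R := (p.1 - x) ^+ 2 + p.2 ^+ 2 + e ^+ 2.

(** Mass [pi] for every positive [e], concentrating at [x] as [e] tends to 0. It is left
    unnormalized because it is exactly d/d(zbar) of the regularized kernel. *)
Definition rho e x p : R := e ^+ 2 / quad e x p ^+ 2.

Lemma quad_gt0 e x p : 0 < e -> 0 < quad e x p.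
Proof. by move=> e0; rewrite ltr_wpDl ?addr_ge0 ?sqr_ge0 // exprn_gt0. Qed.

Lemma smooth_fun_quad e x : smooth_fun (quad e x).
Proof.
have h : smooth_fun (fun p : R * R => p.1 + (- x)).
  by apply: smooth_funD; [exact: smooth_fun_fst | exact: smooth_fun_cst].
apply: smooth_funD; last exact: smooth_fun_cst.
apply: smooth_funD; first exact: (smooth_funM h h).
exact: (smooth_funM (@smooth_fun_snd R) (@smooth_fun_snd R)).
Qed.

Lemma smooth_fun_rho e x : 0 < e -> smooth_fun (rho e x).
Proof.
move=> e0; apply: smooth_funM; first exact: smooth_fun_cst.
apply: smooth_funV; first by move=> p; rewrite expf_neq0 // gt_eqF // quad_gt0.
exact: (smooth_funM (smooth_fun_quad e x) (smooth_fun_quad e x)).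
Qed.

Lemma rho_ge0 e x p : 0 <= rho e x p.
Proof. by rewrite divr_ge0 ?sqr_ge0. Qed.

Lemma measurable_rho e x : 0 < e -> measurable_fun setT (rho e x : plane -> R).
Proof.
move=> e0; apply: continuous_plane_measurable; apply: smooth_fun_continuous.
exact: smooth_fun_rho.
Qed.

(** By Tonelli: with s = sqrt((t - x)^2 + e^2), the integral over the second coordinate is (pi/2)
    e^2/s^3, and the remaining integral of e^2/s^3 is 2. *)
Lemma integral_rho e x : 0 < e -> (\int[mu]_p (rho e x p)%:E = pi%:E)%E.
Proof.
move=> e0.
rewrite (@fubini_tonelli1 _ _ _ _ _ lebesgue_measure lebesgue_measure
  (fun p => (rho e x p)%:E)); last 2 first.
- by apply/measurable_EFinP; exact: measurable_rho.
- by move=> p; rewrite lee_fin rho_ge0.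
rewrite /fubini_F /=.
have c0 t : 0 < Num.sqrt ((t - x) ^+ 2 + e ^+ 2).
  by rewrite sqrtr_gt0 ltr_wpDl ?sqr_ge0 // exprn_gt0.
have H t : (\int[lebesgue_measure]_y (rho e x (t, y))%:E =
    (pi / 2)%:E * (e ^+ 2 / Num.sqrt ((t - x) ^+ 2 + e ^+ 2) ^+ 3)%:E)%E.
  under eq_integral => y _.
    rewrite /rho /quad /=.
    rewrite (_ : _ / _ =
      e ^+ 2 * (y ^+ 2 + Num.sqrt ((t - x) ^+ 2 + e ^+ 2) ^+ 2) ^- 2); last first.
      by rewrite sqr_sqrtr ?addr_ge0 ?sqr_ge0 // addrA [y ^+ 2 + _]addrC.
    rewrite EFinM.
    over.
  rewrite ge0_integralZl_EFin ?sqr_ge0 //; last 2 first.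
  - by move=> y _; rewrite lee_fin invr_ge0 sqr_ge0.
  - apply/measurable_EFinP; apply: (measurableT_comp (@measurable_invr R)).
    by do ?[apply: measurable_funX | apply: measurable_funD] => //.
  rewrite (integral_cauchy2 (c0 t)) -!EFinM; congr (_%:E).
  by have := c0 t; set s := Num.sqrt _ => s0; field; rewrite gt_eqF.
under eq_integral do rewrite H.
rewrite ge0_integralZl_EFin ?divr_ge0 ?pi_ge0 //; last 2 first.
- by move=> t _; rewrite lee_fin divr_ge0 ?sqr_ge0 // exprn_ge0 // sqrtr_ge0.
- pose s t := Num.sqrt ((t - x) ^+ 2 + e ^+ 2).
  have cs : continuous s.
    move=> t; apply: (@continuous_comp _ _ _ (fun t => (t - x) ^+ 2 + e ^+ 2));
      last exact: sqrt_continuous.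
    apply: cvgD; last exact: cvg_cst.
    rewrite /=; under eq_fun do rewrite expr2; rewrite expr2.
    by apply: cvgM; (apply: cvgB; [exact: cvg_id | exact: cvg_cst]).
  apply/measurable_EFinP; apply: (@continuous_measurable_fun _ (fun t => e ^+ 2 / s t ^+ 3)) => t.
  apply: cvgM; first exact: cvg_cst.
  apply: cvgV; first by rewrite expf_neq0 // gt_eqF // c0.
  rewrite /=; under eq_fun do rewrite !exprS expr0 mulr1; rewrite !exprS expr0 mulr1.
  by apply: cvgM; [|apply: cvgM]; exact: cs.
by rewrite (integral_cauchy32 x e0) -EFinM; congr (_%:E); field.
Qed.

(** The majorant of all later estimates is thus an instance of [rho], hence integrable with mass
    [pi]. *)
Lemma weight_rho p : weight (toC p) = rho 1 0 p.
Proof.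
by rewrite /weight /rho /quad /br2 /toC /= subr0 expr1n mul1r [1 + _]addrC.
Qed.

Lemma integrable_rho e x : 0 < e -> mu.-integrable setT (EFin \o rho e x).
Proof.
move=> e0; apply/integrableP; split.
  by apply/measurable_EFinP; exact: measurable_rho.
under eq_integral => p _ do rewrite /= ger0_norm ?rho_ge0 //.
by rewrite integral_rho // ltry.
Qed.

Lemma Rintegral_rho e x : 0 < e -> \int[mu]_p rho e x p = pi.
Proof. by move=> e0; rewrite /Rintegral integral_rho. Qed.

Definition cmeas (f : R * R -> R[i]) :=
  measurable_fun setT ((fun p => complex.Re (f p)) : plane -> R) /\
  measurable_fun setT ((fun p => complex.Im (f p)) : plane -> R).

Definition cint (f : R * R -> R[i]) :=
  mu.-integrable setT (EFin \o (fun p => complex.Re (f p))) /\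
  mu.-integrable setT (EFin \o (fun p => complex.Im (f p))).

Implicit Types (f g : R * R -> R[i]).

Lemma cmeas_cst c : cmeas (fun=> c).
Proof. by split; exact: measurable_cst. Qed.

Lemma cmeasD f g : cmeas f -> cmeas g -> cmeas (fun p => f p + g p).
Proof.
move=> [f1 f2] [g1 g2]; split.
  by under eq_fun do rewrite ReD; exact: measurable_funD.
by under eq_fun do rewrite ImD; exact: measurable_funD.
Qed.

Lemma cmeasM f g : cmeas f -> cmeas g -> cmeas (fun p => f p * g p).
Proof.
move=> [f1 f2] [g1 g2]; split.
  by under eq_fun do rewrite ReM; apply: measurable_funB; exact: measurable_funM.
by under eq_fun do rewrite ImM; apply: measurable_funD; exact: measurable_funM.
Qed.

Lemma cmeasX f n : cmeas f -> cmeas (fun p => f p ^+ n).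
Proof.
move=> mf; elim: n => [|n ih].
  by under [fun p => _]eq_fun do rewrite expr0; exact: cmeas_cst.
by under [fun p => _]eq_fun do rewrite exprS; exact: cmeasM.
Qed.

Lemma cmeasV f : cmeas f -> cmeas (fun p => (f p)^-1).
Proof.
move=> [f1 f2].
have q : measurable_fun setT
    ((fun p => (complex.Re (f p) ^+ 2 + complex.Im (f p) ^+ 2)^-1) : plane -> R).
  apply: (measurableT_comp (@measurable_invr R)).
  by apply: measurable_funD; exact: measurable_funX.
split.
  by under eq_fun do rewrite ReV; exact: measurable_funM.
under eq_fun do rewrite ImV; apply: measurable_funM => //.
exact: measurableT_comp.
Qed.

Lemma cmeas_toC : cmeas (@toC R).
Proof. by split; [exact: measurable_fst | exact: measurable_snd]. Qed.

Lemma cmeas_continuous f : continuous (fun p => complex.Re (f p)) ->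
  continuous (fun p => complex.Im (f p)) -> cmeas f.
Proof. by move=> h1 h2; split; exact: continuous_plane_measurable. Qed.

Lemma cint_le f (G : plane -> R) : cmeas f -> mu.-integrable setT (EFin \o G) ->
  (forall p, cmod (f p) <= G p) -> cint f.
Proof.
move=> [m1 m2] iG fG; split.
  apply: (le_integrable _ _ _ iG) => //; first exact/measurable_EFinP.
  by move=> p _ /=; rewrite lee_fin (le_trans (Re_cmod _)) // (le_trans (fG p)) // ler_norm.
apply: (le_integrable _ _ _ iG) => //; first exact/measurable_EFinP.
by move=> p _ /=; rewrite lee_fin (le_trans (Im_cmod _)) // (le_trans (fG p)) // ler_norm.
Qed.

(** The factor 2 comes from estimating real and imaginary parts separately; it is harmless, since
    only rates of convergence matter. *)
Lemma plane_integral_le f (G : plane -> R) : cmeas f -> mu.-integrable setT (EFin \o G) ->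
  (forall p, cmod (f p) <= G p) -> cmod (plane_integral f) <= 2 * \int[mu]_p G p.
Proof.
move=> mf iG fG; have [i1 i2] := cint_le mf iG fG.
rewrite (le_trans (cmod_ReIm _)) //= mulr_natl mulr2n lerD //.
  rewrite (le_trans (le_normr_Rintegral _ i1)) // le_Rintegral //.
    exact: integrable_norm.
  by move=> p _; rewrite (le_trans (Re_cmod _)).
rewrite (le_trans (le_normr_Rintegral _ i2)) // le_Rintegral //.
  exact: integrable_norm.
by move=> p _; rewrite (le_trans (Im_cmod _)).
Qed.

Lemma integrable_scale (h : plane -> R) (a : R) : mu.-integrable setT (EFin \o h) ->
  mu.-integrable setT (EFin \o (fun p => a * h p)).
Proof.
move=> i; rewrite (_ : _ \o _ = (fun p => a%:E * (EFin \o h) p)%E).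
  exact: integrableZl.
by apply/funext => p; rewrite /= EFinM.
Qed.

Lemma integrable_add (h k : plane -> R) : mu.-integrable setT (EFin \o h) ->
  mu.-integrable setT (EFin \o k) ->
  mu.-integrable setT (EFin \o (fun p => h p + k p)).
Proof.
move=> i j; rewrite (_ : _ \o _ = (EFin \o h) \+ (EFin \o k))%E.
  exact: integrableD.
by apply/funext => p; rewrite /= EFinD.
Qed.

Lemma plane_integralD f g : cint f -> cint g ->
  plane_integral (fun p => f p + g p) = plane_integral f + plane_integral g.
Proof.
move=> [f1 f2] [g1 g2]; apply: complex_ext; rewrite ?ReD ?ImD /=.
  by under eq_Rintegral do rewrite ReD; rewrite RintegralD.
by under eq_Rintegral do rewrite ImD; rewrite RintegralD.
Qed.

Lemma plane_integralZ c f : cint f ->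
  plane_integral (fun p => c * f p) = c * plane_integral f.
Proof.
move=> [f1 f2].
have i1 (a : R) : mu.-integrable setT (EFin \o (fun p => a * complex.Re (f p))).
  exact: integrable_scale.
have i2 (a : R) : mu.-integrable setT (EFin \o (fun p => a * complex.Im (f p))).
  exact: integrable_scale.
apply: complex_ext; rewrite ?ReM ?ImM /=.
  by under eq_Rintegral do rewrite ReM; rewrite RintegralB // !RintegralZl.
by under eq_Rintegral do rewrite ImM; rewrite RintegralD // !RintegralZl.
Qed.

Lemma cintD f g : cint f -> cint g -> cint (fun p => f p + g p).
Proof.
move=> [f1 f2] [g1 g2]; split.
  by under eq_fun do rewrite ReD; exact: integrable_add.
by under eq_fun do rewrite ImD; exact: integrable_add.
Qed.

Lemma cintZ c f : cint f -> cint (fun p => c * f p).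
Proof.
move=> [f1 f2].
have i1 (a : R) : mu.-integrable setT (EFin \o (fun p => a * complex.Re (f p))).
  exact: integrable_scale.
have i2 (a : R) : mu.-integrable setT (EFin \o (fun p => a * complex.Im (f p))).
  exact: integrable_scale.
split.
  under eq_fun do rewrite ReM -mulNr; exact: integrable_add.
by under eq_fun do rewrite ImM; exact: integrable_add.
Qed.

Lemma plane_integralB f g : cint f -> cint g ->
  plane_integral (fun p => f p - g p) = plane_integral f - plane_integral g.
Proof.
move=> cf cg; under [fun p => _ - _]eq_fun do rewrite -mulN1r.
by rewrite plane_integralD ?plane_integralZ ?mulN1r //; exact: cintZ.
Qed.

Lemma cint_rho f (C e x : R) : 0 < e -> cmeas f ->
  (forall p, cmod (f p) <= C * rho e x p) ->
  cint f /\ cmod (plane_integral f) <= 2 * (C * pi).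
Proof.
move=> e0 mf fC.
have i : mu.-integrable setT (EFin \o (fun p : plane => C * rho e x p)).
  exact: integrable_scale (integrable_rho x e0).
split; first exact: cint_le i fC.
rewrite (le_trans (plane_integral_le mf i fC)) //.
by rewrite RintegralZl ?Rintegral_rho //; exact: integrable_rho.
Qed.

Lemma cint_weight f (C : R) : cmeas f ->
  (forall p, cmod (f p) <= C * weight (toC p)) ->
  cint f /\ cmod (plane_integral f) <= 2 * (C * pi).
Proof.
move=> mf fC; apply: (@cint_rho f C 1 0) => // p.
by rewrite -weight_rho.
Qed.

Lemma plane_measureX (A B : set R) : measurable A -> measurable B ->
  mu (A `*` B) = (lebesgue_measure A * lebesgue_measure B)%E.
Proof. by move=> mA mB; exact: (product_measure1E lebesgue_measure lebesgue_measure mA mB). Qed.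

Lemma plane_measure_axis : mu [set p | p.2 = 0] = 0%E.
Proof.
have -> : [set p : plane | p.2 = 0] = setT `*` [set 0 : R].
  by apply/seteqP; split => -[a b] //= [].
rewrite plane_measureX //.
by rewrite lebesgue_measure_set1 mule0.
Qed.

Lemma plane_measure_square (A : R) : 0 <= A ->
  mu (`[- A, A]%classic `*` `[- A, A]%classic) = ((2 * A) * (2 * A))%:E.
Proof.
move=> A0; rewrite plane_measureX // lebesgue_measure_itv /= lte_fin.
case: ltP => h; first by rewrite -EFinB -EFinM; congr (_%:E); ring.
have -> : A = 0 by apply/eqP; rewrite eq_le A0 andbT; lra.
by rewrite mulr0 mul0r mule0.
Qed.

End PlaneIntegrals.

(** * The Cauchy-Pompeiu formula *)

Section Cutoff.
Context {R : realType}.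
Implicit Types (x y : R).

(** Equal to 1 for |x| at most 1 and to 0 for |x| at least 2. Using [x * x] instead of |x| keeps it
    in the class [smooth_fun]; the denominator is positive because 4 - x^2 and x^2 - 1 are never
    both nonpositive. *)
Definition cutoff x : R := flat 1 (4 - x * x) / (flat 1 (4 - x * x) + flat 1 (x * x - 1)).

Lemma cutoff_den_gt0 x : 0 < flat 1 (4 - x * x) + flat 1 (x * x - 1).
Proof.
have [h|h] := ltP (x * x) 4.
  by rewrite ltr_pwDl ?flat_ge0 // flat_gt0 // subr_gt0.
by rewrite ltr_wpDl ?flat_ge0 // flat_gt0 // subr_gt0 (lt_le_trans _ h) // ltr1n.
Qed.

Lemma smooth_fun_cutoff : smooth_fun cutoff.
Proof.
have sq : smooth_fun (fun x : R => x * x).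
  by apply: smooth_funM; exact: smooth_fun_id.
have s1 : smooth_fun (fun x : R => flat 1 (4 - x * x)).
  apply: (@smooth_fun_flat _ _ 1 (fun x : R => 4 - x * x)).
  have := smooth_funD (smooth_fun_cst _ 4) (smooth_funM (smooth_fun_cst _ (-1)) sq).
  by congr smooth_fun; apply/funext => x; rewrite mulN1r.
have s2 : smooth_fun (fun x : R => flat 1 (x * x - 1)).
  apply: (@smooth_fun_flat _ _ 1 (fun x : R => x * x - 1)).
  exact: (smooth_funD sq (smooth_fun_cst _ (-1))).
apply: smooth_funM => //; apply: smooth_funV; last exact: smooth_funD.
by move=> x; rewrite gt_eqF // cutoff_den_gt0.
Qed.

Lemma cutoff_ge0 x : 0 <= cutoff x.
Proof. by rewrite divr_ge0 ?flat_ge0 // ltW // cutoff_den_gt0. Qed.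

Lemma cutoff_le1 x : cutoff x <= 1.
Proof. by rewrite ler_pdivrMr ?cutoff_den_gt0 // mul1r lerDl flat_ge0. Qed.

Lemma cutoff_in x : `|x| <= 1 -> cutoff x = 1.
Proof.
move=> x1; have xx : x * x <= 1 by rewrite -expr2 -real_normK ?num_real // expr_le1.
rewrite /cutoff (flat_le0 _ (_ : x * x - 1 <= 0)) ?subr_le0 // addr0 divff //.
by rewrite gt_eqF // flat_gt0 // subr_gt0 (le_lt_trans xx) // ltr1n.
Qed.

Lemma cutoff_out x : 2 <= `|x| -> cutoff x = 0.
Proof.
move=> x2; have xx : 4 <= x * x.
  rewrite -expr2 -real_normK ?num_real // (_ : 4 = 2 ^+ 2).
    by rewrite lerXn2r // nnegrE.
  by rewrite -natrX.
by rewrite /cutoff flat_le0 ?mul0r // subr_le0.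
Qed.

(** The derivative vanishes where [cutoff] is locally constant and is bounded by continuity on the
    compact remainder. Its smoothness is recorded for the measurability of [plateau_dbar]. *)
Lemma cutoff_derivative : exists (d : R -> R) (L : R), 0 <= L /\
  (forall x, [/\ is_derive x 1 cutoff (d x), `|d x| <= L,
     `|x| < 1 -> d x = 0 & 2 < `|x| -> d x = 0]) /\ smooth_fun d.
Proof.
have [d [sd hd]] := smooth_fun_derive (1 : R) smooth_fun_cutoff.
have [M hM] := continuous_bounded 2 (smooth_fun_continuous sd).
have d_locally_cst x (c : R) : (\forall y \near x, cutoff y = c) -> d x = 0.
  move=> h; have := near_eq_is_derive (g := fun=> c) h (hd x).
  by move=> [_ <-]; rewrite derive_cst.
have d1 x : `|x| < 1 -> d x = 0.
  move=> x1; apply: (@d_locally_cst x 1).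
  have o : open [set y : R | `|y| < 1].
    rewrite (_ : [set _ | _] = ball (0 : R) 1); first exact: ball_open.
    by apply/seteqP; split => y; rewrite /ball /= sub0r normrN.
  have := o x x1; apply: filterS => y /ltW; exact: cutoff_in.
have d2 x : 2 < `|x| -> d x = 0.
  move=> x2; apply: (@d_locally_cst x 0).
  have o : open [set y : R | 2 < `|y|].
    rewrite (_ : [set _ | _] = (fun x : R => `|x|) @^-1` `]2, +oo[).
      by apply: open_comp => [y _|]; [exact: norm_continuous | exact: interval_open].
    by apply/seteqP; split => y /=; rewrite in_itv /= andbT.
  have := o x x2; apply: filterS => y /ltW; exact: cutoff_out.
exists d, `|M|; split => //; split=> // x; split => //; [|exact: d1|exact: d2].
have [x2|x2] := leP `|x| 2; last by rewrite d2 // normr0.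
by rewrite (le_trans (hM x x2)) // ler_norm.
Qed.

End Cutoff.

(** * The regularized Cauchy kernel *)

Section RegularizedKernel.
Context {R : realType}.
Local Notation plane := (measurableTypeR R * measurableTypeR R)%type.
Implicit Types (p : R * R) (x y e : R).

(* conj(z-x)/(|z-x|^2+e^2), a smooth approximation of 1/(z-x) whose
   d/d(zbar) is the approximate identity [rho]. *)
Definition kreg e x p : R[i] := ((p.1 - x) / quad e x p) +i* (- p.2 / quad e x p).

Lemma kregE e x p : 0 < e ->
  kreg e x p = (toC p - x%:C)^* / (quad e x p)%:C.
Proof.
move=> e0; have q0 := quad_gt0 x p e0.
apply: complex_ext; rewrite ?ReM ?ImM ReV ImV /= expr0n /= addr0;
  by field; rewrite gt_eqF.
Qed.

Lemma smooth_fun_kreg_Re e x : 0 < e -> smooth_fun (fun p => complex.Re (kreg e x p)).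
Proof.
move=> e0; apply: smooth_funM.
  exact: (smooth_funD (@smooth_fun_fst R) (smooth_fun_cst _ (- x))).
apply: smooth_funV; last exact: smooth_fun_quad.
by move=> p; rewrite gt_eqF // quad_gt0.
Qed.

Lemma smooth_fun_kreg_Im e x : 0 < e -> smooth_fun (fun p => complex.Im (kreg e x p)).
Proof.
move=> e0; apply: smooth_funM.
  have := smooth_funM (smooth_fun_cst _ (-1)) (@smooth_fun_snd R).
  by congr smooth_fun; apply/funext => p; rewrite mulN1r.
apply: smooth_funV; last exact: smooth_fun_quad.
by move=> p; rewrite gt_eqF // quad_gt0.
Qed.

Lemma is_derive_quad e x p (v : R * R) :
  is_derive p v (quad e x) (2 * ((p.1 - x) * v.1 + p.2 * v.2)).
Proof.
have h1 := is_derive_fst p v; have h2 := is_derive_snd p v.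
apply: is_derive_eq; rewrite /GRing.scale /=; ring.
Qed.

Definition kreg_d e x (v : R * R) p : R[i] :=
  let d := 2 * ((p.1 - x) * v.1 + p.2 * v.2) in
  ((v.1 * quad e x p - (p.1 - x) * d) / quad e x p ^+ 2) +i*
  ((- v.2 * quad e x p + p.2 * d) / quad e x p ^+ 2).

Lemma is_cderive_kreg e x p (v : R * R) : 0 < e ->
  is_cderive p v (kreg e x) (kreg_d e x v p).
Proof.
move=> e0; have q0 : quad e x p != 0 by rewrite gt_eqF // quad_gt0.
have h1 := is_derive_fst p v; have h2 := is_derive_snd p v.
have hq := is_derive_inv q0 (is_derive_quad e x p v).
by split => /=; apply: is_derive_eq; rewrite /GRing.scale /=; field.
Qed.

(** With u = z - x and q = |u|^2 + e^2, d/d(zbar) of q is u, so that of conj u / q is 1/q -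
    |u|^2/q^2 = e^2/q^2. *)
Lemma dbar_kreg e x p : 0 < e ->
  2^-1 * (kreg_d e x (axis false) p + (0 +i* 1) * kreg_d e x (axis true) p)
  = (rho e x p)%:C.
Proof.
move=> e0; have q0 : quad e x p != 0 by rewrite gt_eqF // quad_gt0.
have half : 2^-1 = (2^-1 : R)%:C :> R[i] by rewrite fmorphV rmorph_nat.
rewrite half; apply: complex_ext; rewrite ?ReM ?ImM ?ReD ?ImD ?ReM ?ImM /=;
  last by field.
rewrite /rho; have -> : e ^+ 2 = quad e x p - (p.1 - x) ^+ 2 - p.2 ^+ 2.
  by rewrite /quad; ring.
by field.
Qed.

Lemma cmod_kreg e x p : 0 < e -> p.2 != 0 -> cmod (kreg e x p) <= `|p.2|^-1.
Proof.
move=> e0 p0; have q0 := quad_gt0 x p e0.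
have n0 : 0 < `|p.2| by rewrite normr_gt0.
rewrite kregE // cmodM cmodV cmodR gtr0_norm // ler_pdivrMr // mulrC ler_pdivlMr //.
set u := toC p - x%:C.
have up : `|p.2| <= cmod u.
  by rewrite (le_trans _ (Im_cmod _)) // /u ImD ImN /= subr0.
have -> : cmod u^* = cmod u by rewrite !cmodE; case: (u) => a b /=; rewrite sqrrN.
have qE : quad e x p = cmod u ^+ 2 + e ^+ 2.
  by rewrite cmod_sqr /u ReD ImD ReN ImN /= subr0.
rewrite qE (@le_trans _ _ (cmod u * cmod u)) ?ler_wpM2l ?cmod_ge0 //.
by rewrite -expr2 lerDl sqr_ge0.
Qed.

(** The difference equals -e^2/(u q) with u = z - x, and |u| q is at least |u|^3, hence at least |Im
    z|^3. *)
Lemma kreg_omega e x p : 0 < e -> p.2 != 0 ->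
  cmod (kreg e x p - omega (toC p) x) <= e ^+ 2 * `|p.2|^-1 ^+ 3.
Proof.
move=> e0 p0; have q0 := quad_gt0 x p e0.
have n0 : 0 < `|p.2| by rewrite normr_gt0.
have zx : toC p - x%:C != 0 by exact: nonreal_neq.
rewrite kregE // /omega; set u := toC p - x%:C in zx *.
have up : `|p.2| <= cmod u.
  by rewrite (le_trans _ (Im_cmod _)) // /u ImD ImN /= subr0.
have qE : quad e x p = cmod u ^+ 2 + e ^+ 2.
  by rewrite cmod_sqr /u ReD ImD ReN ImN /= subr0.
have uu : u * u^* = (cmod u ^+ 2)%:C.
  by rewrite -sqr_normc norm_cmod rmorphXn.
have Q0 : (quad e x p)%:C != 0 :> R[i] by rewrite -cmod_eq0 cmodR normr_eq0 gt_eqF.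
have -> : u^* / (quad e x p)%:C - u^-1 = - (e ^+ 2)%:C / (u * (quad e x p)%:C).
  have -> : (e ^+ 2)%:C = (quad e x p)%:C - u * u^* :> R[i].
    by rewrite uu -rmorphB qE addrC addKr.
  by field; rewrite zx Q0.
rewrite cmodM cmodN cmodR cmodV cmodM cmodR (ger0_norm (sqr_ge0 e)) (gtr0_norm q0).
rewrite ler_wpM2l ?sqr_ge0 // exprVn lef_pV2 ?posrE ?exprn_gt0 ?mulr_gt0 ?cmod_gt0 //.
rewrite exprS ler_pM // qE (@le_trans _ _ (cmod u ^+ 2)) ?lerDl ?sqr_ge0 //.
by rewrite lerXn2r ?nnegrE ?cmod_ge0.
Qed.

(** Over the common denominator the numerator is conj u conj w (w - u) + e^2 (conj u - conj w), of
    modulus at most |x - y| (|u| |w| + e^2). By the arithmetic-geometric inequality the bracket is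
    at most half the sum of the two denominators. *)
Lemma kreg_diff e x y p : 0 < e ->
  cmod (kreg e x p - kreg e y p) <=
  `|x - y| * ((quad e x p)^-1 + (quad e y p)^-1) / 2.
Proof.
move=> e0; have q0 := quad_gt0 x p e0; have r0 := quad_gt0 y p e0.
rewrite !kregE //; set u := toC p - x%:C; set w := toC p - y%:C.
have qE : quad e x p = cmod u ^+ 2 + e ^+ 2.
  by rewrite cmod_sqr /u ReD ImD ReN ImN /= subr0.
have rE : quad e y p = cmod w ^+ 2 + e ^+ 2.
  by rewrite cmod_sqr /w ReD ImD ReN ImN /= subr0.
have uu : u * u^* = (cmod u ^+ 2)%:C.
  by rewrite -sqr_normc norm_cmod rmorphXn.
have ww : w * w^* = (cmod w ^+ 2)%:C.
  by rewrite -sqr_normc norm_cmod rmorphXn.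
have Q0 : (quad e x p)%:C != 0 :> R[i] by rewrite -cmod_eq0 cmodR normr_eq0 gt_eqF.
have R0 : (quad e y p)%:C != 0 :> R[i] by rewrite -cmod_eq0 cmodR normr_eq0 gt_eqF.
have cj (z : R[i]) : cmod z^* = cmod z by rewrite !cmodE; case: (z) => a b /=; rewrite sqrrN.
have -> : u^* / (quad e x p)%:C - w^* / (quad e y p)%:C =
  (u^* * w^* * (w - u) + (e ^+ 2)%:C * (u^* - w^*)) / ((quad e x p)%:C * (quad e y p)%:C).
  have -> : u^* * w^* * (w - u) + (e ^+ 2)%:C * (u^* - w^*) =
    u^* * (w * w^* + (e ^+ 2)%:C) - w^* * (u * u^* + (e ^+ 2)%:C) by ring.
  by rewrite uu ww -!rmorphD /= -qE -rE; field; rewrite Q0 R0.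
have wu : w - u = (x - y)%:C by rewrite /w /u rmorphB; ring.
have cuw : u^* - w^* = - (x - y)%:C.
  by apply: complex_ext; rewrite /u /w /=; ring.
rewrite wu cuw mulrN -mulNr -mulrDl !cmodM cmodV cmodM !cmodR.
rewrite (gtr0_norm q0) (gtr0_norm r0) ler_pdivrMr ?mulr_gt0 //.
have -> : `|x - y| * ((quad e x p)^-1 + (quad e y p)^-1) / 2 * (quad e x p * quad e y p)
  = (quad e x p + quad e y p) / 2 * `|x - y|.
  by field; rewrite !gt_eqF.
rewrite ler_wpM2r // (le_trans (cmodB _ _)) // cmodM !cj cmodR (ger0_norm (sqr_ge0 e)).
rewrite qE rE -subr_ge0.
have -> : (cmod u ^+ 2 + e ^+ 2 + (cmod w ^+ 2 + e ^+ 2)) / 2 - (cmod u * cmod w + e ^+ 2)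
  = (cmod u - cmod w) ^+ 2 / 2 by field.
by rewrite divr_ge0 ?sqr_ge0.
Qed.

End RegularizedKernel.

(** * The test functions and their d/d(zbar) *)

Section TestFunction.
Context {R : realType}.
Implicit Types (p : R * R) (x y e r : R).

Definition plateau r p : R := cutoff (p.1 * r^-1) * cutoff (p.2 * r^-1).

Lemma smooth_fun_plateau r : smooth_fun (plateau r).
Proof.
apply: smooth_funM.
  apply: (smooth_fun_comp (@smooth_fun_cutoff R)).
  exact: (smooth_funM (@smooth_fun_fst R) (smooth_fun_cst _ r^-1)).
apply: (smooth_fun_comp (@smooth_fun_cutoff R)).
exact: (smooth_funM (@smooth_fun_snd R) (smooth_fun_cst _ r^-1)).
Qed.

Lemma plateau_ge0 r p : 0 <= plateau r p.
Proof. by rewrite mulr_ge0 ?cutoff_ge0. Qed.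

Lemma plateau_le1 r p : plateau r p <= 1.
Proof. by rewrite mulr_ile1 ?cutoff_ge0 ?cutoff_le1. Qed.

Lemma plateau_in r p : 0 < r -> `|p.1| <= r -> `|p.2| <= r -> plateau r p = 1.
Proof.
move=> r0 h1 h2; rewrite /plateau !cutoff_in ?mulr1 //;
  by rewrite normrM normfV (gtr0_norm r0) ler_pdivrMr // mul1r.
Qed.

Lemma plateau_out r p : 0 < r -> plateau r p != 0 ->
  `|p.1| <= 2 * r /\ `|p.2| <= 2 * r.
Proof.
move=> r0; rewrite mulf_eq0 negb_or => /andP[h1 h2].
split; rewrite leNgt; apply/negP => h.
  by move: h1; rewrite cutoff_out ?eqxx // normrM normfV (gtr0_norm r0) ler_pdivlMr // ltW.
by move: h2; rewrite cutoff_out ?eqxx // normrM normfV (gtr0_norm r0) ler_pdivlMr // ltW.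
Qed.

Definition test_fun r x y p : R[i] :=
  (plateau r p)%:C * (kreg r^-1 x p - kreg r^-1 y p).

Lemma Cc_test_fun r x y : 0 < r -> Cc_infty2 (test_fun r x y).
Proof.
move=> r0; have e0 : 0 < r^-1 by rewrite invr_gt0.
split.
  have diff (F G : R * R -> R) : smooth_fun F -> smooth_fun G ->
      smooth_fun (fun p => plateau r p * (F p - G p)).
    move=> sF sG; apply: smooth_funM; first exact: smooth_fun_plateau.
    have := smooth_funD sF (smooth_funM (smooth_fun_cst _ (-1)) sG).
    by congr smooth_fun; apply/funext => p; rewrite mulN1r.
  have := smooth2_smooth_fun
    (diff _ _ (smooth_fun_kreg_Re x e0) (smooth_fun_kreg_Re y e0))
    (diff _ _ (smooth_fun_kreg_Im x e0) (smooth_fun_kreg_Im y e0)).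
  congr smooth2; apply/funext => p; rewrite /test_fun.
  by apply: complex_ext; rewrite ?ReM ?ImM ?ReD ?ImD ?ReN ?ImN /=; ring.
pose S := `[- (2 * r), 2 * r]%classic `*` `[- (2 * r), 2 * r]%classic : set (R * R).
have cS : compact S by apply: compact_setX; exact: segment_compact.
have clS : closed S.
  by apply: compact_closed => //; exact: norm_hausdorff.
apply: (subclosed_compact _ cS); first exact: closed_closure.
rewrite [X in _ `<=` X](closure_id S).1 //; apply: closure_subset => p /=.
rewrite mulf_eq0 negb_or => /andP[h _].
have : plateau r p != 0 by apply: contra_neq h => ->.
by move=> /(plateau_out r0)[h1 h2]; split; rewrite /= in_itv /= -ler_norml.
Qed.

Definition plateau_dbar (d : R -> R) r p : R[i] :=
  2^-1 * ((d (p.1 * r^-1) * r^-1 * cutoff (p.2 * r^-1))%:C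
   + (0 +i* 1) * (cutoff (p.1 * r^-1) * (d (p.2 * r^-1) * r^-1))%:C).

Lemma dbar_test_fun (d : R -> R) r x y p : (forall x, is_derive x 1 cutoff (d x)) ->
  0 < r -> dbar (test_fun r x y) p =
  plateau_dbar d r p * (kreg r^-1 x p - kreg r^-1 y p)
  + (plateau r p)%:C * ((rho r^-1 x p)%:C - (rho r^-1 y p)%:C).
Proof.
move=> hd r0; have e0 : 0 < r^-1 by rewrite invr_gt0.
have real_is_cderive (h : R * R -> R) v dh : is_derive p v h dh ->
    is_cderive p v (fun q => (h q)%:C) dh%:C.
  by move=> hh; split => //=; exact: is_derive_cst.
have comp_cutoff (l : R * R -> R) v (dl : R) : smooth_fun l -> is_derive p v l dl ->
    is_derive p v (fun q => cutoff (l q * r^-1)) (d (l p * r^-1) * (dl * r^-1)).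
  move=> sl hl; apply: is_derive_comp => //.
    exact: (smooth_fun_differentiable (smooth_funM sl (smooth_fun_cst _ r^-1))).
  by apply: is_derive_eq; rewrite /GRing.scale /= mulrC; ring.
have hP v : is_cderive p v (fun q => (plateau r q)%:C)
    (cutoff (p.1 * r^-1) * (d (p.2 * r^-1) * (v.2 * r^-1)) +
     cutoff (p.2 * r^-1) * (d (p.1 * r^-1) * (v.1 * r^-1)))%:C.
  apply: real_is_cderive; apply: is_deriveM.
    exact: (comp_cutoff _ _ _ (@smooth_fun_fst R) (is_derive_fst p v)).
  exact: (comp_cutoff _ _ _ (@smooth_fun_snd R) (is_derive_snd p v)).
have hK v : is_cderive p v (fun q => kreg r^-1 x q - kreg r^-1 y q)
    (kreg_d r^-1 x v p - kreg_d r^-1 y v p).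
  under [fun q => _]eq_fun do rewrite -mulN1r.
  apply: is_cderive_eq.
    apply: is_cderiveD (is_cderive_kreg x p v e0) _.
    exact: is_cderiveM (is_cderive_cst p v (-1)) (is_cderive_kreg y p v e0).
  by rewrite mul0r addr0 mulN1r.
rewrite /dbar !(is_cderiveE (is_cderiveM (hP _) (hK _))) -!dbar_kreg //.
rewrite /plateau_dbar /axis /= !mul0r !mul1r !mulr0 ?add0r ?addr0.
rewrite [d (p.1 / r) / r * _]mulrC; ring.
Qed.

(** Rescaling costs 1/r per derivative, and the derivative lives on the frame between the squares of
    half-widths r and 2r. *)
Lemma plateau_dbar_bound (d : R -> R) (L r : R) p : 0 < r -> 0 <= L ->
  (forall x, [/\ is_derive x 1 cutoff (d x), `|d x| <= L,
     `|x| < 1 -> d x = 0 & 2 < `|x| -> d x = 0]) ->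
  cmod (plateau_dbar d r p) <= L / r /\
  (plateau_dbar d r p != 0 -> [/\ `|p.1| <= 2 * r, `|p.2| <= 2 * r
    & (r <= `|p.1|) || (r <= `|p.2|)]).
Proof.
move=> r0 L0 hd; have rn t : `|t * r^-1| = `|t| / r by rewrite normrM normfV (gtr0_norm r0).
split.
  rewrite /plateau_dbar cmodM cmodV (cmod_nat 2) mulrC ler_pdivrMr //.
  rewrite (le_trans (cmodD _ _)) // mulr_natr mulr2n lerD //.
    have [_ h _ _] := hd (p.1 * r^-1).
    move: (cutoff _) (cutoff_ge0 (p.2 * r^-1)) (cutoff_le1 (p.2 * r^-1)) => c c0 c1.
    rewrite cmodR !normrM (ger0_norm c0) normfV (gtr0_norm r0).
    rewrite -[leRHS]mulr1 ler_pM ?divr_ge0 ?(ltW r0) //.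
    by rewrite ler_wpM2r ?invr_ge0 ?(ltW r0).
  rewrite cmodM; have -> : cmod (0 +i* 1 : R[i]) = 1 by rewrite cmodE /= expr0n expr1n add0r sqrtr1.
  have [_ h _ _] := hd (p.2 * r^-1).
  move: (cutoff _) (cutoff_ge0 (p.1 * r^-1)) (cutoff_le1 (p.1 * r^-1)) => c c0 c1.
  rewrite mul1r cmodR !normrM (ger0_norm c0) normfV (gtr0_norm r0).
  rewrite -[leRHS]mul1r ler_pM ?divr_ge0 ?(ltW r0) //.
  by rewrite ler_wpM2r ?invr_ge0 ?(ltW r0).
move=> h.
have [_ _ a1 a2] := hd (p.1 * r^-1); have [_ _ b1 b2] := hd (p.2 * r^-1).
have {h} : (d (p.1 * r^-1) != 0) && (cutoff (p.2 * r^-1) != 0) ||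
       (cutoff (p.1 * r^-1) != 0) && (d (p.2 * r^-1) != 0).
  apply: contraNT h; rewrite negb_or !negb_and !negbK /plateau_dbar.
  by move=> /andP[/orP[]/eqP -> /orP[]/eqP ->]; rewrite ?(mul0r,mulr0,addr0).
have le2 t (h : R -> R) : (2 < `|t * r^-1| -> h (t * r^-1) = 0) ->
    h (t * r^-1) != 0 -> `|t| <= 2 * r.
  move=> H; apply: contraNT; rewrite -ltNge => tr; apply/eqP; apply: H.
  by rewrite rn ltr_pdivlMr.
have ge1 t : (`|t * r^-1| < 1 -> d (t * r^-1) = 0) -> d (t * r^-1) != 0 -> r <= `|t|.
  move=> H; apply: contraNT; rewrite -ltNge => tr; apply/eqP; apply: H.
  by rewrite rn ltr_pdivrMr // mul1r.
move=> /orP[/andP[h1 h2]|/andP[h1 h2]]; split.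
- exact: (le2 _ d).
- by apply: (le2 _ (@cutoff R)) => // /ltW; exact: cutoff_out.
- by rewrite ge1.
- by apply: (le2 _ (@cutoff R)) => // /ltW; exact: cutoff_out.
- exact: (le2 _ d).
- by rewrite orbC ge1.
Qed.

End TestFunction.

(** * The limit in the weak derivative identity *)

Section CauchyPompeiu.
Context {R : realType}.
Local Notation plane := (measurableTypeR R * measurableTypeR R)%type.
Local Notation mu := (@plane_measure R).
Implicit Types (p : R * R) (x y e r : R).

Lemma cvgCP (T : Type) (F : set_system T) {FF : Filter F} (h : T -> R[i]) l :
  h @ F --> l -> forall e, 0 < e -> \forall t \near F, cmod (l - h t) < e.
Proof.
move=> /cvgrPdist_lt H e e0.
have e0' : 0 < e%:C :> R[i] by rewrite -[X in X < _](rmorph0 (real_complex R)) ltcR.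
by apply: filterS (H _ e0') => t; rewrite norm_ltC.
Qed.

Lemma continuous_ReIm (T : topologicalType) (h : T -> R[i]) : continuous h ->
  continuous (fun t => complex.Re (h t)) /\ continuous (fun t => complex.Im (h t)).
Proof.
move=> ch; split=> t; apply/cvgrPdist_lt => e e0.
  near=> s; apply: (@le_lt_trans _ _ (cmod (h t - h s))).
    by rewrite -ReN -ReD Re_cmod.
  by near: s; exact: (cvgCP (ch t) e0).
near=> s; apply: (@le_lt_trans _ _ (cmod (h t - h s))).
  by rewrite -ImN -ImD Im_cmod.
by near: s; exact: (cvgCP (ch t) e0).
Unshelve. all: by end_near. Qed.

Lemma continuous_toC : continuous (@toC R).
Proof. by apply: continuous_complex => p; [exact: cvg_fst | exact: cvg_snd]. Qed.

Lemma cmeas_real (h : R * R -> R) : measurable_fun setT (h : plane -> R) ->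
  cmeas (fun p => (h p)%:C).
Proof. by move=> mh; split => //=; exact: measurable_cst. Qed.

Lemma cmeas_smooth (h : R * R -> R) : smooth_fun h -> cmeas (fun p => (h p)%:C).
Proof.
move=> sh; apply: cmeas_real; apply: continuous_plane_measurable.
exact: (smooth_fun_continuous sh).
Qed.

Lemma cmeas_kreg e x : 0 < e -> cmeas (kreg e x).
Proof.
move=> e0; apply: cmeas_continuous.
  exact: (smooth_fun_continuous (smooth_fun_kreg_Re x e0)).
exact: (smooth_fun_continuous (smooth_fun_kreg_Im x e0)).
Qed.

Lemma cmeasB (h k : R * R -> R[i]) : cmeas h -> cmeas k -> cmeas (fun p => h p - k p).
Proof.
move=> mh mk; under eq_fun do rewrite -mulN1r.
by apply: cmeasD => //; apply: cmeasM => //; exact: cmeas_cst.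
Qed.

Lemma cmeas_omega x : cmeas (fun p => omega (toC p) x).
Proof. by apply: cmeasV; apply: cmeasB; [exact: cmeas_toC | exact: cmeas_cst]. Qed.

Lemma integrable_square (A : R) : 0 <= A ->
  mu.-integrable setT (EFin \o (\1_(`[- A, A]%classic `*` `[- A, A]%classic) : plane -> R)).
Proof.
move=> A0; apply/integrableP; split.
  apply/measurable_EFinP; apply: measurable_indic; apply: measurableX; exact: measurable_itv.
under eq_integral => p _ do rewrite /= ger0_norm ?indic_ge0 //.
rewrite integral_indic //; last by apply: measurableX; exact: measurable_itv.
by rewrite setIT plane_measure_square // ltry.
Qed.

Lemma Rintegral_square (A : R) : 0 <= A ->
  \int[mu]_p (\1_(`[- A, A]%classic `*` `[- A, A]%classic) p : R) = (2 * A) * (2 * A).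
Proof.
move=> A0; rewrite /Rintegral integral_indic //; last by apply: measurableX; exact: measurable_itv.
by rewrite setIT plane_measure_square.
Qed.

Lemma plane_integral_square (h : R * R -> R[i]) (A K : R) : 0 <= A -> 0 <= K ->
  cmeas h -> (forall p, cmod (h p) <= K) ->
  (forall p, h p != 0 -> `|p.1| <= A /\ `|p.2| <= A) ->
  cint h /\ cmod (plane_integral h) <= 2 * (K * ((2 * A) * (2 * A))).
Proof.
move=> A0 K0 mh hK hA.
pose S := (`[- A, A]%classic `*` `[- A, A]%classic : set plane).
have iS : mu.-integrable setT (EFin \o (fun p => K * (\1_S p : R))).
  exact: integrable_scale (integrable_square A0).
have hS p : cmod (h p) <= K * \1_S p.
  have [-> |/hA [h1 h2]] := eqVneq (h p) 0; first by rewrite cmod0 mulr_ge0.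
  rewrite indicE mem_set ?mulr1 // /S /=.
  by split; rewrite /= in_itv /= -ler_norml.
split; first exact: cint_le mh iS hS.
rewrite (le_trans (plane_integral_le mh iS hS)) //.
by rewrite RintegralZl ?Rintegral_square //; exact: integrable_square.
Qed.

Variables (f : R -> R[i]) (ft g : R[i] -> R[i]).
Hypothesis ext : extension f ft g.

Let cft : continuous (fun p => ft (toC p)).
Proof.
by move=> p; apply: continuous_comp; [exact: continuous_toC | exact: ext_continuous ext _].
Qed.

Let mft : cmeas (fun p => ft (toC p)).
Proof. by have [h1 h2] := continuous_ReIm cft; exact: cmeas_continuous. Qed.

Lemma cmeas_ext_dbar : cmeas (fun p => g (toC p)).
Proof. by split; [exact: (ext_measurable_Re ext) | exact: (ext_measurable_Im ext)]. Qed.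

Let ft_bound : exists M, 0 <= M /\ forall z, cmod (ft z) <= M.
Proof.
have [M hM] := ext_bounded ext; exists `|M|; split => // z.
by have := hM z; rewrite norm_leC => /le_trans; apply; exact: ler_norm.
Qed.

Lemma quad_far e x r p : 0 <= r -> 2 * `|x| <= r -> (r <= `|p.1|) || (r <= `|p.2|) ->
  r ^+ 2 / 4 <= quad e x p.
Proof.
move=> r0 xr h; rewrite /quad.
have hr : 0 <= r / 2 by rewrite divr_ge0.
have -> : r ^+ 2 / 4 = (r / 2) ^+ 2 by field.
have sq t : r / 2 <= `|t| -> (r / 2) ^+ 2 <= t ^+ 2.
  by move=> ht; rewrite -(real_normK (num_real t)) lerXn2r ?nnegrE.
case/orP: h => h.
  rewrite -addrA (@le_trans _ _ ((p.1 - x) ^+ 2)) ?lerDl ?addr_ge0 ?sqr_ge0 // sq //.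
  have := lerB_normD p.1 (- x); rewrite normrN => hh; apply: le_trans hh; lra.
rewrite (@le_trans _ _ (p.2 ^+ 2)) ?sq //; first lra.
by rewrite addrAC lerDr addr_ge0 ?sqr_ge0.
Qed.

Lemma cmeas_plateau_dbar (d : R -> R) r : smooth_fun d -> cmeas (plateau_dbar d r).
Proof.
move=> sd.
have s1 : smooth_fun (fun p : R * R => p.1 * r^-1).
  exact: (smooth_funM (@smooth_fun_fst R) (smooth_fun_cst _ r^-1)).
have s2 : smooth_fun (fun p : R * R => p.2 * r^-1).
  exact: (smooth_funM (@smooth_fun_snd R) (smooth_fun_cst _ r^-1)).
apply: cmeasM; first exact: cmeas_cst.
apply: cmeasD; last apply: cmeasM; [|exact: cmeas_cst|].
  apply: cmeas_smooth; apply: smooth_funM.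
    exact: (smooth_funM (smooth_fun_comp sd s1) (smooth_fun_cst _ r^-1)).
  exact: (smooth_fun_comp (@smooth_fun_cutoff R) s2).
apply: cmeas_smooth; apply: smooth_funM.
  exact: (smooth_fun_comp (@smooth_fun_cutoff R) s1).
exact: (smooth_funM (smooth_fun_comp sd s2) (smooth_fun_cst _ r^-1)).
Qed.

(** The factors are |ft| at most M, L/r for the plateau, 4 |x - y| / r^2 for the two kernels on the
    frame, and area 16 r^2; with the factor 2 of the complex integral they give 128 M |x - y| L / r.
    The threshold [r0] puts [x] and [y] well inside the frame. *)
Lemma cutoff_term x y : exists C r0, 0 < r0 /\ forall d L r,
  0 <= L -> (forall x, [/\ is_derive x 1 cutoff (d x), `|d x| <= L,
     `|x| < 1 -> d x = 0 & 2 < `|x| -> d x = 0]) -> smooth_fun d -> r0 <= r ->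
  let h := fun p => ft (toC p) * (plateau_dbar d r p * (kreg r^-1 x p - kreg r^-1 y p)) in
  cint h /\ cmod (plane_integral h) <= C * L / r.
Proof.
have [M [M0 hM]] := ft_bound.
have x0 := normr_ge0 x; have y0 := normr_ge0 y.
exists (128 * M * `|x - y|), (1 + 2 * `|x| + 2 * `|y|); split; first lra.
move=> d L r L0 hd sd rr h.
have r0 : 0 < r by lra.
have xr : 2 * `|x| <= r by lra.
have yr : 2 * `|y| <= r by lra.
have e0 : 0 < r^-1 by rewrite invr_gt0.
pose K := M * (L / r * (`|x - y| * (4 / r ^+ 2))).
have K0 : 0 <= K by rewrite !mulr_ge0 ?invr_ge0 ?exprn_ge0 // ltW.
have r2 : 0 <= 2 * r by rewrite mulr_ge0 // ltW.
have mh : cmeas h.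
  apply: cmeasM => //; apply: cmeasM; first exact: cmeas_plateau_dbar.
  by apply: cmeasB; exact: cmeas_kreg.
have nz p : h p != 0 -> plateau_dbar d r p != 0.
  by apply: contra_neq => e; rewrite /h e mul0r mulr0.
have hK p : cmod (h p) <= K.
  have [-> |/nz hp] := eqVneq (h p) 0; first by rewrite cmod0.
  have [b1 /(_ hp) [_ _ b2]] := plateau_dbar_bound p r0 L0 hd.
  rewrite /h cmodM ler_pM ?cmod_ge0 // cmodM ler_pM ?cmod_ge0 //.
  rewrite (le_trans (kreg_diff x y p e0)) // -mulrA ler_wpM2l //.
  have q1 := quad_far r^-1 (ltW r0) xr b2; have q2 := quad_far r^-1 (ltW r0) yr b2.
  have rr0 : 0 < r ^+ 2 / 4 by rewrite divr_gt0 // exprn_gt0.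
  have i4 : (r ^+ 2 / 4)^-1 = 4 / r ^+ 2 by rewrite invf_div.
  have j1 : (quad r^-1 x p)^-1 <= 4 / r ^+ 2.
    by rewrite -i4 lef_pV2 ?posrE // quad_gt0.
  have j2 : (quad r^-1 y p)^-1 <= 4 / r ^+ 2.
    by rewrite -i4 lef_pV2 ?posrE // quad_gt0.
  by rewrite ler_pdivrMr // mulr_natr mulr2n lerD.
have hS p : h p != 0 -> `|p.1| <= 2 * r /\ `|p.2| <= 2 * r.
  by move=> /nz hp; have [_ /(_ hp) []] := plateau_dbar_bound p r0 L0 hd.
have [ch bh] := plane_integral_square r2 K0 mh hK hS.
split=> //; apply: (le_trans bh).
rewrite le_eqVlt; apply/orP; left; apply/eqP; rewrite /K; field.
by rewrite gt_eqF.
Qed.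

Lemma plane_integral_rho (c : R[i]) e x : 0 < e ->
  cint (fun p => c * (rho e x p)%:C) /\
  plane_integral (fun p => c * (rho e x p)%:C) = c * pi%:C.
Proof.
move=> e0.
have ci : cint (fun p => (rho e x p)%:C).
  split; first exact: integrable_rho.
  by rewrite (_ : _ \o _ = cst 0%E); [exact: integrable0 | apply/funext].
split; first exact: cintZ.
rewrite plane_integralZ //; congr (_ * _); apply: complex_ext => /=.
  by rewrite Rintegral_rho.
by rewrite /Rintegral integral0.
Qed.

(** Away from [x] the term 1 in [quad 1 x] is at most eta^-2 times the squared distance, so the tail
    of the approximate identity is e^2 times a fixed integrable function. *)
Lemma rho_far e x eta p : 0 < e -> 0 < eta ->
  eta ^+ 2 <= (p.1 - x) ^+ 2 + p.2 ^+ 2 ->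
  rho e x p <= e ^+ 2 * (1 + eta ^- 2) ^+ 2 * rho 1 x p.
Proof.
move=> e0 eta0 h; have q0 := quad_gt0 x p e0; have q1 := quad_gt0 x p (@ltr01 R).
have eta2 : 0 < eta ^+ 2 by rewrite exprn_gt0.
have k0 : 0 < 1 + eta ^- 2 by rewrite addr_gt0 // invr_gt0.
have hk : quad 1 x p <= (1 + eta ^- 2) * quad e x p.
  rewrite /quad; set s := _ + p.2 ^+ 2 in h *; rewrite expr1n mulrDl mul1r.
  have s1 : 1 <= eta ^- 2 * s by rewrite mulrC ler_pdivlMr // mul1r.
  have : 0 <= e ^+ 2 by rewrite sqr_ge0.
  have : 0 <= eta ^- 2 * e ^+ 2 by rewrite mulr_ge0 ?sqr_ge0 // invr_ge0 ltW.
  rewrite mulrDr; move: (eta ^- 2 * e ^+ 2) (eta ^- 2 * s) (e ^+ 2) s1 => a b c; lra.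
move: (1 + eta ^- 2) k0 hk => k k0 hk.
rewrite /rho expr1n mul1r -mulrA ler_wpM2l ?sqr_ge0 // -!exprVn -exprMn.
rewrite lerXn2r ?nnegrE ?mulr_ge0 ?invr_ge0 ?(ltW q0) ?(ltW q1) ?(ltW k0) //.
by rewrite ler_pdivlMr // mulrC ler_pdivrMr.
Qed.

(** Near [x], continuity of [ft] makes the error at most [e1 * rho r^-1 x]; away from [x],
    boundedness of [ft] and [rho_far] make it at most [e1 * rho 1 x] for large [r]. *)
Lemma delta_term x eps : 0 < eps -> exists r0, 0 < r0 /\ forall r, r0 <= r ->
  let h := fun p => ft (toC p) * ((plateau r p)%:C * (rho r^-1 x p)%:C) in
  cint h /\ cmod (pi%:C * f x - plane_integral h) <= eps.
Proof.
move=> eps0; have [M [M0 hM]] := ft_bound.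
have pi0 : 0 < pi :> R by exact: pi_gt0.
(* Two majorants of mass [pi], and the factor 2 of [plane_integral_le], account for 4 pi. *)
pose e1 := eps / (4 * pi); have e10 : 0 < e1 by rewrite divr_gt0 // mulr_gt0.
have near_x : nbhs (x, 0 : R) [set q : R * R | cmod (f x - ft (toC q)) < e1].
  have := cvgCP (@cft (x, 0)) e10.
  rewrite (_ : toC (x, 0) = x%:C) // (ext_restriction ext); apply; exact: nbhs_filter.
have /nbhs_ballP[eta /= eta0 heta] := near_x.
pose K := (1 + eta ^- 2) ^+ 2.
have K0 : 0 <= K by rewrite sqr_ge0.
(* The middle summand makes the plateau equal to 1 on the [eta]-neighbourhood of [x]; the last one
   brings 2 M K / r^2 below [e1]. *)
exists (1 + (`|x| + eta) + 2 * M * K / e1).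
have b0 : 0 <= 2 * M * K / e1 by apply: divr_ge0 (ltW e10); apply: mulr_ge0 K0; exact: mulr_ge0.
have x0 := normr_ge0 x.
split; first lra.
move=> r rr; pose h p := ft (toC p) * ((plateau r p)%:C * (rho r^-1 x p)%:C).
suff : cint h /\ cmod (pi%:C * f x - plane_integral h) <= eps by [].
have r0 : 0 < r by lra.
have r1 : 1 <= r by lra.
have ir0 : 0 < r^-1 by rewrite invr_gt0.
have [cr ir] := plane_integral_rho (f x) x ir0.
pose k p := h p - f x * (rho r^-1 x p)%:C.
have mh : cmeas h.
  apply: cmeasM => //; apply: cmeasM; first exact/cmeas_smooth/smooth_fun_plateau.
  exact/cmeas_smooth/smooth_fun_rho.
have mk : cmeas k.
  apply: cmeasB => //; apply: cmeasM; first exact: cmeas_cst.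
  exact/cmeas_smooth/smooth_fun_rho.
pose G p := e1 * rho r^-1 x p + e1 * rho 1 x p.
have i1 := integrable_scale e1 (integrable_rho x ir0).
have i2 := integrable_scale e1 (integrable_rho x (@ltr01 R)).
have iG : mu.-integrable setT (EFin \o (G : plane -> R)) := integrable_add i1 i2.
have IG : \int[mu]_p G p = e1 * pi + e1 * pi.
  rewrite (RintegralD _ i1 i2) // (RintegralZl _ _ (integrable_rho x ir0)) //.
  by rewrite (RintegralZl _ _ (integrable_rho x (@ltr01 R))) // !Rintegral_rho.
have kG p : cmod (k p) <= G p.
  have -> : k p = (ft (toC p) * (plateau r p)%:C - f x) * (rho r^-1 x p)%:C.
    by rewrite /k /h; ring.
  rewrite cmodM cmodR (ger0_norm (rho_ge0 _ _ _)).
  have fM : cmod (f x) <= M by rewrite -(ext_restriction ext).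
  have [px|far] := pselect (`|x - p.1| < eta /\ `|0 - p.2| < eta).
    have [n1 n2] := px; rewrite sub0r normrN in n2.
    have p1 : `|p.1| <= r.
      have := ler_normB x (x - p.1); rewrite opprB addrCA subrr addr0; lra.
    rewrite plateau_in // ?mulr1; last lra.
    rewrite (@le_trans _ _ (e1 * rho r^-1 x p)) //.
      rewrite ler_wpM2r ?rho_ge0 // cmodBC ltW //.
      by have := heta p px.
    by rewrite lerDl mulr_ge0 ?rho_ge0 // ltW.
  have far2 : eta ^+ 2 <= (p.1 - x) ^+ 2 + p.2 ^+ 2.
    have sq t : eta <= `|t| -> eta ^+ 2 <= t ^+ 2.
      move=> ht; rewrite -(real_normK (num_real t)) lerXn2r ?nnegrE //; exact: ltW.
    have [h1|h1] := leP eta `|p.1 - x|.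
      by rewrite (le_trans (sq _ h1)) // lerDl sqr_ge0.
    have [h2|h2] := leP eta `|p.2|.
      by rewrite (le_trans (sq _ h2)) // lerDr sqr_ge0.
    by case: far; rewrite distrC sub0r normrN.
  rewrite (@le_trans _ _ (2 * M * rho r^-1 x p)) //.
    rewrite ler_wpM2r ?rho_ge0 // (le_trans (cmodB _ _)) // mulr_natl mulr2n lerD //.
    rewrite cmodM cmodR (ger0_norm (plateau_ge0 _ _)) -[leRHS]mulr1.
    by rewrite ler_pM ?cmod_ge0 ?plateau_ge0 ?plateau_le1.
  rewrite (@le_trans _ _ (e1 * rho 1 x p)) //; last first.
    by rewrite lerDr mulr_ge0 ?rho_ge0 // ltW.
  rewrite (le_trans (ler_wpM2l _ (rho_far ir0 eta0 far2))) ?mulr_ge0 //.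
  rewrite mulrA ler_wpM2r ?rho_ge0 // -/K.
  have h1 : 2 * M * K / e1 <= r by lra.
  rewrite exprVn (_ : 2 * M * (r ^- 2 * K) = (2 * M * K) / r ^+ 2); last by ring.
  rewrite ler_pdivrMr ?exprn_gt0 // [leRHS]mulrC -ler_pdivrMr // (le_trans h1) //.
  by rewrite expr2 ler_peMl // ltW.
have ck : cint k by exact: cint_le mk iG kG.
have ch : cint h.
  have := cintD ck cr; congr cint; apply/funext => p; rewrite /k; ring.
split => //; rewrite cmodBC -[pi%:C * _]mulrC -ir -plane_integralB //.
apply: (le_trans (plane_integral_le mk iG kG)); rewrite IG /e1.
rewrite le_eqVlt; apply/orP; left; apply/eqP.
by move: pi0; move: (pi : R) => P P0; field; rewrite gt_eqF.
Qed.

Lemma cmod_le_tau p : `|p.1| <= cmod (toC p) /\ `|p.2| <= cmod (toC p).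
Proof. by split; [exact: (Re_cmod (toC p)) | exact: (Im_cmod (toC p))]. Qed.

(** Removing the plateau and the regularization each costs at most tau^3 / r, which three powers of
    decay of [g] absorb. *)
Lemma kernel_term x : cint (fun p => g (toC p) * omega (toC p) x) /\
  exists C, 0 <= C /\ forall r, 1 <= r ->
  let h := fun p => g (toC p) * ((plateau r p)%:C * kreg r^-1 x p) in
  cint h /\
  cmod (plane_integral h - plane_integral (fun p => g (toC p) * omega (toC p) x)) <= C / r.
Proof.
have [C [C0 hC]] := extension_decay 3 ext.
have mg := cmeas_ext_dbar.
have mo : cmeas (fun p => g (toC p) * omega (toC p) x).
  by apply: cmeasM => //; exact: cmeas_omega.
have io : cint (fun p => g (toC p) * omega (toC p) x).
  have [] // := @cint_weight _ _ C mo _ => p.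
  have [p0|p0] := eqVneq (complex.Im (toC p)) 0.
    by rewrite (extension_real ext p0) mul0r cmod0; apply: mulr_ge0 (ltW (weight_gt0 _)).
  rewrite cmodM (le_trans _ (hC _ p0)) // ler_wpM2l ?cmod_ge0 //.
  have t1 := tau_ge1 p0.
  rewrite (le_trans (cmod_omega x p0)) // (le_trans (tau_ge_invIm _)) //.
  by rewrite -[leLHS]expr1 ler_weXn2l.
split=> //; exists (2 * (2 * C * pi)); split.
  by rewrite !mulr_ge0 // pi_ge0.
move=> r r1 h.
have r0 : 0 < r by rewrite (lt_le_trans ltr01).
have ir0 : 0 < r^-1 by rewrite invr_gt0.
have mh : cmeas h.
  apply: cmeasM => //; apply: cmeasM; first exact/cmeas_smooth/smooth_fun_plateau.
  exact: cmeas_kreg.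
have mk := cmeasB mh mo.
have [ck bk] : cint (fun p => h p - g (toC p) * omega (toC p) x) /\
   cmod (plane_integral (fun p => h p - g (toC p) * omega (toC p) x)) <= 2 * (2 * C / r * pi).
  apply: cint_weight mk _ => p.
  have [p0|p0] := eqVneq (complex.Im (toC p)) 0.
    rewrite /h (extension_real ext p0) !mul0r subrr cmod0.
    by apply: mulr_ge0 (ltW (weight_gt0 _)); apply: divr_ge0 (ltW r0); exact: mulr_ge0.
  have t1 := tau_ge1 p0; have t0 := tau_gt0 p0.
  have iT := tau_ge_invIm (toC p); rewrite /= in iT.
  have -> : h p - g (toC p) * omega (toC p) x = g (toC p) *
      (((plateau r p)%:C - 1) * kreg r^-1 x p + (kreg r^-1 x p - omega (toC p) x)).
    by rewrite /h; ring.
  rewrite cmodM.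
  have -> : 2 * C / r * weight (toC p) = (2 / r) * (C * weight (toC p)) by ring.
  apply: (@le_trans _ _ (2 / r * (cmod (g (toC p)) * tau (toC p) ^+ 3))); last first.
    by rewrite ler_wpM2l ?hC // divr_ge0 // ltW.
  rewrite mulrCA ler_wpM2l ?cmod_ge0 // (le_trans (cmodD _ _)) //.
  rewrite (_ : 2 / r * tau (toC p) ^+ 3 = tau (toC p) ^+ 3 / r + tau (toC p) ^+ 3 / r);
    last by ring.
  have kt : cmod (kreg r^-1 x p) <= tau (toC p).
    exact: le_trans (cmod_kreg x ir0 p0) iT.
  rewrite lerD //.
    rewrite cmodM.
    have [h1|h1] := pselect (`|p.1| <= r /\ `|p.2| <= r).
      have [? ?] := h1; rewrite plateau_in // subrr cmod0 mul0r.
      by rewrite divr_ge0 ?exprn_ge0 // ltW.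
    (* Outside the square |z| exceeds r, hence so does tau: one power of tau pays for the factor
       1/r. *)
    have rt : r <= tau (toC p).
      have [c1 c2] := cmod_le_tau p; have c3 := tau_ge_cmod p0.
      rewrite leNgt; apply/negP => h2; apply: h1; split.
        by rewrite (le_trans c1) // (le_trans c3) // ltW.
      by rewrite (le_trans c2) // (le_trans c3) // ltW.
    have b1 : cmod ((plateau r p)%:C - 1) <= 1.
      rewrite -(rmorph1 (real_complex R)) -rmorphB cmodR distrC ger0_norm ?subr_ge0 ?plateau_le1 //.
      by rewrite lerBlDr lerDl plateau_ge0.
    apply: (@le_trans _ _ (1 * tau (toC p))); first by rewrite ler_pM ?cmod_ge0.
    rewrite mul1r.
    rewrite ler_pdivlMr // (@le_trans _ _ (tau (toC p) * tau (toC p))) //.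
      by rewrite ler_wpM2l // ltW.
    by rewrite -expr2 ler_weXn2l.
  rewrite (le_trans (kreg_omega x ir0 p0)) //.
  rewrite mulrC ler_pM ?exprn_ge0 ?invr_ge0 ?(ltW r0) //.
    by rewrite lerXn2r ?nnegrE ?invr_ge0 // ltW.
  by rewrite expr2 ler_piMl ?(ltW ir0) // invf_le1.
have ch : cint h.
  by have := cintD ck io; congr cint; apply/funext => p; rewrite subrK.
split => //; rewrite -plane_integralB //; apply: (le_trans bk).
by rewrite le_eqVlt; apply/orP; left; apply/eqP; ring.
Qed.

Lemma cauchy_pompeiu_diff x y : pi%:C * (f x - f y) =
  - (plane_integral (fun p => g (toC p) * omega (toC p) x)
     - plane_integral (fun p => g (toC p) * omega (toC p) y)).
Proof.
apply/eqP; rewrite -subr_eq0 opprK; set D := _ + _.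
have [d [L [L0 [hd sd]]]] := @cutoff_derivative R.
have [C1 [r1 [r10 H1]]] := cutoff_term x y.
have [ix [Cx [Cx0 Hx]]] := kernel_term x; have [iy [Cy [Cy0 Hy]]] := kernel_term y.
suff small eps : 0 < eps -> cmod D <= eps.
  rewrite -cmod_eq0; apply/eqP/le_anti; rewrite cmod_ge0 andbT.
  by apply/ler_addgt0Pr => e e0; rewrite add0r; apply: small.
move=> eps0; have e4 : 0 < eps / 4 by rewrite divr_gt0.
have [r2 [r20 Hdx]] := delta_term x e4; have [r3 [r30 Hdy]] := delta_term y e4.
pose c1 := `|C1 * L|; have c10 : 0 <= c1 by exact: normr_ge0.
have b0 : 0 <= (c1 + Cx + Cy) / (eps / 4) by rewrite divr_ge0 ?addr_ge0 // ltW.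
have [r [q1 q2 q3 q4 q5]] : exists r, [/\ r1 <= r, r2 <= r, r3 <= r, 1 <= r
    & (c1 + Cx + Cy) / (eps / 4) <= r].
  by exists (1 + r1 + r2 + r3 + (c1 + Cx + Cy) / (eps / 4)); split; lra.
have r0 : 0 < r by exact: lt_le_trans ltr01 q4.
have ir0 : 0 < r^-1 by rewrite invr_gt0.
have [cT bT] := H1 d L r L0 hd sd q1.
have [cdx bdx] := Hdx r q2; have [cdy bdy] := Hdy r q3.
have [cx bx] := Hx r q4; have [cy by_] := Hy r q4.
have := ext_dbar ext (Cc_test_fun x y r0).
have -> : (fun p => ft (toC p) * dbar (test_fun r x y) p) = (fun p =>
   ft (toC p) * (plateau_dbar d r p * (kreg r^-1 x p - kreg r^-1 y p)) +
   (ft (toC p) * ((plateau r p)%:C * (rho r^-1 x p)%:C) -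
    ft (toC p) * ((plateau r p)%:C * (rho r^-1 y p)%:C))).
  have hd' t : is_derive t (1 : R) cutoff (d t) by have [] := hd t.
  by apply/funext => p; rewrite (dbar_test_fun x y p hd' r0); ring.
have -> : (fun p => g (toC p) * test_fun r x y p) = (fun p =>
   g (toC p) * ((plateau r p)%:C * kreg r^-1 x p) -
   g (toC p) * ((plateau r p)%:C * kreg r^-1 y p)).
  by apply/funext => p; rewrite /test_fun; ring.
have cB (h k : R * R -> R[i]) : cint h -> cint k -> cint (fun p => h p - k p).
  move=> ih ik; under eq_fun do rewrite -mulN1r.
  by apply: cintD => //; exact: cintZ.
rewrite plane_integralD //; last exact: cB.
rewrite !plane_integralB //.
move: bT bdx bdy bx by_ => /=; rewrite /D.
set T := plane_integral _; set Dx := plane_integral _; set Dy := plane_integral _.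
set Gx := plane_integral _; set Ox := plane_integral _.
set Gy := plane_integral _; set Oy := plane_integral _.
move=> bT bdx bdy bx by_ E.
(* [E] says that T + (Dx - Dy) + (Gx - Gy) is 0; subtracting it regroups the claim into differences
   that are each known to be small. *)
have -> : pi%:C * (f x - f y) + (Ox - Oy) = (pi%:C * f x - Dx) - (pi%:C * f y - Dy)
   + - T + (- (Gx - Ox) + (Gy - Oy)).
  rewrite (_ : (pi%:C * f x - Dx) - (pi%:C * f y - Dy) + - T + (- (Gx - Ox) + (Gy - Oy)) =
    pi%:C * (f x - f y) + (Ox - Oy) - (T + (Dx - Dy) + (Gx - Gy))); last by ring.
  by rewrite E addNr subr0.
rewrite (le_trans (cmodD _ _)) // (le_trans (lerD (cmodD _ _) (cmodD _ _))) //.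
rewrite (le_trans (lerD (lerD (cmodB _ _) (lexx _)) (lexx _))) //.
rewrite !cmodN.
have E1 : C1 * L / r + Cx / r + Cy / r <= eps / 4.
  rewrite -!mulrDl ler_pdivrMr //; apply: (@le_trans _ _ (c1 + Cx + Cy)).
    by rewrite !lerD // ler_norm.
  by rewrite mulrC -ler_pdivrMr.
apply: (@le_trans _ _ (eps / 4 + eps / 4 + C1 * L / r + (Cx / r + Cy / r))).
  by rewrite !lerD.
rewrite -subr_ge0 (_ : _ - _ = eps / 4 - (C1 * L / r + Cx / r + Cy / r) + eps / 4).
  by rewrite addr_ge0 ?subr_ge0 // ltW.
by field; rewrite gt_eqF.
Qed.

(** In the difference formula both [y]-terms converge at rate 1/y: [f y] to its limit by
    [spaceE_lim], and the plane integral to 0. *)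
Lemma cauchy_pompeiu x : spaceE f ->
  pi%:C * (lim_infty f - f x) = plane_integral (fun p => g (toC p) * omega (toC p) x).
Proof.
move=> Ef; have [a0 [K [-> hK]]] := spaceE_lim Ef.
have [C [C0 hC]] := extension_decay 2 ext.
have [ix _] := kernel_term x.
have pi0 : 0 < pi :> R by exact: pi_gt0.
set O := plane_integral _.
have small y : 1 < y -> cmod (pi%:C * (a0 - f x) - O) <= (pi * cmod K + 2 * (2 * C * pi)) / y.
  move=> y1; have y0 : 0 < y by rewrite (lt_trans ltr01).
  have := cauchy_pompeiu_diff x y; rewrite -/O; set Oy := plane_integral _ => E.
  have -> : pi%:C * (a0 - f x) - O = pi%:C * (a0 - f y) - Oy.
    have -> : pi%:C * (a0 - f x) - O = pi%:C * (a0 - f y) - (pi%:C * (f x - f y)) - O by ring.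
    by rewrite E; ring.
  rewrite (le_trans (cmodB _ _)) // mulrDl lerD //.
    rewrite cmodM cmodR gtr0_norm // -mulrA ler_wpM2l ?(ltW pi0) //.
    by have := hK y; rewrite (gtr0_norm y0) => /(_ y1).
  have [] := @cint_weight _ (fun p => g (toC p) * omega (toC p) y) (2 * C / y).
  - by apply: cmeasM; [exact: cmeas_ext_dbar | exact: cmeas_omega].
  - move=> p; have [p0|p0] := eqVneq (complex.Im (toC p)) 0.
      rewrite (extension_real ext p0) !mul0r cmod0.
      by apply: mulr_ge0 (ltW (weight_gt0 _)); apply: divr_ge0 (ltW y0); exact: mulr_ge0.
    have t1 := tau_ge1 p0; have t0 := tau_gt0 p0.
    have zy := nonreal_neq y p0.
    have -> : 2 * C / y * weight (toC p) = (2 / y) * (C * weight (toC p)) by ring.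
    apply: (@le_trans _ _ (2 / y * (cmod (g (toC p)) * tau (toC p) ^+ 2))); last first.
      by rewrite ler_wpM2l ?hC // divr_ge0 // ltW.
    rewrite cmodM mulrCA ler_wpM2l ?cmod_ge0 //.
    have ot : cmod (omega (toC p) y) <= tau (toC p).
      exact: le_trans (cmod_omega y p0) (tau_ge_invIm _).
    rewrite mulrAC ler_pdivlMr //.
    (* Hence y |omega| is at most 1 + |z| |omega|, so at most 2 tau^2: the factor 1/y costs one
       further power of tau. *)
    have yE : y <= cmod (toC p - y%:C) + cmod (toC p).
      apply: (@le_trans _ _ (cmod y%:C)); first by rewrite cmodR gtr0_norm.
      have -> : cmod y%:C = cmod (toC p - (toC p - y%:C)) by congr cmod; ring.
      by rewrite [leRHS]addrC cmodB.
    rewrite (le_trans (ler_wpM2l (cmod_ge0 _) yE)) // mulrDr -cmodM /omega mulVf // cmod1.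
    rewrite mulr_natl mulr2n lerD //; first by rewrite expr_ge1 // ltW.
    by rewrite expr2 ler_pM ?cmod_ge0 // tau_ge_cmod.
  - move=> _; rewrite -/Oy => /le_trans; apply.
    by rewrite le_eqVlt; apply/orP; left; apply/eqP; ring.
apply/eqP; rewrite -subr_eq0 -cmod_eq0; apply/eqP/le_anti; rewrite cmod_ge0 andbT.
set S := pi * cmod K + 2 * (2 * C * pi) in small.
have S0 : 0 <= S by rewrite addr_ge0 ?mulr_ge0 ?cmod_ge0 // ltW.
apply/ler_addgt0Pr => e e0; rewrite add0r.
have y1 : 1 < 2 + S / e by have := divr_ge0 S0 (ltW e0); lra.
apply: (le_trans (small _ y1)); rewrite ler_pdivrMr ?(lt_trans ltr01 y1) // mulrC -ler_pdivrMr //.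
by rewrite lerDr.
Qed.

End CauchyPompeiu.

(** * Approximation by simple functions *)

Section UnderIntegral.
Context {R : realType}.
Local Notation plane := (measurableTypeR R * measurableTypeR R)%type.
Local Notation mu := (@plane_measure R).
Implicit Types (p : R * R) (x y : R).

Lemma is_derive_Rintegral (h h' : R -> plane -> R) (G : plane -> R) (a : R) :
  (forall x, mu.-integrable setT (EFin \o h x)) ->
  (forall x p, is_derive x 1 (h^~ p) (h' x p)) ->
  (forall x p, `|h' x p| <= G p) -> mu.-integrable setT (EFin \o G) ->
  is_derive a 1 (fun x => \int[mu]_p h x p) (\int[mu]_p h' a p).
Proof.
move=> ih dh hG iG.
have G0 p : 0 <= G p by exact: le_trans (normr_ge0 _) (hG 0 p).
have Ia : `]a - 1, a + 1[%classic a by rewrite /= in_itv /=; apply/andP; split; lra.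
have d x p : derivable (h^~ p) x 1 by have k := dh x p; exact: ex_derive.
have pE x p : partial1of2 h x p = h' x p.
  by rewrite partial1of2E; have k := dh x p; rewrite derive_val.
have ub x p : `|partial1of2 h x p| <= G p by rewrite pE.
apply: DeriveDef.
  exact: (@derivable_under_integral R _ _ mu h setT measurableT a _ _ Ia
    (fun x _ => ih x) (fun x q _ _ => d x q) G G0 iG (fun x q _ _ => ub x q)).
rewrite -derive1E.
rewrite (@differentiation_under_integral R _ _ mu h setT measurableT a _ _ Ia
    (fun x _ => ih x) (fun x q _ _ => d x q) G G0 iG (fun x q _ _ => ub x q)).
by apply: eq_Rintegral => p _; rewrite -pE.
Qed.

(** Differentiation under the integral sign, with [C * weight] dominating every derivative; its mass
    C pi and the factor 2 of the complex integral give the bound. *)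
Lemma Ck_bound_integral (k : nat) (C : R) (D : nat -> R * R -> R -> R[i]) : 0 <= C ->
  (forall j x, (j <= k)%N -> cmeas (fun p => D j p x)) ->
  (forall j p x, (j <= k)%N -> is_cderive x (1 : R) (D j p) (D j.+1 p x)) ->
  (forall j p x, (j <= k.+1)%N -> cmod (D j p x) <= C * weight (toC p)) ->
  Ck_bound k (2 * (C * pi)) (fun x => plane_integral (fun p => D 0%N p x)).
Proof.
move=> C0 mD dD bD.
have iD j x : (j <= k)%N -> cint (fun p => D j p x).
  by move=> jk; have [] := cint_weight (mD j x jk) (fun p => bD j p x (leqW jk)).
have iG : mu.-integrable setT (EFin \o (fun p : plane => C * weight (toC p))).
  have := integrable_scale C (integrable_rho 0 (@ltr01 R)).
  by congr integrable; apply/funext => p; rewrite /= weight_rho.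
exists (fun j x => plane_integral (fun p => D j p x)); split => //.
- move=> j x jk; have jk' := ltnW jk; split.
    apply: (@is_derive_Rintegral (fun x p => complex.Re (D j p x))
      (fun x p => complex.Re (D j.+1 p x)) (fun p => C * weight (toC p))) => //.
    + by move=> t; have [] := iD j t jk'.
    + by move=> t p; have [] := dD j p t jk'.
    + by move=> t p; apply: le_trans (Re_cmod _) (bD j.+1 p t _).
  apply: (@is_derive_Rintegral (fun x p => complex.Im (D j p x))
      (fun x p => complex.Im (D j.+1 p x)) (fun p => C * weight (toC p))) => //.
  + by move=> t; have [] := iD j t jk'.
  + by move=> t p; have [] := dD j p t jk'.
  + by move=> t p; apply: le_trans (Im_cmod _) (bD j.+1 p t _).
- by move=> j x jk; have [] := cint_weight (mD j x jk) (fun p => bD j p x (leqW jk)).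
Qed.

End UnderIntegral.

(** * Finite measurable colourings with small oscillation *)

Section Quantization.
Context d {T : measurableType d} {R : realType}.
Implicit Types (phi : T -> R).

Definition quantized (L delta : R) (J : finType) (c : T -> J) phi :=
  forall p q, `|phi p| <= L -> `|phi q| <= L -> c p = c q ->
    `|phi p - phi q| <= delta.

(** The colour of [p] is the pattern of thresholds [i * delta - L] that [phi p] reaches. With
    patterns as colours, measurability reduces to that of superlevel sets. *)
Lemma quantize phi (L delta : R) : measurable_fun setT phi -> 0 < delta ->
  exists (J : finType) (c : T -> J),
    (forall i, measurable (c @^-1` [set i])) /\ quantized L delta c phi.
Proof.
move=> mphi d0.
pose t (i : nat) : R := i%:R * delta - L.
have [m hm] : exists m, L < t m.
  exists (Num.bound `|2 * L / delta|).
  have h1 : 2 * L / delta < (Num.bound `|2 * L / delta|)%:R.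
    by apply: le_lt_trans (ler_norm _) _; apply: archi_boundP.
  by move: h1; rewrite ltr_pdivrMr // /t; lra.
exists {ffun 'I_m.+1 -> bool}, (fun p => [ffun i : 'I_m.+1 => t i <= phi p]).
split.
  move=> f.
  rewrite (_ : _ @^-1` _ = ~` \bigcup_(i : 'I_m.+1) [set p | (t i <= phi p) != f i]); last first.
    apply/seteqP; split => p /=.
      by move=> e [i _] /=; rewrite -e ffunE eqxx.
    move=> h; apply/ffunP => i; rewrite ffunE; apply/eqP/negPn/negP => hi.
    by apply: h; exists i.
  apply: measurableC; apply: countable_bigcupT_measurable => // i.
  have mi : measurable [set p | t i <= phi p].
    rewrite (_ : [set _ | _] = phi @^-1` `[t i, +oo[).
      by rewrite -[X in measurable X]setTI; apply: mphi.
    by apply/seteqP; split => p /=; rewrite in_itv /= andbT.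
  case: (f i).
    rewrite (_ : [set _ | _] = ~` [set p | t i <= phi p]); first exact: measurableC.
    by apply/seteqP; split => p /=; case: (t i <= phi p).
  rewrite (_ : [set p | (t i <= phi p) != false] = [set p | t i <= phi p]) //.
  by apply/seteqP; split => p /=; case: (t i <= phi p).
have half p q : `|phi q| <= L -> `|phi p| <= L ->
    [ffun i : 'I_m.+1 => t i <= phi p] = [ffun i : 'I_m.+1 => t i <= phi q] ->
    phi p - phi q <= delta.
  move=> qL pL e; rewrite leNgt; apply/negP => h.
  have ex : exists i, phi q < t i by exists m; apply: le_lt_trans (ler_norm _) (le_lt_trans qL hm).
  (* The least threshold above [phi q] lies at most [delta] above it. If [phi p] exceeded [phi q] by
     more, it would reach this threshold and the patterns would differ at [i]. *)
  have [i ti imin] := ex_minnP ex.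
  have im : (i < m.+1)%N.
    by rewrite ltnS; apply: imin; apply: le_lt_trans (ler_norm _) (le_lt_trans qL hm).
  have tp : t i <= phi p.
    case: i ti imin im => [|i] ti imin im.
      move: ti; rewrite /t mul0r sub0r => ti; move: qL; rewrite ler_norml => /andP[qL _].
      by have := lt_le_trans ti qL; rewrite ltxx.
    have : t i <= phi q.
      by rewrite leNgt; apply/negP => /imin; rewrite ltnn.
    by rewrite /t -natr1; lra.
  have /ffunP /(_ (Ordinal im)) := e; rewrite !ffunE /= tp => /esym.
  by rewrite leNgt ti.
move=> p q pL qL e; rewrite ler_norml; apply/andP; split; last exact: half.
by have := half q p pL qL (esym e); lra.
Qed.

End Quantization.

(** * Both kernels treated together on the sets in_K *)

Section Kern.
Context {R : realType}.
Local Notation plane := (measurableTypeR R * measurableTypeR R)%type.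
Local Notation mu := (@plane_measure R).
Implicit Types (p : R * R) (x y : R) (z w : R[i]) (b : bool) (j k n : nat).

(* [b] selects the chart: the real line, or the neighbourhood of infinity. *)
Definition kern b z j x : R[i] := if b then omega_infty z j x else omega_family z j x.

Lemma is_cderive_kern b z j x : complex.Im z != 0 ->
  is_cderive x (1 : R) (kern b z j) (kern b z j.+1 x).
Proof.
by case: b => z0; [exact: is_cderive_omega_infty | exact: is_cderive_omega_family].
Qed.

Lemma kern_bound b z j x : complex.Im z != 0 ->
  cmod (kern b z j x) <= j`!%:R * tau z ^+ (j.*2.+1).
Proof.
by case: b => z0; [exact: omega_infty_bound | exact: omega_family_bound].
Qed.

(** Finitely many constants are added up to a single one, valid for both charts and all orders up to
    [k]. *)
Lemma kern_lipschitz n k : exists M : R, 0 <= M /\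
  forall b j z w x, (j <= k)%N -> in_K n z -> in_K n w ->
    cmod (kern b z j x) <= M /\ cmod (kern b z j x - kern b w j x) <= M * cmod (z - w).
Proof.
elim: k => [|k [M [M0 ih]]].
  have [M1 [M10 h1]] := @K_lipschitz_omega_infty R n 0.
  have [M2 [M20 h2]] := @K_lipschitz_omega_family R n 0.
  exists (M1 + M2); split; first exact: addr_ge0.
  move=> b j z w x; rewrite leqn0 => /eqP -> Kz Kw; rewrite mulrDl.
  case: b => /=; [have [a1 a2] := h1 z w Kz Kw x | have [a1 a2] := h2 z w Kz Kw x].
    by split; [rewrite (le_trans a1) // lerDl
              | rewrite (le_trans a2) // lerDl mulr_ge0 // cmod_ge0].
  by split; [rewrite (le_trans a1) // lerDr
            | rewrite (le_trans a2) // lerDr mulr_ge0 // cmod_ge0].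
have [M1 [M10 h1]] := @K_lipschitz_omega_infty R n k.+1.
have [M2 [M20 h2]] := @K_lipschitz_omega_family R n k.+1.
exists (M + (M1 + M2)); split; first by rewrite !addr_ge0.
move=> b j z w x; rewrite leq_eqVlt => /orP[/eqP -> | jk] Kz Kw.
  rewrite !mulrDl.
  have c := cmod_ge0 (z - w).
  have m0 := mulr_ge0 M0 c; have m1 := mulr_ge0 M10 c; have m2 := mulr_ge0 M20 c.
  case: b => /=; [have [a1 a2] := h1 z w Kz Kw x | have [a1 a2] := h2 z w Kz Kw x].
    by split; [rewrite (le_trans a1) | rewrite (le_trans a2)] => //; lra.
  by split; [rewrite (le_trans a1) | rewrite (le_trans a2)] => //; lra.
have [a1 a2] := ih b j z w x jk Kz Kw.
split; first by rewrite (le_trans a1) // lerDl addr_ge0.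
by rewrite (le_trans a2) // mulrDl lerDl mulr_ge0 ?cmod_ge0 // addr_ge0.
Qed.

Lemma cmeas_kern b j x : cmeas (fun p => kern b (toC p) j x).
Proof.
have mz : cmeas (fun p : R * R => 1 + toC p * x%:C).
  apply: cmeasD; first exact: cmeas_cst.
  by apply: cmeasM; [exact: cmeas_toC | exact: cmeas_cst].
have mw : cmeas (fun p : R * R => toC p - x%:C).
  by apply: cmeasB; [exact: cmeas_toC | exact: cmeas_cst].
case: b => /=.
  case: j => [|j] /=.
    by apply: cmeasM; [exact: cmeas_cst | exact: cmeasV].
  apply: cmeasM; last exact/cmeasV/cmeasX.
  apply: cmeasM; first exact: cmeas_cst.
  exact/cmeasX/cmeas_toC.
apply: cmeasM; first exact: cmeas_cst.
exact/cmeasV/cmeasX.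
Qed.

(** <z>^2 is at most n |Im z|, which is at most n |z| and so at most n^2; consequently [weight] is
    at least n^-4 here. *)
Lemma in_KE n p : in_K n (toC p) -> [/\ cmod (toC p) <= n%:R & br2 (toC p) <= n%:R ^+ 2].
Proof.
move=> [p0 tn]; have h : cmod (toC p) <= n%:R by rewrite (le_trans (tau_ge_cmod p0)).
split=> //; have i0 : 0 < `|complex.Im (toC p)| by rewrite normr_gt0.
move: tn; rewrite /tau ler_pdivrMr // => /le_trans; apply.
by rewrite expr2 ler_wpM2l // (le_trans (Im_cmod _)).
Qed.

Lemma measurable_in_K n : measurable ([set p | in_K n (toC p)] : set plane).
Proof.
have -> : [set p | in_K n (toC p)] =
   ~` [set p | p.2 = 0] `&` [set p : R * R | br2 (toC p) - n%:R * `|p.2| <= 0].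
  apply/seteqP; split => p /=.
    move=> [/eqP p0 tn]; split => //; rewrite subr_le0.
    by move: tn; rewrite /tau ler_pdivrMr // normr_gt0; apply/eqP.
  move=> [/eqP p0]; rewrite subr_le0 => h; split => //.
  by rewrite /tau ler_pdivrMr // normr_gt0.
apply: measurableI.
  apply: measurableC.
  rewrite (_ : [set _ | _] = setT `*` [set 0 : R]); last first.
    by apply/seteqP; split => -[a c] //= [].
  by apply: measurableX.
have c : continuous (fun p : R * R => br2 (toC p) - n%:R * `|p.2|).
  have s : smooth_fun (fun p : R * R => br2 (toC p)).
    apply: smooth_funD; first exact: smooth_fun_cst.
    apply: smooth_funD.
      exact: (smooth_funM (@smooth_fun_fst R) (@smooth_fun_fst R)).
    exact: (smooth_funM (@smooth_fun_snd R) (@smooth_fun_snd R)).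
  move=> p; apply: cvgB; first exact: (smooth_fun_continuous s).
  apply: cvgM; first exact: cvg_cst.
  by apply: cvg_norm; exact: cvg_snd.
rewrite (_ : [set _ | _] =
  (fun p : R * R => br2 (toC p) - n%:R * `|p.2|) @^-1` `]-oo, 0]); last first.
  by apply/seteqP; split => p /=; rewrite in_itv.
rewrite -[X in measurable X]setTI.
by apply: (continuous_plane_measurable c) => //; exact: measurable_itv.
Qed.

Lemma plane_measure_in_K n (S : set plane) : measurable S -> (forall p, S p -> in_K n (toC p)) ->
  (mu S < +oo)%E.
Proof.
move=> mS SK; apply: (@le_lt_trans _ _ (mu (`[- n%:R, n%:R]%classic `*` `[- n%:R, n%:R]%classic))).
  apply: le_measure; rewrite ?inE //.
    by apply: measurableX; exact: measurable_itv.
  move=> p /SK /in_KE[h _]; have [h1 h2] := cmod_le_tau p.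
  by split; rewrite /= in_itv /= -ler_norml; [rewrite (le_trans h1) | rewrite (le_trans h2)].
by rewrite plane_measure_square // ltry.
Qed.

End Kern.

(** * Fine partitions and the error of simple functions *)

Section Cells.
Context {R : realType}.
Local Notation plane := (measurableTypeR R * measurableTypeR R)%type.
Local Notation mu := (@plane_measure R).
Implicit Types (p : R * R) (x y : R) (b : bool) (j k n : nat).
Variables (f : R -> R[i]) (ft g : R[i] -> R[i]).
Hypothesis ext : extension f ft g.

(** The derivative of order [j] in chart [b] of the difference between [g(z) omega z] and the simple
    function with value [g(q i) omega (q i)] on [A i]. *)
Definition cell_error (J : finType) (A : J -> set (R * R)) (q : J -> R * R) b j p x : R[i] :=
  g (toC p) * kern b (toC p) j x -
  \sum_(i : J) (\1_(A i) p : R)%:C * (g (toC (q i)) * kern b (toC (q i)) j x).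

(** As [g] is only measurable, small squares would not control its oscillation. The cells are
    therefore common colour classes of four real functions, the real and imaginary parts of [z] and
    of [g]; each pair contributes 2 delta. *)
Lemma measurable_partition n (delta : R) : 0 < delta ->
  exists (J : finType) (A : J -> set plane),
   [/\ forall i, measurable (A i),
       forall i p, A i p -> in_K n (toC p),
       forall p, in_K n (toC p) -> exists i, A i p /\ forall i', A i' p -> i' = i
     & forall i p p', A i p -> A i p' -> cmod (toC p - toC p') <= 2 * delta /\
         cmod (g (toC p) - g (toC p')) <= 2 * delta].
Proof.
move=> d0; have [Mg hMg] := ext_dbar_bounded ext.
pose L := `|Mg| + n%:R.
have gL p : cmod (g (toC p)) <= L.
  have := hMg (toC p); rewrite norm_leC => /le_trans; apply.
  by rewrite (le_trans (ler_norm _)) // lerDl.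
have pL p : in_K n (toC p) -> cmod (toC p) <= L.
  by move=> /in_KE[h _]; rewrite (le_trans h) // lerDr.
have [mfst msnd] := @cmeas_toC R.
have [J1 [c1 [m1 q1]]] := quantize L mfst d0.
have [J2 [c2 [m2 q2]]] := quantize L msnd d0.
have [J3 [c3 [m3 q3]]] := quantize L (ext_measurable_Re ext) d0.
have [J4 [c4 [m4 q4]]] := quantize L (ext_measurable_Im ext) d0.
pose J := (J1 * J2 * J3 * J4)%type.
pose A (i : J) : set plane := [set p | in_K n (toC p)] `&`
  ((c1 @^-1` [set i.1.1.1] `&` c2 @^-1` [set i.1.1.2]) `&`
   (c3 @^-1` [set i.1.2] `&` c4 @^-1` [set i.2])).
exists J, A; split.
- move=> i; apply: measurableI; first exact: measurable_in_K.
  by apply: measurableI; apply: measurableI.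
- by move=> i p [].
- move=> p Kp; exists (c1 p, c2 p, c3 p, c4 p); split; first by split.
  by move=> [[[a b] c] e] [_ [[/= <- <-] [<- <-]]].
- move=> i p p' [Kp [[/= e1 e2] [e3 e4]]] [Kp' [[/= e1' e2'] [e3' e4']]].
  have [a1 a2] := cmod_le_tau p; have [b1 b2] := cmod_le_tau p'.
  have lp := pL p Kp; have lp' := pL p' Kp'.
  split.
    rewrite (le_trans (cmod_ReIm _)) // mulr_natl mulr2n lerD //.
      rewrite ReD ReN /=; apply: q1; rewrite ?(le_trans a1) ?(le_trans b1) //.
      by rewrite e1 e1'.
    rewrite ImD ImN /=; apply: q2; rewrite ?(le_trans a2) ?(le_trans b2) //.
    by rewrite e2 e2'.
  rewrite (le_trans (cmod_ReIm _)) // mulr_natl mulr2n lerD //.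
    rewrite ReD ReN /=; apply: q3; rewrite ?(le_trans (Re_cmod _)) //.
    by rewrite e3 e3'.
  rewrite ImD ImN /=; apply: q4; rewrite ?(le_trans (Im_cmod _)) //.
  by rewrite e4 e4'.
Qed.

(** On [in_K n.+1] the oscillation on a cell is made smaller than the weight divided by n+1. Off it
    the simple function vanishes, and the decay of [g] gains the same factor from tau > n+1. *)
Lemma cells k : exists C : R, 0 < C /\ forall n,
  exists (J : finType) (A : J -> set plane) (q : J -> R * R),
  [/\ forall i, measurable (A i) /\ (mu (A i) < +oo)%E,
      forall i, complex.Im (toC (q i)) != 0,
      forall i p, A i p -> complex.Im (toC p) != 0
    & forall b j p x, (j <= k)%N ->
       cmod (cell_error A q b j p x) <= C / n.+1%:R * weight (toC p)].
Proof.
(* One power more than the tau^(2k+1) that bounds the kernels; it pays for the factor 1/(n+1)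
   outside [in_K n.+1]. *)
have [C0 [C00 hC0]] := extension_decay (k.*2.+2) ext.
exists (1 + k`!%:R * C0); split; first by rewrite ltr_pwDl // mulr_ge0.
move=> n.
have [M [M0 hM]] := @kern_lipschitz R n.+1 k.
have [Mg hMg'] := ext_dbar_bounded ext.
have hMg z : cmod (g z) <= `|Mg|.
  by have := hMg' z; rewrite norm_leC => h; rewrite (le_trans h) // ler_norm.
pose B := 2 * (M * (1 + `|Mg|)) + 1.
have B0 : 0 < B by rewrite ltr_wpDl // !mulr_ge0 // addr_ge0.
have n0 : 0 < n.+1%:R :> R by rewrite ltr0n.
(* Of the five powers, four compensate the lower bound of the weight on [in_K n.+1] and one is the
   rate. [B] collects the Lipschitz constant and the bound of [g]; its summand 1 makes it
   positive. *)
pose delta := n.+1%:R ^- 5 / B.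
have d0 : 0 < delta by rewrite divr_gt0 // invr_gt0 exprn_gt0.
have [J [A [mA AK cov osc]]] := measurable_partition n.+1 d0.
(* An empty cell receives the point i, so that every [q i] is nonreal. *)
pose q i : R * R := xget (0, 1) (A i).
have qA i p : A i p -> A i (q i) by move=> h; exact: (xgetPex _ (ex_intro _ p h)).
exists J, A, q; split.
- by move=> i; split => //; apply: (@plane_measure_in_K _ n.+1) => // p; exact: AK.
- move=> i; have [[p /qA /AK [] //]|no] := pselect (exists p, A i p).
  rewrite /q xgetPN; last by move=> p hp; apply: no; exists p.
  by rewrite /= oner_neq0.
- by move=> i p /AK [].
- move=> b j p x jk; rewrite /cell_error.
  have C1 : 1 <= 1 + k`!%:R * C0 by rewrite lerDl mulr_ge0.
  have w0 := weight_gt0 (toC p).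
  have [Kp|nKp] := pselect (in_K n.+1 (toC p)).
    have [i [Ai uni]] := cov p Kp.
    rewrite (bigD1 i) //= big1 ?addr0; last first.
      move=> i' i'i; rewrite indicE memNset ?mul0r //.
      by move=> /uni e; move: i'i; rewrite e eqxx.
    rewrite indicE mem_set // mul1r.
    have [u1 u2] := osc i p (q i) Ai (qA i p Ai).
    have [l1 l2] := hM b j _ _ x jk Kp (AK i _ (qA i p Ai)).
    rewrite (_ : _ - _ = (g (toC p) - g (toC (q i))) * kern b (toC p) j x +
       g (toC (q i)) * (kern b (toC p) j x - kern b (toC (q i)) j x)); last by ring.
    rewrite (le_trans (cmodD _ _)) // !cmodM.
    have d2 : 0 <= 2 * delta by rewrite mulr_ge0 // ltW.
    apply: (@le_trans _ _ (2 * delta * M + `|Mg| * (M * (2 * delta)))).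
      rewrite lerD // ler_pM ?cmod_ge0 // ?mulr_ge0 ?cmod_ge0 //.
      by rewrite (le_trans l2) // ler_wpM2l.
    have -> : 2 * delta * M + `|Mg| * (M * (2 * delta)) = delta * (2 * (M * (1 + `|Mg|))) by ring.
    apply: (@le_trans _ _ (n.+1%:R ^- 5)).
      rewrite /delta mulrAC ler_pdivrMr // ler_wpM2l ?invr_ge0 ?exprn_ge0 //.
      by rewrite /B lerDl.
    have -> : n.+1%:R ^- 5 = 1 / n.+1%:R * n.+1%:R ^- 4 :> R.
      by rewrite [in LHS]exprS invfM mul1r.
    have wK : n.+1%:R ^- 4 <= weight (toC p).
      have [_ bp] := in_KE Kp.
      rewrite /weight lef_pV2 ?posrE ?exprn_gt0 ?br2_gt0 //.
      by rewrite (_ : 4 = 2 * 2)%N // exprM lerXn2r ?nnegrE ?exprn_ge0 // ltW // br2_gt0.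
    rewrite ler_pM ?divr_ge0 ?invr_ge0 ?exprn_ge0 //.
    by rewrite ler_wpM2r ?invr_ge0.
  rewrite big1 ?subr0; last first.
    by move=> i _; rewrite indicE memNset ?mul0r // => /AK.
  have [p0|p0] := eqVneq (complex.Im (toC p)) 0.
    rewrite (extension_real ext p0) mul0r cmod0.
    by apply: mulr_ge0 (ltW w0); apply: divr_ge0 => //; apply: le_trans C1.
  have tn : n.+1%:R < tau (toC p).
    by rewrite ltNge; apply/negP => h; apply: nKp.
  have t0 := tau_gt0 p0; have t1 := tau_ge1 p0.
  rewrite cmodM.
  apply: (@le_trans _ _ (cmod (g (toC p)) * (k`!%:R * tau (toC p) ^+ (k.*2.+1)))).
    rewrite ler_wpM2l ?cmod_ge0 // (le_trans (kern_bound b j x p0)) //.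
    rewrite ler_pM ?exprn_ge0 ?(ltW t0) //.
      by rewrite ler_nat leq_fact.
    by rewrite ler_weXn2l // ltnS leq_double.
  apply: (@le_trans _ _ ((k`!%:R * C0) / n.+1%:R * weight (toC p))); last first.
    by rewrite ler_wpM2r ?(ltW w0) // ler_wpM2r ?invr_ge0 // lerDr.
  rewrite mulrAC ler_pdivlMr //.
  rewrite (_ : _ * n.+1%:R =
    k`!%:R * (cmod (g (toC p)) * (tau (toC p) ^+ (k.*2.+1) * n.+1%:R))); last by ring.
  rewrite -[leRHS]mulrA ler_wpM2l // (le_trans _ (hC0 _ p0)) // ler_wpM2l ?cmod_ge0 //.
  by rewrite [leRHS]exprSr ler_wpM2l ?exprn_ge0 ?(ltW t0) ?(ltW tn).
Qed.

End Cells.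

(** * Derivatives and plane integrals of the error *)

Section CellErrorCalculus.
Context {R : realType}.
Local Notation plane := (measurableTypeR R * measurableTypeR R)%type.
Local Notation mu := (@plane_measure R).
Implicit Types (p : R * R) (x y : R) (z w : R[i]) (b : bool) (j k n : nat).

Lemma is_cderive_sum (I : Type) (s : seq I) (c : I -> R[i]) (F F' : I -> R -> R[i]) x :
  (forall i, is_cderive x (1 : R) (F i) (F' i x)) ->
  is_cderive x (1 : R) (fun y => \sum_(i <- s) c i * F i y) (\sum_(i <- s) c i * F' i x).
Proof.
move=> h; elim: s => [|i s ih].
  under [fun y => _]eq_fun do rewrite big_nil.
  by rewrite big_nil; exact: is_cderive_cst.
under [fun y => _]eq_fun do rewrite big_cons.
rewrite big_cons; apply: is_cderiveD ih; apply: is_cderive_eq.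
  exact: is_cderiveM (is_cderive_cst x (1 : R) (c i)) (h i).
by rewrite mul0r addr0.
Qed.

Lemma cmeas_sum (I : Type) (s : seq I) (F : I -> R * R -> R[i]) :
  (forall i, cmeas (F i)) -> cmeas (fun p => \sum_(i <- s) F i p).
Proof.
move=> h; elim: s => [|i s ih].
  by under [fun p => _]eq_fun do rewrite big_nil; exact: cmeas_cst.
by under [fun p => _]eq_fun do rewrite big_cons; exact: cmeasD.
Qed.

Lemma plane_integral_sum (I : Type) (s : seq I) (F : I -> R * R -> R[i]) :
  (forall i, cint (F i)) -> cint (fun p => \sum_(i <- s) F i p) /\
  plane_integral (fun p => \sum_(i <- s) F i p) = \sum_(i <- s) plane_integral (F i).
Proof.
move=> h; elim: s => [|i s [ih1 ih2]].
  under [fun p => _]eq_fun do rewrite big_nil; rewrite big_nil; split.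
    by split; rewrite (_ : _ \o _ = cst 0%E); [exact: integrable0| |exact: integrable0|].
  by apply: complex_ext; rewrite /= /Rintegral integral0.
under [fun p => _]eq_fun do rewrite big_cons; rewrite big_cons.
by split; [exact: cintD | rewrite plane_integralD // ih2].
Qed.

Lemma plane_integral_indic (A : set plane) : measurable A -> (mu A < +oo)%E ->
  cint (fun p => (\1_A p : R)%:C) /\
  plane_integral (fun p => (\1_A p : R)%:C) = (fine (mu A))%:C.
Proof.
move=> mA fA; have iA : (\int[mu]_p ((\1_A p : R)%:E) = mu A)%E.
  by rewrite integral_indic // setIT.
split; last first.
  apply: complex_ext => /=; first by rewrite /Rintegral iA.
  by rewrite /Rintegral integral0.
split; last by rewrite (_ : _ \o _ = cst 0%E); [exact: integrable0 | apply/funext].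
apply/integrableP; split; first exact/measurable_EFinP/measurable_indic.
under eq_integral => p _ do rewrite /= ger0_norm //.
by rewrite iA.
Qed.

Variables (f : R -> R[i]) (ft g : R[i] -> R[i]).
Hypothesis ext : extension f ft g.

Lemma is_cderive_ext_kern b j p x : is_cderive x (1 : R)
  (fun y => g (toC p) * kern b (toC p) j y) (g (toC p) * kern b (toC p) j.+1 x).
Proof.
have [p0|p0] := eqVneq (complex.Im (toC p)) 0.
  rewrite (extension_real ext p0) mul0r.
  by under [fun y => _]eq_fun do rewrite mul0r; exact: is_cderive_cst.
apply: is_cderive_eq.
  exact: is_cderiveM (is_cderive_cst x (1 : R) (g (toC p))) (is_cderive_kern b j x p0).
by rewrite mul0r addr0.
Qed.

Section Error.
Variables (J : finType) (A : J -> set (R * R)) (q : J -> R * R).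
Local Notation err := (cell_error g A q).

Lemma cell_errorE b j p x : err b j p x =
  (-1) * (\sum_(i : J) ((\1_(A i) p : R)%:C * g (toC (q i))) * kern b (toC (q i)) j x)
  + g (toC p) * kern b (toC p) j x.
Proof.
rewrite /cell_error mulN1r addrC; congr (- _ + _).
by apply: eq_bigr => i _; rewrite mulrA.
Qed.

Lemma is_cderive_cell_error b j p x :
  is_cderive x (1 : R) (err b j p) (err b j.+1 p x).
Proof.
rewrite [X in is_cderive _ _ X](_ : _ = (fun y =>
  (-1) * (\sum_(i : J) (\1_(A i) p : R)%:C * (g (toC (q i)) * kern b (toC (q i)) j y))
  + g (toC p) * kern b (toC p) j y)); last first.
  by apply/funext => y; rewrite /cell_error mulN1r addrC.
apply: is_cderive_eq.
  apply: is_cderiveD (is_cderive_ext_kern b j p x).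
  apply: is_cderiveM (is_cderive_cst x (1 : R) (-1)) _.
  apply: (@is_cderive_sum _ _ _ (fun i y => g (toC (q i)) * kern b (toC (q i)) j y)
    (fun i y => g (toC (q i)) * kern b (toC (q i)) j.+1 y)) => i.
  exact: is_cderive_ext_kern.
by rewrite mul0r addr0 /cell_error mulN1r addrC.
Qed.

Hypothesis mA : forall i, measurable (A i : set plane) /\ (mu (A i) < +oo)%E.

Lemma cmeas_cell_error b j x : cmeas (fun p => err b j p x).
Proof.
apply: cmeasB.
  by apply: cmeasM; [exact: (cmeas_ext_dbar ext) | exact: cmeas_kern].
apply: cmeas_sum => i; apply: cmeasM; last exact: cmeas_cst.
by have [mAi _] := mA i; apply: cmeas_real; exact: (measurable_indic (D := setT) mAi).
Qed.

Lemma cint_ext_kern b x : cint (fun p => g (toC p) * kern b (toC p) 0 x).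
Proof.
have [C [C0 hC]] := extension_decay 1 ext.
have [] // := @cint_weight _ (fun p => g (toC p) * kern b (toC p) 0 x) C.
  by apply: cmeasM; [exact: (cmeas_ext_dbar ext) | exact: cmeas_kern].
move=> p; have [p0|p0] := eqVneq (complex.Im (toC p)) 0.
  rewrite (extension_real ext p0) mul0r cmod0.
  exact: mulr_ge0 (ltW (weight_gt0 _)).
rewrite cmodM (le_trans _ (hC _ p0)) // ler_wpM2l ?cmod_ge0 //.
by have := kern_bound b 0 x p0; rewrite fact0 mul1r.
Qed.

Lemma plane_integral_cell_error b x : plane_integral (fun p => err b 0 p x) =
  plane_integral (fun p => g (toC p) * kern b (toC p) 0 x) -
  \sum_(i : J) (fine (mu (A i)))%:C * g (toC (q i)) * kern b (toC (q i)) 0 x.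
Proof.
have H i : cint (fun p => (\1_(A i) p : R)%:C * (g (toC (q i)) * kern b (toC (q i)) 0 x)) /\
   plane_integral (fun p => (\1_(A i) p : R)%:C * (g (toC (q i)) * kern b (toC (q i)) 0 x)) =
   (fine (mu (A i)))%:C * g (toC (q i)) * kern b (toC (q i)) 0 x.
  have [mAi fAi] := mA i; have [h1 h2] := plane_integral_indic mAi fAi.
  under [fun p => _]eq_fun do rewrite mulrC; split; first exact: cintZ.
  by rewrite plane_integralZ // h2; ring.
have [s1 s2] := plane_integral_sum (index_enum J) (fun i => (H i).1).
rewrite /cell_error plane_integralB //; last exact: cint_ext_kern.
by rewrite s2; congr (_ - _); apply: eq_bigr => i _; rewrite (H i).2.
Qed.

End Error.

Lemma kern0 z x : kern false z 0 x = omega z x.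
Proof. by rewrite /kern /omega_family mul1r expr1. Qed.

(** In the chart at infinity the formula at nonzero [y] is the one at -1/y. At [y = 0] the kernel
    y/(1+zy) vanishes, and so does the right-hand side, because [at_infty f 0] is the limit of
    [f]. *)
Lemma cauchy_pompeiu_chart b x : spaceE f ->
  plane_integral (fun p => g (toC p) * kern b (toC p) 0 x) =
  (- pi%:C) * (if b then at_infty f x else f x) + pi%:C * lim_infty f.
Proof.
move=> Ef; have CP y : plane_integral (fun p => g (toC p) * omega (toC p) y) =
    (- pi%:C) * f y + pi%:C * lim_infty f.
  by rewrite -(cauchy_pompeiu ext y Ef); ring.
case: b; last first.
  by rewrite -CP; congr plane_integral; apply/funext => p; rewrite kern0.
rewrite /at_infty; case: eqP => [->|/eqP x0].
  rewrite mulNr addNr (_ : (fun p => _) = (fun=> 0)).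
    by apply: complex_ext; rewrite /= /Rintegral integral0.
  by apply/funext => p; rewrite /kern /omega_infty mul0r mulr0.
rewrite -CP; congr plane_integral; apply/funext => p.
have [p0|p0] := eqVneq (complex.Im (toC p)) 0.
  by rewrite (extension_real ext p0) !mul0r.
by rewrite /kern -(at_infty_omega p0) /at_infty (negbTE x0).
Qed.

End CellErrorCalculus.

Section BochnerTools.
Context {R : realType} {B : completeNormedModType R[i]}.
Local Notation plane := (measurableTypeR R * measurableTypeR R)%type.

(* The integral of a nonnegative function is a supremum over the simple functions
   below it, hence monotone without any measurability. *)
Lemma ge0_le_integral_nonmeasurable d (T : measurableType d) (mu : {measure set T -> \bar R})
  (F G : T -> \bar R) : (forall t, 0 <= F t)%E -> (forall t, F t <= G t)%E ->
  (\int[mu]_t F t <= \int[mu]_t G t)%E.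
Proof.
move=> F0 FG; have G0 t : (0 <= G t)%E by exact: le_trans (F0 t) (FG t).
rewrite !ge0_integralTE //; apply: ereal_sup_le => _ [h hF <-].
by exists h => // t; exact: le_trans (hF t) (FG t).
Qed.

Lemma squeeze_ereal (u : nat -> \bar R) (C : R) : (forall n, 0 <= u n)%E ->
  (forall n, u n <= (C / n.+1%:R)%:E)%E -> u n @[n --> \oo] --> 0%E.
Proof.
move=> u0 uC.
apply: (@squeeze_cvge _ _ _ _ (fun=> 0%E) _ (fun n => (C / n.+1%:R)%:E)).
- by near=> n; rewrite u0 uC.
- exact: cvg_cst.
- apply: cvg_EFin; first by near=> n.
  rewrite -(mulr0 C); apply: cvgM; first exact: cvg_cst.
  exact: cvg_harmonic.
Unshelve. all: by end_near. Qed.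

Lemma bounded_opsZ (c : R[i]) (T : B -> B) : bounded_ops T -> bounded_ops (c *: T).
Proof.
move=> [lT cT]; split.
  move=> a u v; change (c *: T (a *: u + v) = a *: (c *: T u) + c *: T v).
  by rewrite lT scalerDr !scalerA mulrC.
by move=> u; exact: (cvgZ (cvg_cst c) (cT u)).
Qed.

End BochnerTools.

(** * The Bochner integral *)

Section Assembly.
Context {R : realType} {B : completeNormedModType R[i]}.
Local Notation plane := (measurableTypeR R * measurableTypeR R)%type.
Local Notation mu := (@plane_measure R).
Variable Op : (R -> R[i]) -> B -> B.
Hypothesis Op_bounded : forall f, spaceE f -> bounded_ops (Op f).
Hypothesis Op_linear : forall (a : R[i]) f1 f2, spaceE f1 -> spaceE f2 ->
  Op (fun x => a * f1 x + f2 x) = (fun u => a *: Op f1 u + Op f2 u).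
Hypothesis Op_continuous : continuous_on_E Op.
Hypothesis Op_mul : forall f1 f2, spaceE f1 -> spaceE f2 ->
  (fun u => Op f1 (Op f2 u)) = Op (fun x => f1 x * f2 x).
Hypothesis Op_ker : forall u : B, (forall g, Cc_infty g -> Op g u = 0) -> u = 0.
Variables (f : R -> R[i]) (ft g : R[i] -> R[i]).
Hypothesis Ef : spaceE f.
Hypothesis ext : extension f ft g.

Let F (p : R * R) : B -> B := g (toC p) *: resolvent (generated_op Op) (toC p).

(** This is pi (a_0 - f), by Cauchy-Pompeiu the plane integral of [g(z) omega z], in the form to
    which linearity of [Op] applies. *)
Let e1 (x : R) : R[i] := (- pi%:C) * f x + pi%:C * lim_infty f.

Let Ee1 : spaceE e1.
Proof. by apply: spaceE_lin => //; exact: spaceE_cst. Qed.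

Section Approximant.
Variables (J : finType) (A : J -> set plane) (q : J -> R * R).
Hypothesis mA : forall i, measurable (A i) /\ (mu (A i) < +oo)%E.
Hypothesis q0 : forall i, complex.Im (toC (q i)) != 0.
Hypothesis A0 : forall i p, A i p -> complex.Im (toC p) != 0.
Variables (k : nat) (c : R).
Hypothesis c0 : 0 < c.
Hypothesis err : forall b j p x, (j <= k.+1)%N ->
  cmod (cell_error g A q b j p x) <= c * weight (toC p).

Let Eomega i : spaceE (omega (toC (q i))). Proof. exact: spaceE_omega. Qed.

Definition cell_op : simple_op (B := B) mu :=
  @SimpleOp _ _ R B mu #|J| (fun i => A (enum_val i))
    (fun i => g (toC (q (enum_val i))) *: Op (omega (toC (q (enum_val i)))))
    (fun i => (mA (enum_val i)).1) (fun i => (mA (enum_val i)).2)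
    (fun i => bounded_opsZ _ (Op_bounded (Eomega _))).

Lemma so_fun_cell_op p u : so_fun cell_op p u =
  \sum_(i : J) ((\1_(A i) p : R)%:C * g (toC (q i))) *: Op (omega (toC (q i))) u.
Proof.
rewrite /so_fun fct_sumE /=.
rewrite (big_enum_val (A := J)
  (fun i => ((\1_(A i) p : R)%:C * g (toC (q i))) *: Op (omega (toC (q i))) u)).
by apply: eq_bigr => i _; rewrite -scalerA.
Qed.

Lemma so_integral_cell_op u : so_integral cell_op u =
  \sum_(i : J) ((fine (mu (A i)))%:C * g (toC (q i))) *: Op (omega (toC (q i))) u.
Proof.
rewrite /so_integral fct_sumE /=.
rewrite (big_enum_val (A := J)
  (fun i => ((fine (mu (A i)))%:C * g (toC (q i))) *: Op (omega (toC (q i))) u)).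
by apply: eq_bigr => i _; rewrite -scalerA.
Qed.

Let Ecomb (a : J -> R[i]) : spaceE (fun x => \sum_(i : J) a i * omega (toC (q i)) x).
Proof. exact: spaceE_sum. Qed.

Let Op_comb (a : J -> R[i]) u : Op (fun x => \sum_(i : J) a i * omega (toC (q i)) x) u =
  \sum_(i : J) a i *: Op (omega (toC (q i))) u.
Proof. exact: (Op_sum Op_linear (index_enum J) a u Eomega). Qed.

Lemma at_infty_comb (a : J -> R[i]) :
  at_infty (fun x => \sum_(i : J) a i * omega (toC (q i)) x) =
  (fun y => \sum_(i : J) a i * kern true (toC (q i)) 0 y).
Proof.
rewrite at_infty_sum //; apply/funext => y; apply: eq_bigr => i _.
by rewrite at_infty_omega.
Qed.

Lemma cell_error_lin p : cell_error g A q false 0 p = (fun x =>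
  (-1) * (\sum_(i : J) ((\1_(A i) p : R)%:C * g (toC (q i))) * omega (toC (q i)) x)
  + g (toC p) * omega (toC p) x).
Proof.
apply/funext => x; rewrite cell_errorE kern0; congr (_ * _ + _).
by apply: eq_bigr => i _; rewrite kern0.
Qed.

Lemma E_bound_cell_error p : complex.Im (toC p) != 0 ->
  spaceE (cell_error g A q false 0 p) /\
  E_bound k (c * weight (toC p)) (cell_error g A q false 0 p).
Proof.
move=> p0; have Eg : spaceE (fun x => g (toC p) * omega (toC p) x).
  by apply: spaceEZ; exact: spaceE_omega.
split; first by rewrite cell_error_lin; exact: spaceE_lin.
split.
  exists (fun j => cell_error g A q false j p); split => //.
    by move=> j x _; exact: (is_cderive_cell_error ext).
  by move=> j x jk; apply: err; exact: leqW.
have -> : at_infty (cell_error g A q false 0 p) = cell_error g A q true 0 p.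
  rewrite cell_error_lin at_infty_lin // at_infty_comb.
  have -> : at_infty (fun x => g (toC p) * omega (toC p) x) =
      (fun y => g (toC p) * kern true (toC p) 0 y).
    by rewrite at_inftyZ ?at_infty_omega //; exact: spaceE_omega.
  by apply/funext => y; rewrite cell_errorE.
exists (fun j => cell_error g A q true j p); split => //.
  by move=> j x _; exact: (is_cderive_cell_error ext).
by move=> j x jk; apply: err; exact: leqW.
Qed.

Variable C : R.
Hypothesis C0 : 0 < C.
Hypothesis OpC : forall t h, 0 < t -> spaceE h -> E_bound k t h ->
  (opnorm (Op h) <= (C * t)%:E)%E.

(** Off the axis the difference is [Op] of the error function, because [resolvent] is
    [Op (omega z)]. On the axis both terms vanish: [g] is 0 there and no cell meets it. *)
Lemma opnorm_cell_error p : (opnorm (F p - so_fun cell_op p)%R <= (C * (c * weight (toC p)))%:E)%E.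
Proof.
have [p0|p0] := eqVneq (complex.Im (toC p)) 0.
  apply: opnorm_le => u _.
  have -> : (F p - so_fun cell_op p)%R u = 0.
    change (F p u - so_fun cell_op p u = 0).
    rewrite so_fun_cell_op big1 ?subr0.
      by rewrite /F (extension_real ext p0); exact: scale0r.
    move=> i _; rewrite indicE memNset ?mul0r ?scale0r // => /A0.
    by rewrite p0 eqxx.
  rewrite /rnorm normr0; apply: mulr_ge0 (ltW C0) _.
  exact: mulr_ge0 (ltW c0) (ltW (weight_gt0 _)).
have [Ee be] := E_bound_cell_error p0.
have -> : (F p - so_fun cell_op p)%R = Op (cell_error g A q false 0 p).
  apply/funext => u; change (F p u - so_fun cell_op p u = Op (cell_error g A q false 0 p) u).
  rewrite so_fun_cell_op cell_error_lin (Op_lin Op_linear) //; last first.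
    by apply: spaceEZ; exact: spaceE_omega.
  rewrite (Op_comb (fun i => (\1_(A i) p : R)%:C * g (toC (q i)))) (Op_scale Op_linear) //;
    last exact: spaceE_omega.
  rewrite scaleN1r addrC; congr (_ + _).
  by rewrite /F (resolvent_generated Op_bounded Op_linear Op_mul Op_ker p0).
by apply: OpC => //; apply: mulr_gt0 => //; exact: weight_gt0.
Qed.

(** In each chart, [e1] minus the sum over the cells is the plane integral of [cell_error], so its
    derivatives are bounded under the integral sign. This identifies the Bochner integral as
    [Op e1]. *)
Lemma opnorm_integral_error : (opnorm (Op e1 - so_integral cell_op)%R <= (C * (2 * (c * pi)))%:E)%E.
Proof.
pose a i := (fine (mu (A i)))%:C * g (toC (q i)).
pose h x := (-1) * (\sum_(i : J) a i * omega (toC (q i)) x) + e1 x.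
have Eh : spaceE h by exact: spaceE_lin.
have -> : (Op e1 - so_integral cell_op)%R = Op h.
  apply/funext => u; change (Op e1 u - so_integral cell_op u = Op h u).
  rewrite so_integral_cell_op [Op h u](Op_lin Op_linear) // (Op_comb a).
  by rewrite scaleN1r addrC.
apply: OpC => //; first by rewrite !mulr_gt0 // pi_gt0.
have bD b : Ck_bound k (2 * (c * pi)) (fun x => plane_integral (fun p => cell_error g A q b 0 p x)).
  apply: (@Ck_bound_integral _ k c (fun j p x => cell_error g A q b j p x)); first exact: ltW.
  - by move=> j x _; exact: (cmeas_cell_error ext).
  - by move=> j p x _; exact: (is_cderive_cell_error ext).
  - by move=> j p x jk; exact: err.
split.
  have := bD false; congr Ck_bound; apply/funext => x.
  rewrite (plane_integral_cell_error ext) // (cauchy_pompeiu_chart ext) //.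
  rewrite /h mulN1r addrC; congr (- _ + _).
  by apply: eq_bigr => i _; rewrite kern0.
have := bD true; congr Ck_bound; apply/funext => x.
rewrite (plane_integral_cell_error ext) // (cauchy_pompeiu_chart ext) //.
rewrite /h at_infty_lin // at_infty_comb mulN1r addrC; congr (- _ + _).
by rewrite /e1 at_infty_lin ?at_infty_cst //; exact: spaceE_cst.
Qed.

End Approximant.

Lemma bochner_functional_calculus :
  is_bochner_integral mu F (Op e1).
Proof.
split; first exact: Op_bounded.
have [k [C [C0 OpC]]] := Op_norm_bound Op_linear Op_continuous.
(* Order [k.+1], since [Ck_bound_integral] takes bounds up to one order beyond the one it
   concludes. *)
have [D [D0 HD]] := cells ext k.+1.
have : forall n, exists s : simple_op (B := B) mu,
    (forall p, opnorm (F p - so_fun s p)%R <= (C * (D / n.+1%:R * weight (toC p)))%:E)%E /\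
    (opnorm (Op e1 - so_integral s)%R <= (C * (2 * (D / n.+1%:R * pi)))%:E)%E.
  move=> n; have [J [A [q [mA q0 A0 err]]]] := HD n.
  have c0 : 0 < D / n.+1%:R by rewrite divr_gt0.
  exists (cell_op mA q0); split.
    by move=> p; exact: (@opnorm_cell_error J A q mA q0 A0 k _ c0 err C C0 OpC).
  exact: (@opnorm_integral_error J A q mA q0 k _ c0 err C OpC).
move=> /choice[s hs].
exists s; split.
- exists [set p | p.2 = 0]; split.
  + rewrite (_ : [set p : plane | p.2 = 0] = setT `*` [set 0 : R]).
      by apply: measurableX.
    by apply/seteqP; split => -[x y] //= [].
  + exact: plane_measure_axis.
  + move=> p /= np; apply/eqP/negPn/negP => pn0; apply: np.
    have p0 : complex.Im (toC p) != 0 by [].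
    split.
      apply: bounded_opsZ; rewrite (resolvent_generated Op_bounded Op_linear Op_mul Op_ker p0).
      exact/Op_bounded/spaceE_omega.
    apply: (@squeeze_ereal _ _ (C * D * weight (toC p))) => n; first exact: opnorm_ge0.
    apply: le_trans ((hs n).1 p) _; rewrite lee_fin le_eqVlt; apply/orP; left; apply/eqP.
    by ring.
- apply: (@squeeze_ereal _ _ (C * D * pi)) => n.
    by apply: integral_ge0 => p _; exact: opnorm_ge0.
  apply: (@le_trans _ _ (\int[mu]_p ((C * (D / n.+1%:R)) * rho 1 0 p)%:E)%E).
    apply: ge0_le_integral_nonmeasurable => p; first exact: opnorm_ge0.
    by apply: le_trans ((hs n).1 p) _; rewrite weight_rho lee_fin mulrA.
  under eq_integral => p _ do rewrite EFinM.
  rewrite ge0_integralZl_EFin //.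
  + rewrite integral_rho // -EFinM lee_fin le_eqVlt; apply/orP; left; apply/eqP; ring.
  + by move=> p _; rewrite lee_fin rho_ge0.
  + by apply/measurable_EFinP; exact: measurable_rho.
  + by rewrite mulr_ge0 ?divr_ge0 // ltW.
- apply: (@squeeze_ereal _ _ (C * (2 * (D * pi)))) => n; first exact: opnorm_ge0.
  apply: le_trans (hs n).2 _; rewrite lee_fin le_eqVlt; apply/orP; left; apply/eqP.
  by ring.
Qed.

(** The relation e1 = pi (a_0 - f) is solved for [f] under [Op], a constant being sent to that
    multiple of the identity. *)
Lemma Op_functional_calculus u :
  Op f u = lim_infty f *: u - (pi^-1)%:C *: Op e1 u.
Proof.
have pi0 : pi%:C != 0 :> R[i] by rewrite -cmod_eq0 cmodR normr_eq0 gt_eqF // pi_gt0.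
rewrite (Op_lin Op_linear) //; last exact: spaceE_cst.
rewrite (Op_cst Op_bounded Op_linear Op_mul Op_ker) scalerDr !scalerA opprD.
rewrite fmorphV mulrN !mulrA mulVf //.
by rewrite scaleN1r opprK mul1r addrCA subrr addr0.
Qed.

End Assembly.

Theorem proposition11p3 (R : realType) (B : completeNormedModType R[i])
  (Op : (R -> R[i]) -> B -> B)
  (Op_bounded : forall f, spaceE f -> bounded_ops (Op f))
  (Op_linear : forall (a : R[i]) f1 f2, spaceE f1 -> spaceE f2 ->
     Op (fun x => a * f1 x + f2 x) = (fun u => a *: Op f1 u + Op f2 u))
  (Op_continuous : continuous_on_E Op)
  (Op_mul : forall f1 f2, spaceE f1 -> spaceE f2 ->
     (fun u => Op f1 (Op f2 u)) = Op (fun x => f1 x * f2 x))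
  (Op_dense : dense (span_ranges Op))
  (Op_ker : forall u : B, (forall g, Cc_infty g -> Op g u = 0) -> u = 0) :
  forall f, spaceE f ->
  forall ft g, extension f ft g ->
    is_functional_calculus (generated_op Op) f g (Op f).
Proof.
move=> f Ef ft g ext.
exists (Op (fun x => (- pi%:C)%C * f x + (pi%:C)%C * lim_infty f)); split.
  exact: (bochner_functional_calculus Op_bounded Op_linear Op_continuous Op_mul Op_ker Ef ext).
apply/funext => u.
exact: (Op_functional_calculus Op_bounded Op_linear Op_mul Op_ker Ef).
Qed.
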